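(* Let $\{A,T,V,C,Q\}$ be a data set for the GNCL problem. Then the solutions of the GNCL problem (the contractive interpolants for $A$) are exactly the operators $$B=\begin{bmatrix} A \\ \Gamma D_A \end{bmatrix}:\mathcal X\to\mathcal H\oplus[\mathcal D\otimes F^2(H_n)],$$ where $\Gamma:\mathcal D_A\to\mathcal D\otimes F^2(H_n)$ is the symbol of a free holomorphic function $\Theta\in H^2_{\bf ball}(B(\mathcal D_A,\mathcal D))$ given by $$\Theta(Z)=L(Z)\Big[I_{\mathcal D_A\otimes\mathcal Z}-\sum_{i=1}^n(I_{\mathcal D_A}\otimes Z_i)M_i(Z)\Big]^{-1}\quad\text{for } Z=(Z_1,\dots,Z_n)\in[B(\mathcal Z)^n]_1,$$ where $\begin{bmatrix} L \\ M_1 \\ \vdots \\ M_n \end{bmatrix}$ is an arbitrary element of the noncommutative Schur class $\mathcal S_{\bf ball}^\Omega(B(\mathcal D_A,\mathcal D\oplus\mathcal D_A^{(n)}))$.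
   Context: Fock space and function spaces. Let $n\ge1$; $\mathbb F_n^+$ is the free unital semigroup on $g_1,\dots,g_n$ with identity $g_0$, $|\alpha|$ is word length, $\tilde\alpha=g_{i_k}\cdots g_{i_1}$ is the reverse of $\alpha=g_{i_1}\cdots g_{i_k}$, and $X_\alpha=X_{i_1}\cdots X_{i_k}$, $X_{g_0}=I$. $F^2(H_n)=\mathbb C1\oplus\bigoplus_{k\ge1}H_n^{\otimes k}$ is the full Fock space of an $n$-dimensional complex Hilbert space $H_n$ with orthonormal basis $e_1,\dots,e_n$; $e_\alpha=e_{i_1}\otimes\cdots\otimes e_{i_k}$, $e_{g_0}=1$; $S_i\varphi=e_i\otimes\varphi$. $\mathcal Z$ is an infinite dimensional Hilbert space, $[B(\mathcal Z)^n]_1=\{(Z_1,\dots,Z_n)\in B(\mathcal Z)^n:\|\sum_iZ_iZ_i^*\|^{1/2}<1\}$. For Hilbert spaces $\mathcal M,\mathcal L$, a free holomorphic function with coefficients in $B(\mathcal M,\mathcal L)$ is a map $\Phi(Z)=\sum_{k}\sum_{|\alpha|=k}C_{(\alpha)}\otimes Z_\alpha$ on $[B(\mathcal Z)^n]_1$ with $C_{(\alpha)}\in B(\mathcal M,\mathcal L)$ and $\limsup_k\|\sum_{|\alpha|=k}C_{(\alpha)}^*C_{(\alpha)}\|^{1/2k}\le1$. It is in $H^2_{\bf ball}(B(\mathcal M,\mathcal L))$ if $\sum_\alpha C_{(\alpha)}^*C_{(\alpha)}\le cI$ for some $c>0$, and its symbol is then $\Gamma:\mathcal M\to\mathcal L\otimes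 F^2(H_n)$, $\Gamma x=\sum_\alpha C_{(\alpha)}x\otimes e_{\tilde\alpha}$. $\|\Phi\|_\infty=\sup_Z\|\Phi(Z)\|$. For a closed subspace $\mathcal N\subset\mathcal M$ and $D\in B(\mathcal N,\mathcal L)$, $\Phi|_{\mathcal N}=D$ means $C_{(g_0)}|_{\mathcal N}=D$ and $C_{(\alpha)}|_{\mathcal N}=0$ for $|\alpha|\ge1$. $\mathcal M^{(n)}$ is the direct sum of $n$ copies of $\mathcal M$. For a contraction $A$, $D_A=(I-A^*A)^{1/2}$ and $\mathcal D_A$ is the closure of its range. Data set and the GNCL problem. $T=(T_1,\dots,T_n)$, $T_i\in B(\mathcal H)$, is a row contraction ($\sum_iT_iT_i^*\le I$), $\Delta_T=([\delta_{ij}I_{\mathcal H}-T_i^*T_j]_{n\times n})^{1/2}\in B(\mathcal H^{(n)})$, $\mathcal D=\overline{\Delta_T\mathcal H^{(n)}}$. $V=(V_1,\dots,V_n)$ is the minimal isometric dilation of $T$ on $\mathcal K=\mathcal H\oplus[\mathcal D\otimes F^2(H_n)]$ given by $V_i=\begin{bmatrix} T_i & 0 \\ \Delta_i & I_{\mathcal D}\otimes S_i \end{bmatrix}$, where $\Delta_ih=\Delta_T(0,\dots,0,h,0,\dots,0)\otimes1$ ($h$ in position $i$). $Q_i,C_i\in B(\mathcal G_i,\mathcal X)$, $i=1,\dots,n$ ($\mathcal G_i,\mathcal X$ Hilbert spaces), satisfy $[\delta_{ij}C_i^*C_j]_{n\times n}\le[Q_i^*Q_j]_{n\times n}$, and $A\in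 B(\mathcal X,\mathcal H)$ is a contraction with $T_iAC_i=AQ_i$ for all $i$; $Q=(Q_1,\dots,Q_n)$, $C=(C_1,\dots,C_n)$. A contractive interpolant for $A$ (solution of the GNCL problem) is a contraction $B\in B(\mathcal X,\mathcal K)$ with $P_{\mathcal H}B=A$ and $V_iBC_i=BQ_i$, $i=1,\dots,n$, where $P_{\mathcal H}$ is the orthogonal projection of $\mathcal K$ onto $\mathcal H$. The class $\mathcal S^\Omega_{\bf ball}$. Let $\mathcal F=\overline{\{\sum_{i=1}^nD_AQ_iy_i:y_i\in\mathcal G_i\}}\subset\mathcal D_A$ and let $\Omega=\begin{bmatrix} \Omega_1 \\ \Omega_2 \end{bmatrix}:\mathcal F\to\mathcal D\oplus\mathcal D_A^{(n)}$ be the (well-defined) contraction with $\Omega_1(\sum_iD_AQ_iy_i)=\Delta_T(\oplus_{i=1}^nAC_iy_i)$, $\Omega_2(\sum_iD_AQ_iy_i)=\oplus_{i=1}^nD_AC_iy_i$. $\mathcal S^\Omega_{\bf ball}(B(\mathcal D_A,\mathcal D\oplus\mathcal D_A^{(n)}))$ is the set of free holomorphic functions $\Psi$ with coefficients in $B(\mathcal D_A,\mathcal D\oplus\mathcal D_A^{(n)})$ with $\|\Psi\|_\infty\le1$ and $\Psi|_{\mathcal F}=\Omega$. *)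

(* Defs.v *)
From HB Require Import structures.
From mathcomp Require Import all_boot all_order all_algebra finmap complex.
From mathcomp Require Import ring lra.
From mathcomp Require Import mathcomp_extra boolp classical_sets functions cardinality reals ereal.
From mathcomp Require Import topology normedtype sequences exp.
From mathcomp.analysis.showcase Require Import summability.
Set Implicit Arguments.
Unset Strict Implicit.
Unset Printing Implicit Defensive.
Import Order.TTheory GRing.Theory Num.Theory.
Import numFieldNormedType.Exports.
Local Open Scope classical_set_scope.
Local Open Scope ring_scope.

(* The inner product is linear in its first argument.  The norm of a normed
   module over R[i] takes its values in R[i]; hnorm below is its real form. *)
HB.mixin Record NormedModule_isPreHilbert (R : realType) H
    & NormedModule R[i] H := {
  dot : H -> H -> R[i] ;
  dotDl : forall x y z, dot (x + y) z = dot x z + dot y z ;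
  dotZl : forall a x y, dot (a *: x) y = a * dot x y ;
  dot_conj : forall x y, dot y x = Num.conj (dot x y) ;
  dotxx : forall x, dot x x = `|x| ^+ 2 }.

#[short(type="preHilbertType")]
HB.structure Definition PreHilbert (R : realType) :=
  {H of NormedModule_isPreHilbert R H & NormedModule R[i] H}.

#[short(type="hilbertType")]
HB.structure Definition Hilbert (R : realType) :=
  {H of PreHilbert R H & Complete H}.

Notation "'<|' x , y '|>'" := (dot x y) (format "<| x ,  y |>").

HB.factory Record Lmodule_isPreHilbert (R : realType) H
    & GRing.Lmodule R[i] H := {
  dot : H -> H -> R[i] ;
  dotDl : forall x y z, dot (x + y) z = dot x z + dot y z ;
  dotZl : forall a x y, dot (a *: x) y = a * dot x y ;
  dot_conj : forall x y, dot y x = Num.conj (dot x y) ;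
  dot_ge0 : forall x, 0 <= dot x x ;
  dot_eq0 : forall x, dot x x = 0 -> x = 0 }.

HB.builders Context (R : realType) H & Lmodule_isPreHilbert R H.

Let nrm (x : H) : R[i] := sqrtC (dot x x).

Let dotDr x y z : dot x (y + z) = dot x y + dot x z.
Proof. by rewrite dot_conj dotDl rmorphD /= -!dot_conj. Qed.

Let dotZr a x y : dot x (a *: y) = Num.conj a * dot x y.
Proof. by rewrite dot_conj dotZl rmorphM /= -!dot_conj. Qed.

Let dot0r x : dot x 0 = 0.
Proof. by rewrite -(scale0r 0) dotZr rmorph0 mul0r. Qed.

Let nrm_ge0 x : 0 <= nrm x. Proof. by rewrite sqrtC_ge0 dot_ge0. Qed.

Let nrm2 x : nrm x ^+ 2 = dot x x. Proof. exact: sqrtCK. Qed.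

Let cauchy_schwarz x y : `|dot x y| <= nrm x * nrm y.
Proof.
have [->|y0] := eqVneq y 0; first by rewrite dot0r normr0 mulr_ge0.
have Dy : dot y y != 0 by apply: contra_neq y0; exact: dot_eq0.
have Dy0 : 0 < dot y y by rewrite lt_def Dy dot_ge0.
rewrite -(@ler_pXn2r _ 2) ?nnegrE ?mulr_ge0// exprMn !nrm2 normCK.
have := dot_ge0 (dot y y *: x + (- dot x y) *: y).
rewrite dotDl !dotDr !dotZl !dotZr rmorphN /= -[in Num.conj (dot y y)]dot_conj.
rewrite -[X in _ + (X + _)]/(- dot x y * (dot y y * dot y x)).
have -> : dot y y * (dot y y * dot x x) + dot y y * (- Num.conj (dot x y) * dot x y)
   + (- dot x y * (dot y y * dot y x) + - dot x y * (- Num.conj (dot x y) * dot y y))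
   = dot y y * (dot x x * dot y y - dot x y * Num.conj (dot x y)).
  rewrite (dot_conj x y); ring.
by rewrite pmulr_rge0// subr_ge0.
Qed.

Let nrmD x y : nrm (x + y) <= nrm x + nrm y.
Proof.
rewrite -(@ler_pXn2r _ 2) ?nnegrE ?addr_ge0// nrm2 sqrrD !nrm2.
rewrite dotDl !dotDr addrA lerD2r -addrA lerD2l.
have -> : dot x y + dot y x = 'Re (dot x y) *+ 2.
  by rewrite (dot_conj x y) ReE -mulr_natr divfK// pnatr_eq0.
by rewrite lerMn2r/= (le_trans _ (cauchy_schwarz x y))// leif_Re_Creal.
Qed.

Let nrmZ a x : nrm (a *: x) = `|a| * nrm x.
Proof.
apply/eqP; rewrite -(@eqrXn2 _ 2) ?mulr_ge0// exprMn !nrm2 dotZl dotZr mulrA.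
by rewrite normCK.
Qed.

Let nrm_eq0 x : nrm x = 0 -> x = 0.
Proof. by move/eqP; rewrite sqrtC_eq0 => /eqP/dot_eq0. Qed.

HB.instance Definition _ :=
  @Lmodule_isNormed.Build R[i] H nrm nrmD nrmZ nrm_eq0.

HB.instance Definition _ :=
  @NormedModule_isPreHilbert.Build R H dot dotDl dotZl dot_conj
    (fun x => esym (nrm2 x)).

HB.end.

Section PreHilbertTheory.
Variables (R : realType) (H : preHilbertType R).
Implicit Types x y z : H.

Lemma dotDr x y z : <|x, y + z|> = <|x, y|> + <|x, z|>.
Proof. by rewrite dot_conj dotDl rmorphD /= -!dot_conj. Qed.

Lemma dotZr a x y : <|x, a *: y|> = Num.conj a * <|x, y|>.
Proof. by rewrite dot_conj dotZl rmorphM /= -!dot_conj. Qed.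

Lemma dot0r x : <|x, 0|> = 0.
Proof. by rewrite -(scale0r 0) dotZr rmorph0 mul0r. Qed.

Lemma dot0l x : <|0, x|> = 0.
Proof. by rewrite -(scale0r 0) dotZl mul0r. Qed.

Lemma dotNl x y : <|- x, y|> = - <|x, y|>.
Proof. by rewrite -scaleN1r dotZl mulN1r. Qed.

Lemma dotNr x y : <|x, - y|> = - <|x, y|>.
Proof. by rewrite -scaleN1r dotZr rmorphN rmorph1 mulN1r. Qed.

Lemma dotBl x y z : <|x - y, z|> = <|x, z|> - <|y, z|>.
Proof. by rewrite dotDl dotNl. Qed.

Lemma dotBr x y z : <|x, y - z|> = <|x, y|> - <|x, z|>.
Proof. by rewrite dotDr dotNr. Qed.

Lemma dot_suml (I : Type) (r : seq I) (P : pred I) (F : I -> H) y :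
  <|\sum_(i <- r | P i) F i, y|> = \sum_(i <- r | P i) <|F i, y|>.
Proof. by apply: (big_morph (fun x => <|x, y|>)) => [u v|]; rewrite ?dotDl ?dot0l. Qed.

Lemma dot_sumr (I : Type) (r : seq I) (P : pred I) (F : I -> H) x :
  <|x, \sum_(i <- r | P i) F i|> = \sum_(i <- r | P i) <|x, F i|>.
Proof. by apply: (big_morph (fun y => <|x, y|>)) => [u v|]; rewrite ?dotDr ?dot0r. Qed.

Lemma cauchy_schwarz x y : `|<|x, y|>| <= `|x| * `|y|.
Proof.
have [->|y0] := eqVneq y 0; first by rewrite dot0r !normr0 mulr0.
have Dy0 : 0 < <|y, y|> by rewrite dotxx exprn_gt0// normr_gt0.
rewrite -(@ler_pXn2r _ 2) ?nnegrE ?mulr_ge0// exprMn -!dotxx normCK.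
have : 0 <= <|<|y, y|> *: x - <|x, y|> *: y, <|y, y|> *: x - <|x, y|> *: y|>.
  by rewrite dotxx exprn_ge0.
rewrite dotBl !dotBr !dotZl !dotZr -[in Num.conj <|y, y|>]dot_conj.
rewrite (_ : _ - _ = <|y, y|> * (<|x, x|> * <|y, y|> - <|x, y|> * Num.conj <|x, y|>)).
  by rewrite pmulr_rge0// subr_ge0.
by rewrite (dot_conj x y); ring.
Qed.

End PreHilbertTheory.

Section BoundedOperators.
Variables (K : numFieldType) (H L : normedModType K).

Definition bop_pred : {pred H -> L} :=
  mem [set f : H -> L | linear f /\ continuous f].

Record bop := Bop { bop_fun :> H -> L ; bop_funP : bop_fun \in bop_pred }.

HB.instance Definition _ := [isSub for bop_fun].
HB.instance Definition _ := [Choice of bop by <:].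

Let bop_submod : submod_closed bop_pred.
Proof.
split; first by rewrite inE/=; split=> [a x y|]; [rewrite scaler0 addr0|exact: cst_continuous].
move=> a f g; rewrite !inE/= => -[lf cf] [lg cg]; split.
  move=> b x y; rewrite !fctE/= lf lg.
  by rewrite !scalerDr !scalerA (mulrC a b) addrACA.
move=> x; apply: cvgD; [|exact: cg].
by apply: cvgZl_tmp; exact: cf.
Qed.

HB.instance Definition _ :=
  GRing.isSubmodClosed.Build K (H -> L) bop_pred bop_submod.
HB.instance Definition _ := [SubChoice_isSubLmodule of bop by <:].

Lemma bopP (f g : bop) : (forall x, f x = g x) -> f = g.
Proof. by move=> fg; apply/val_inj/funext. Qed.

Lemma bop_linear (f : bop) : linear f.
Proof. by case: f => f /= /[!inE] -[]. Qed.

Lemma bop_continuous (f : bop) : continuous f.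
Proof. by case: f => f /= /[!inE] -[]. Qed.

HB.instance Definition _ (f : bop) :=
  GRing.isLinear.Build K H L *:%R f (bop_linear f).

Lemma bop_sumE (I : Type) (r : seq I) (P : pred I) (F : I -> bop) x :
  (\sum_(i <- r | P i) F i) x = \sum_(i <- r | P i) F i x.
Proof. by apply: (big_morph (fun f : bop => f x)). Qed.

End BoundedOperators.

Definition mkbop (K : numFieldType) (H L : normedModType K) (f : H -> L)
  (lf : linear f) (cf : continuous f) : bop H L := Bop (mem_set (conj lf cf)).

Definition bid (K : numFieldType) (H : normedModType K) : bop H H :=
  @mkbop K H H idfun (fun _ _ _ => erefl) (fun _ => cvg_id).

Section comp.
Variables (K : numFieldType) (H L M : normedModType K).
Variables (f : bop L M) (g : bop H L).

Let comp_linear : linear (f \o g).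
Proof. by move=> a x y /=; rewrite !linearP. Qed.

Let comp_continuous : continuous (f \o g).
Proof. by move=> x; apply: continuous_comp; exact: bop_continuous. Qed.

Definition bcomp := mkbop comp_linear comp_continuous.
End comp.

Notation "f '\bo' g" := (bcomp f g) (at level 40, left associativity).

Section cauchy.
Variables (K : numFieldType) (V : normedModType K).

Lemma cauchy_normP (F : set_system V) : ProperFilter F ->
  cauchy F <-> forall e : K, 0 < e ->
    exists2 A, F A & forall x y, A x -> A y -> `|x - y| < e.
Proof.
move=> FF; split=> [/cauchy_ballP Fc e e0|Fc].
  have [[A B]/= [FA FB] AB] := Fc e e0.
  exists (A `&` B); first exact: filterI.
  by move=> x y [Ax _] [_ By]; have := AB (x, y) (conj Ax By); rewrite -ball_normE.
apply/cauchy_ballP => e e0; have [A FA AP] := Fc e e0.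
exists (A, A) => //= -[x y]/= [Ax Ay]; rewrite -ball_normE; exact: AP.
Qed.

End cauchy.

Section complex_complete.
Variable R : realType.

Let sub_complete (g : {additive R[i]^o -> R}) (F : set_system R[i]^o) :
  (forall x, (`|g x|%:C)%C <= `|x|) -> ProperFilter F -> cauchy F -> cvg (g @ F).
Proof.
move=> gle FF /cauchy_normP Fc; apply: cauchy_cvg.
apply/(@cauchy_normP R R^o) => e e0.
have [|A FA AP] := Fc (e%:C)%C; first by rewrite ltcR.
exists (g @` A).
  by apply: (@filterS _ F _ A (g @^-1` (g @` A)) _ FA) => x Ax; exists x.
move=> _ _ [x Ax <-] [y Ay <-]; rewrite -raddfB -ltcR.
exact: le_lt_trans (gle _) (AP _ _ Ax Ay).
Qed.

Lemma complex_complete (F : set_system R[i]^o) :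
  ProperFilter F -> cauchy F -> cvg F.
Proof.
move=> FF Fc.
have /cvg_ex[/= a Fa] : cvg ((@complex.Re R) @ F).
  apply: sub_complete => // x; exact: normc_ge_Re.
have /cvg_ex[/= b Fb] : cvg ((@complex.Im R) @ F).
  apply: sub_complete => // x.
  rewrite normc_def lecR -sqrtr_sqr ler_wsqrtr// lerDr sqr_ge0//.
apply/cvg_ex; exists (a +i* b)%C; apply/cvgrPdist_lt => e e0.
have {}e0 : 0 < complex.Re e / 2 /\ e = (complex.Re e)%:C%C.
  by move: e0; rewrite ltcE/= => /andP[/eqP ie er]; split; [rewrite divr_gt0|case: e ie er => ? ? /= ->].
case: e0 => e0 ->.
move/cvgrPdist_lt : Fa => /(_ _ e0) Fa.
move/cvgrPdist_lt : Fb => /(_ _ e0) Fb.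
near=> z.
have za : `|a - complex.Re z| < complex.Re e / 2 by near: z; exact: Fa.
have zb : `|b - complex.Im z| < complex.Re e / 2 by near: z; exact: Fb.
have -> : ((a +i* b)%C - z : R[i]) =
  ((a - complex.Re z)%:C + 'i * (b - complex.Im z)%:C)%C.
  by rewrite [LHS]complexE; move: (z) => -[].
apply: (le_lt_trans (ler_normD _ _)).
rewrite normrM !normc_def/= !expr0n/= expr1n add0r sqrtr1 mul1r !addr0 !sqrtr_sqr.
by rewrite -rmorphD ltcR (splitr (complex.Re e)) ltrD.
Unshelve. all: by end_near. Qed.

(* An alias is needed: R^o already carries a completeness instance reserved for
   R : realType, which prevents one for R[i]^o. *)
Definition scalars := R[i]^o.
HB.instance Definition _ := NormedModule.copy scalars R[i]^o.
HB.instance Definition _ := Uniform_isComplete.Build scalars complex_complete.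

Let cdot (x y : scalars) : R[i] := x * Num.conj y.

Let cdotDl x y z : cdot (x + y) z = cdot x z + cdot y z.
Proof. exact: mulrDl. Qed.
Let cdotZl a x y : cdot (a *: x) y = a * cdot x y.
Proof. by rewrite /cdot -mulrA. Qed.
Let cdot_conj x y : cdot y x = Num.conj (cdot x y).
Proof. by rewrite /cdot rmorphM /= conjCK mulrC. Qed.
Let cdotxx x : cdot x x = `|x| ^+ 2.
Proof. by rewrite /cdot -normCK. Qed.

HB.instance Definition _ := @NormedModule_isPreHilbert.Build R scalars
  cdot cdotDl cdotZl cdot_conj cdotxx.

End complex_complete.

Section hnorm.
Variables (R : realType) (H : normedModType R[i]).
Implicit Types x y : H.

Definition hnorm x : R := complex.Re `|x|.

Lemma hnormE x : `|x| = (hnorm x)%:C%C.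
Proof.
rewrite /hnorm; have := normr_ge0 x; move: `|x| => -[a b].
by rewrite lecE/= => /andP[/eqP -> _].
Qed.

Lemma hnorm_ge0 x : 0 <= hnorm x.
Proof. by rewrite -lecR -hnormE normr_ge0. Qed.

Lemma hnormD x y : hnorm (x + y) <= hnorm x + hnorm y.
Proof. by rewrite -lecR rmorphD/= -!hnormE ler_normD. Qed.

Lemma hnormN x : hnorm (- x) = hnorm x.
Proof. by rewrite /hnorm normrN. Qed.

Lemma hnorm0 : hnorm 0 = 0.
Proof. by rewrite /hnorm normr0. Qed.

Lemma hnorm0_eq0 x : hnorm x = 0 -> x = 0.
Proof. by move=> x0; apply/eqP; rewrite -normr_eq0 hnormE x0. Qed.

Lemma hnormZ (a : R[i]) x : hnorm (a *: x) = complex.Re `|a| * hnorm x.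
Proof.
by rewrite {1}/hnorm normrZ !normc_def hnormE -rmorphM.
Qed.

Lemma ler_dist_hnorm x y : `|hnorm x - hnorm y| <= hnorm (x - y).
Proof.
have hB u v : hnorm u - hnorm v <= hnorm (u - v).
  by rewrite lerBlDr (le_trans _ (hnormD _ _))// subrK.
have := hB y x; have := hB x y.
have := hnormN (x - y); rewrite opprB => -> h1 h2.
by rewrite ler_norml h1 lerNl opprB h2.
Qed.

Lemma hnorm_cvg (T : Type) (F : set_system T) (FF : Filter F) (f : T -> H) l :
  f @ F --> l -> hnorm (f x) @[x --> F] --> hnorm l.
Proof.
move=> /cvgrPdist_lt fl; apply/cvgrPdist_lt => e e0.
have ec0 : 0 < e%:C%C by rewrite ltcR.
apply: filterS (fl _ ec0) => x; rewrite hnormE ltcR; apply: le_lt_trans.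
exact: ler_dist_hnorm.
Qed.

Lemma cauchy_hnormP (F : set_system H) : ProperFilter F ->
  cauchy F <-> forall e : R, 0 < e ->
    exists2 A, F A & forall x y, A x -> A y -> hnorm (x - y) < e.
Proof.
move=> FF; rewrite cauchy_normP; split=> Fc e e0.
  have [|A FA AP] := Fc e%:C%C; first by rewrite ltcR.
  by exists A => // x y Ax Ay; rewrite -ltcR -hnormE AP.
move: e0; rewrite ltcE => /andP[/= /eqP ie re].
have [A FA AP] := Fc _ re; exists A => // x y Ax Ay.
by rewrite hnormE ltcE/= ie eqxx/= AP.
Qed.

Lemma cvg_hnormP (F : set_system H) l : Filter F ->
  F --> l <-> forall e : R, 0 < e -> \forall x \near F, hnorm (l - x) < e.
Proof.
move=> FF; split.
  move=> /cvgrPdist_lt fl e e0.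
  have ec0 : 0 < e%:C%C by rewrite ltcR.
  by apply: filterS (fl _ ec0) => x; rewrite hnormE ltcR.
move=> fl; apply/cvgrPdist_lt => e; rewrite ltcE => /andP[/= /eqP ie re].
by apply: filterS (fl _ re) => x; rewrite hnormE ltcE/= ie eqxx.
Qed.

End hnorm.

Lemma bop_bounded (R : realType) (H L : normedModType R[i]) (f : bop H L) :
  exists2 M : R, 0 <= M & forall x, hnorm (f x) <= M * hnorm x.
Proof.
have /linear_boundedP := (linear_bounded_continuous f).2 (@bop_continuous _ _ _ f).
move=> /pinfty_ex_gt0[r]; rewrite ltcE/= => /andP[/eqP ir rr] rP.
exists (complex.Re r); first exact: ltW.
move=> x; have := rP x; rewrite !hnormE.
have -> : r = (complex.Re r)%:C%C by case: (r) ir => ? ? /= ->.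
by rewrite -rmorphM lecR.
Qed.

Lemma bounded_continuous (R : realType) (H L : normedModType R[i]) (f : H -> L)
  (M : R) : linear f -> (forall x, hnorm (f x) <= M * hnorm x) -> continuous f.
Proof.
move=> lf fM; pose m := GRing.isLinear.Build R[i] H L *:%R f lf.
pose g : {linear H -> L} := HB.pack f m.
apply: (@bounded_linear_continuous _ _ _ g); apply/linear_boundedP.
near=> r => x; apply: (@le_trans _ _ (M%:C%C * `|x|)).
  by rewrite !hnormE -rmorphM lecR; exact: fM.
rewrite ler_wpM2r//; near: r; apply: nbhs_pinfty_ge; rewrite complex_real//.
Unshelve. all: by end_near. Qed.

#[local] Existing Instance totally_filter.

Section usum.
Variables (I : choiceType).

Definition fsum (V : nmodType) (f : I -> V) (A : {fset I}) : V :=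
  \sum_(i <- A) f i.

Lemma fsumD (V : nmodType) (f : I -> V) (A B : {fset I}) :
  (A `<=` B)%fset -> fsum f B = fsum f A + fsum f (B `\` A)%fset.
Proof.
move=> AB; rewrite /fsum (big_fsetID _ (mem A))/=; congr (_ + _).
  apply: eq_fbigl => i; rewrite !inE/=; apply/andP/idP => [[]//|iA].
  by rewrite (fsubsetP AB).
by apply: eq_fbigl => i; rewrite !inE/= andbC.
Qed.

Lemma fsum_cvg (R : realType) (V : normedModType R[i])
    (Vc : forall F : set_system V, ProperFilter F -> cauchy F -> cvg F)
    (f : I -> V) :
  (forall e : R, 0 < e -> exists A : {fset I},
     forall B, (A `<=` B)%fset -> hnorm (fsum f (B `\` A)%fset) < e) ->
  cvg (fsum f @ totally).
Proof.
move=> fA; apply: Vc; apply/(@cauchy_hnormP _ _ (fsum f @ totally)) => e e0.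
have [|A AP] := fA (e / 2); first by rewrite divr_gt0.
exists (fsum f @` [set B | (A `<=` B)%fset]).
  by exists A => //= B AB; exists B.
move=> _ _ [B AB <-] [C AC <-].
rewrite (fsumD f AB) (fsumD f AC) opprD addrACA subrr add0r.
rewrite (le_lt_trans (hnormD _ _))// (splitr e) ltrD// ?AP//.
by rewrite hnormN AP.
Qed.

Variable R : realType.
Variable g : I -> R.
Hypothesis g0 : forall i, 0 <= g i.
Variable M : R.
Hypothesis gM : forall A, fsum g A <= M.

Lemma fsum_ge0 A : 0 <= fsum g A.
Proof. by apply: sumr_ge0. Qed.

Let has_supg : has_sup (range (fsum g)).
Proof.
split; first by exists (fsum g fset0%fset), fset0%fset.
by exists M => _ [A _ <-].
Qed.

Lemma fsum_tail e : 0 < e -> exists A : {fset I},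
  forall B, (A `<=` B)%fset -> fsum g (B `\` A)%fset < e.
Proof.
move=> e0; have [_ [A _ <-] AP] := sup_adherent e0 has_supg.
exists A => B AB; rewrite -(ltrD2l (fsum g A)) -fsumD// -ltrBlDr.
apply: le_lt_trans AP; rewrite lerB//; apply: ub_le_sup; first exact: has_supg.2.
by exists B.
Qed.

Lemma fsum_sup A : fsum g A <= sup (range (fsum g)).
Proof. by apply: ub_le_sup; [exact: has_supg.2|exists A]. Qed.

Lemma fsum_sup_cvg : fsum g @ totally --> (sup (range (fsum g)) : R).
Proof.
apply/cvgrPdist_lt => e e0.
have [_ [A _ <-] AP] := sup_adherent e0 has_supg.
exists A => //= B AB; rewrite ger0_norm ?subr_ge0 ?fsum_sup// ltrBlDr -ltrBlDl.
by rewrite (lt_le_trans AP)// (fsumD _ AB) lerDl sumr_ge0.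
Qed.

End usum.

(* Hilbert direct sum of an arbitrary family: square-summable families with
   <f, g> the unconditional sum of the <f i, g i>. *)
Section HilbertSum.
Variables (R : realType) (I : choiceType) (H : I -> hilbertType R).

Definition sq_summable (f : forall i, H i) : Prop :=
  exists M : R, forall A : {fset I}, fsum (fun i => hnorm (f i) ^+ 2) A <= M.

Record hsum := HSum { hsum_fun :> forall i, H i ; hsumP : sq_summable hsum_fun }.

HB.instance Definition _ := gen_eqMixin hsum.
HB.instance Definition _ := gen_choiceMixin hsum.

Lemma hsum_ext (f g : hsum) : (forall i, f i = g i) -> f = g.
Proof.
case: f g => [f Pf] [g Pg]/= fg.
have {}fg : f = g by apply: functional_extensionality_dep.
by move: Pf Pg; rewrite fg => Pf Pg; congr HSum; exact: Prop_irrelevance.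
Qed.

Let sqD (a b : R) : (a + b) ^+ 2 <= 2 * a ^+ 2 + 2 * b ^+ 2.
Proof. by have := sqr_ge0 (a - b); rewrite sqrrB sqrrD; lra. Qed.

Let sq0 : sq_summable (fun=> 0).
Proof.
by exists 0 => A; rewrite /fsum big1// => i _; rewrite hnorm0 expr0n.
Qed.

Let sqZ a f : sq_summable f -> sq_summable (fun i => a *: f i).
Proof.
move=> [M fM]; exists (complex.Re `|a| ^+ 2 * M) => A.
rewrite (_ : fsum _ A = complex.Re `|a| ^+ 2 * fsum (fun i => hnorm (f i) ^+ 2) A).
  by rewrite ler_wpM2l// sqr_ge0.
by rewrite /fsum mulr_sumr; apply: eq_bigr => i _; rewrite hnormZ exprMn.
Qed.

Let sqD_ f g : sq_summable f -> sq_summable g ->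
  sq_summable (fun i => f i + g i).
Proof.
move=> [M fM] [N gN]; exists (2 * M + 2 * N) => A.
apply: (@le_trans _ _ (2 * fsum (fun i => hnorm (f i) ^+ 2) A +
  2 * fsum (fun i => hnorm (g i) ^+ 2) A)); last by have := fM A; have := gN A; lra.
rewrite /fsum !mulr_sumr -big_split/=; apply: ler_sum => i _.
apply: le_trans (sqD _ _); rewrite lerXn2r ?nnegrE ?addr_ge0 ?hnorm_ge0//.
exact: hnormD.
Qed.

Let sqN f : sq_summable f -> sq_summable (fun i => - f i).
Proof.
move=> [M fM]; exists M => A; apply: le_trans (fM A).
by apply: ler_sum => i _; rewrite hnormN.
Qed.

Let zero := HSum sq0.
Let add f g := HSum (sqD_ (hsumP f) (hsumP g)).
Let opp f := HSum (sqN (hsumP f)).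
Let scale a f := HSum (sqZ a (hsumP f)).

Let addA : associative add.
Proof. by move=> f g h; apply: hsum_ext => i /=; rewrite addrA. Qed.
Let addC : commutative add.
Proof. by move=> f g; apply: hsum_ext => i /=; rewrite addrC. Qed.
Let add0 : left_id zero add.
Proof. by move=> f; apply: hsum_ext => i /=; rewrite add0r. Qed.
Let addN : left_inverse zero opp add.
Proof. by move=> f; apply: hsum_ext => i /=; rewrite addNr. Qed.

HB.instance Definition _ := GRing.isZmodule.Build hsum addA addC add0 addN.

Let scaleA a b f : scale a (scale b f) = scale (a * b) f.
Proof. by apply: hsum_ext => i /=; rewrite scalerA. Qed.
Let scale1 : left_id 1 scale.
Proof. by move=> f; apply: hsum_ext => i /=; rewrite scale1r. Qed.
Let scaleDr : right_distributive scale +%R.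
Proof. by move=> a f g; apply: hsum_ext => i /=; rewrite scalerDr. Qed.
Let scaleDl f : {morph scale^~ f : a b / a + b}.
Proof. by move=> a b; apply: hsum_ext => i /=; rewrite scalerDl. Qed.

HB.instance Definition _ := GRing.Zmodule_isLmodule.Build R[i] hsum
  scaleA scale1 scaleDr scaleDl.

Let sdot (f g : hsum) (i : I) : scalars R := <|f i, g i|>.

Lemma hsum_dot_cvg f g : cvg (fsum (sdot f g) @ totally).
Proof.
apply: fsum_cvg => [F FF|e e0]; first exact: cauchy_cvg.
have [[M fM] [N gN]] := (hsumP f, hsumP g).
pose k i := hnorm (f i) ^+ 2 + hnorm (g i) ^+ 2.
have [|A AP] := @fsum_tail I R k (M + N) _ e e0.
  by move=> A; rewrite /fsum /k big_split/=; apply: lerD; [exact: fM|exact: gN].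
exists A => B /AP; apply: le_lt_trans.
rewrite /fsum; elim/big_ind2 : _ => [|x1 x2 y1 y2 h1 h2|i _].
- by rewrite hnorm0.
- by rewrite (le_trans (hnormD _ _))// lerD.
rewrite -lecR -[X in X <= _]hnormE.
apply: (le_trans (@cauchy_schwarz _ (H i) (f i) (g i))).
rewrite !hnormE -rmorphM lecR /k.
have := sqr_ge0 (hnorm (f i) - hnorm (g i)); rewrite sqrrB.
have := mulr_ge0 (hnorm_ge0 (f i)) (hnorm_ge0 (g i)); lra.
Qed.

Definition hsum_dot (f g : hsum) : R[i] := lim (fsum (sdot f g) @ totally).

Let hdotE (f g : hsum) (l : scalars R) :
  fsum (sdot f g) @ totally --> l -> hsum_dot f g = l.
Proof. by move=> /cvg_lim; apply; exact: norm_hausdorff. Qed.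

Let hdotP (f g : hsum) :
  fsum (sdot f g) @ totally --> (hsum_dot f g : scalars R).
Proof. exact: hsum_dot_cvg. Qed.

Let hdotDl f g h : hsum_dot (f + g) h = hsum_dot f h + hsum_dot g h.
Proof.
apply: hdotE; rewrite (_ : fsum _ = fsum (sdot f h) \+ fsum (sdot g h)).
  by apply: cvgD; exact: hdotP.
apply/funext => A; rewrite /fsum/= -big_split; apply: eq_bigr => i _.
exact: dotDl.
Qed.

Let hdotZl a f g : hsum_dot (a *: f) g = a * hsum_dot f g.
Proof.
apply: hdotE; rewrite (_ : fsum _ = (fun A => a *: fsum (sdot f g) A)).
  by apply: cvgZl_tmp; exact: hdotP.
apply/funext => A; rewrite /fsum scaler_sumr; apply: eq_bigr => i _.
exact: dotZl.
Qed.

Let hdot_conj f g : hsum_dot g f = Num.conj (hsum_dot f g).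
Proof.
apply: hdotE; apply/cvgrPdist_lt => e e0.
have /cvgrPdist_lt /(_ e e0) := @hdotP f g; apply: filterS => A.
rewrite -norm_conjC rmorphB /fsum rmorph_sum/=.
congr (`|_ - _| < _); apply: eq_bigr => i _; rewrite /sdot.
by rewrite -dot_conj.
Qed.

Let hnorm_scalars (r : R) : hnorm (r%:C%C : scalars R) = `|r|.
Proof. by rewrite /hnorm normc_def/= expr0n addr0 sqrtr_sqr. Qed.

Let ssq (f : hsum) : R := sup (range (fsum (fun i => hnorm (f i) ^+ 2))).

Let hdotxx f : hsum_dot f f = (ssq f)%:C%C.
Proof.
apply: hdotE; have [M fM] := hsumP f.
have := @fsum_sup_cvg _ _ _ (fun i => sqr_ge0 (hnorm (f i))) M fM.
move/cvgrPdist_lt => ssqP; apply/cvg_hnormP => e e0.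
apply: filterS (ssqP e e0) => A /= hA.
have sE : fsum (sdot f f) A = (fsum (fun i => hnorm (f i) ^+ 2) A)%:C%C.
  rewrite /fsum rmorph_sum; apply: eq_bigr => i _.
  by rewrite /sdot dotxx hnormE -rmorphXn.
by rewrite sE; move: hA; rewrite -hnorm_scalars rmorphB.
Qed.

Let ssq_ge (f : hsum) A : fsum (fun i => hnorm (f i) ^+ 2) A <= ssq f.
Proof.
have [M fM] := hsumP f.
exact: (@fsum_sup _ _ _ M fM).
Qed.

Let hdot_ge0 f : 0 <= hsum_dot f f.
Proof.
by rewrite hdotxx lecR (le_trans _ (ssq_ge f fset0))// /fsum big_seq_fset0.
Qed.

Let hdot_eq0 f : hsum_dot f f = 0 -> f = 0.
Proof.
rewrite hdotxx => -[f0]; apply: hsum_ext => i; apply: hnorm0_eq0.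
have := ssq_ge f [fset i]%fset; rewrite f0 /fsum big_seq_fset1.
by move=> h; apply/eqP; rewrite -sqrf_eq0 eq_le h sqr_ge0.
Qed.

HB.instance Definition _ := @Lmodule_isPreHilbert.Build R hsum
  hsum_dot hdotDl hdotZl hdot_conj hdot_ge0 hdot_eq0.

Lemma hsum_fsum_le (f : hsum) A :
  fsum (fun i => hnorm (f i) ^+ 2) A <= hnorm f ^+ 2.
Proof.
rewrite (le_trans (ssq_ge f A))// -lecR rmorphXn/= -hnormE.
by rewrite -(@dotxx R hsum) -hdotxx.
Qed.

Lemma hsum_norm_le (f : hsum) (M : R) : 0 <= M ->
  (forall A, fsum (fun i => hnorm (f i) ^+ 2) A <= M ^+ 2) -> hnorm f <= M.
Proof.
move=> M0 fM; rewrite -(@ler_pXn2r _ 2) ?nnegrE ?hnorm_ge0//.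
rewrite -lecR rmorphXn/= -hnormE -(@dotxx R hsum).
rewrite -[X in X <= _]/(hsum_dot f f) hdotxx lecR; apply: sup_le_ub.
  by exists (fsum (fun i => hnorm (f i) ^+ 2) fset0), fset0.
by move=> _ [A _ <-].
Qed.

Lemma hsum_coord_le (f : hsum) i : hnorm (f i) <= hnorm f.
Proof.
rewrite -(@ler_pXn2r _ 2) ?nnegrE ?hnorm_ge0//.
by have := hsum_fsum_le f [fset i]%fset; rewrite /fsum big_seq_fset1.
Qed.

Lemma hsum_complete (F : set_system hsum) : ProperFilter F -> cauchy F -> cvg F.
Proof.
move=> FF /cauchy_hnormP Fc.
have coord i : cvg ((fun f : hsum => f i) @ F).
  apply: cauchy_cvg; apply/(@cauchy_hnormP _ _ ((fun f : hsum => f i) @ F)).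
  move=> e e0; have [A FA AP] := Fc e e0.
  exists ((fun f : hsum => f i) @` A).
    by apply: (@filterS _ F _ A _ _ FA) => f Af; exists f.
  move=> _ _ [f Af <-] [g Ag <-].
  exact: le_lt_trans (hsum_coord_le (f - g) i) (AP _ _ Af Ag).
pose l i := lim ((fun f : hsum => f i) @ F).
have key (e : R) (A : set hsum) (g : hsum) : F A -> 0 <= e ->
    (forall f, A f -> hnorm (f - g) <= e) ->
    forall B, fsum (fun i => hnorm (l i - g i) ^+ 2) B <= e ^+ 2.
  move=> FA e0 Ae B.
  have : (fun f : hsum => fsum (fun i => hnorm (f i - g i) ^+ 2) B) @ F
      --> (fsum (fun i => hnorm (l i - g i) ^+ 2) B : R).
    rewrite /fsum; elim: (enum_fset B) => [|i s IH].
      rewrite big_nil (_ : (fun _ => _) = cst 0); first exact: cvg_cst.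
      by apply/funext => f; rewrite big_nil.
    rewrite big_cons (_ : (fun _ => _) = (fun f : hsum => hnorm (f i - g i) ^+ 2)
        \+ (fun f : hsum => \sum_(j <- s) hnorm (f j - g j) ^+ 2)); last first.
      by apply/funext => f; rewrite big_cons.
    apply: cvgD; last exact: IH.
    have h : hnorm (f i - g i) @[f --> F] --> (hnorm (l i - g i) : R).
      by apply: hnorm_cvg; apply: cvgB; [exact: coord|exact: cvg_cst].
    by apply: cvgM; exact: h.
  move/cvgr_to_le; apply; apply: filterS FA => f Af.
  rewrite (le_trans (hsum_fsum_le (f - g) B))// lerXn2r ?nnegrE ?hnorm_ge0//.
  exact: Ae.
have lP : sq_summable l.
  have [A FA AP] := Fc 1 ltr01; have [g Ag] := filter_ex FA.
  have := key 1 A g FA ler01 (fun f Af => ltW (AP f g Af Ag)).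
  move=> lg; have : sq_summable (fun i => l i - g i) by exists (1 ^+ 2).
  move=> /sqD_ /(_ (hsumP g)) [M lM]; exists M => B; apply: le_trans (lM B).
  by apply: ler_sum => i _; rewrite subrK.
apply/cvg_ex; exists (HSum lP); apply/cvg_hnormP => e e0.
have [|A FA AP] := Fc (e / 2); first by rewrite divr_gt0.
apply: filterS (FA) => g Ag.
apply: (@le_lt_trans _ _ (e / 2)); last by rewrite gtr_pMr// invf_lt1// ltr1n.
apply: hsum_norm_le => [|B]; first by rewrite divr_ge0// ltW.
apply: (key _ A g FA) => [|f Af]; first by rewrite divr_ge0// ltW.
exact: ltW (AP f g Af Ag).
Qed.

HB.instance Definition _ := Uniform_isComplete.Build hsum hsum_complete.

End HilbertSum.

Section HilbertSumMaps.
Variables (R : realType) (I : choiceType) (H : I -> hilbertType R).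

Section inj.
Variable i : I.

Definition hin_fun (x : H i) (j : I) : H j :=
  if i =P j is ReflectT e then ecast k (H k) e x else 0.

Lemma hin_fun_id x : hin_fun x i = x.
Proof. by rewrite /hin_fun; case: eqP => // e; rewrite eq_axiomK. Qed.

Lemma hin_fun_neq x j : i != j -> hin_fun x j = 0.
Proof. by rewrite /hin_fun; case: eqP. Qed.

Let fsum_hin x A : fsum (fun j => hnorm (hin_fun x j) ^+ 2) A <= hnorm x ^+ 2.
Proof.
rewrite /fsum; have [iA|iA] := boolP (i \in A); last first.
  rewrite big_seq big1 ?sqr_ge0// => j jA.
  rewrite hin_fun_neq ?hnorm0 ?expr0n//.
  by apply: contraNneq iA => ->.
rewrite (big_fsetD1 i)//= hin_fun_id big_seq big1 ?addr0// => j.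
by rewrite !inE => /andP[ji _]; rewrite hin_fun_neq ?hnorm0 ?expr0n// eq_sym.
Qed.

Definition hin_hsum (x : H i) : hsum H :=
  HSum (ex_intro _ (hnorm x ^+ 2) (@fsum_hin x)).

Let hin_linear : linear hin_hsum.
Proof.
move=> a x y; apply: hsum_ext => j.
rewrite -[RHS]/(a *: hin_fun x j + hin_fun y j) /= /hin_fun.
by case: eqP => [e|_]; [case: _ / e|rewrite scaler0 addr0].
Qed.

Let hin_continuous : continuous hin_hsum.
Proof.
apply: (@bounded_continuous _ _ _ _ 1 hin_linear) => x.
by rewrite mul1r; apply: hsum_norm_le => [|A]; [exact: hnorm_ge0|exact: fsum_hin].
Qed.

Definition hin : bop (H i) (hsum H) := mkbop hin_linear hin_continuous.

Let hpr_linear : linear (fun f : hsum H => f i).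
Proof. by []. Qed.

Let hpr_continuous : continuous (fun f : hsum H => f i).
Proof.
apply: (@bounded_continuous _ _ _ _ 1 hpr_linear) => f.
by rewrite mul1r; exact: hsum_coord_le.
Qed.

Definition hpr : bop (hsum H) (H i) := mkbop hpr_linear hpr_continuous.

End inj.
End HilbertSumMaps.
Arguments hin {R I H}.
Arguments hpr {R I H}.

Section HilbertPair.
Variables (R : realType) (H K : hilbertType R).

Definition hplus : hilbertType R := hsum (fun b : bool => if b then H else K).

Definition hinl : bop H hplus := @hin R bool (fun b => if b then H else K) true.
Definition hinr : bop K hplus := @hin R bool (fun b => if b then H else K) false.
Definition hprl : bop hplus H := @hpr R bool (fun b => if b then H else K) true.
Definition hprr : bop hplus K := @hpr R bool (fun b => if b then H else K) false.
End HilbertPair.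
Arguments hinl {R H K}.
Arguments hinr {R H K}.
Arguments hprl {R H K}.
Arguments hprr {R H K}.

Record closed_subspace (R : realType) (H : hilbertType R) := ClosedSubspace {
  csub_set :> set H ;
  csub_submod : submod_closed (mem csub_set : {pred H}) ;
  csub_closed : closed csub_set }.

Section ClosedSubspace.
Variables (R : realType) (H : hilbertType R) (A : closed_subspace H).

Definition csub_pred : {pred H} := mem (csub_set A).

HB.instance Definition _ :=
  GRing.isSubmodClosed.Build R[i] H csub_pred (csub_submod A).

Record csub := CSub { csub_val : H ; csub_valP : csub_val \in csub_pred }.

HB.instance Definition _ := [isSub for csub_val].
HB.instance Definition _ := [Choice of csub by <:].
HB.instance Definition _ := [SubChoice_isSubLmodule of csub by <:].

Let sdot (x y : csub) : R[i] := <|val x, val y|>.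
Let sdotDl x y z : sdot (x + y) z = sdot x z + sdot y z.
Proof. exact: dotDl. Qed.
Let sdotZl a x y : sdot (a *: x) y = a * sdot x y.
Proof. exact: dotZl. Qed.
Let sdot_conj x y : sdot y x = Num.conj (sdot x y).
Proof. exact: dot_conj. Qed.
Let sdot_ge0 x : 0 <= sdot x x.
Proof. by rewrite /sdot dotxx exprn_ge0. Qed.
Let sdot_eq0 x : sdot x x = 0 -> x = 0.
Proof.
by rewrite /sdot dotxx => /eqP; rewrite sqrf_eq0 normr_eq0 => /eqP x0; apply: val_inj.
Qed.

HB.instance Definition _ := @Lmodule_isPreHilbert.Build R csub
  sdot sdotDl sdotZl sdot_conj sdot_ge0 sdot_eq0.

Lemma csub_norm (x : csub) : hnorm x = hnorm (val x).
Proof.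
apply/eqP; rewrite -(@eqrXn2 _ 2) ?hnorm_ge0//; apply/eqP/complexI.
by rewrite !rmorphXn/= -!hnormE -!dotxx.
Qed.

Let csub_complete (F : set_system csub) : ProperFilter F -> cauchy F -> cvg F.
Proof.
move=> FF /cauchy_hnormP Fc.
have /cvg_ex[/= l Fl] : cvg (val @ F : set_system H).
  apply: cauchy_cvg; apply/(@cauchy_hnormP _ _ (val @ F)) => e e0.
  have [B FB BP] := Fc e e0; exists (val @` B).
    by apply: (@filterS _ F _ B _ _ FB) => x Bx; exists x.
  by move=> _ _ [x Bx <-] [y By <-]; rewrite -(csub_norm (x - y)) BP.
have Al : l \in csub_pred.
  have nA : \forall x \near F, csub_set A (csub_val x).
    by apply: nearW => x; have := csub_valP x; rewrite inE.
  by rewrite inE; exact: (closed_cvg _ (@csub_closed _ _ A) nA _ Fl).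
apply/cvg_ex; exists (CSub Al); apply/cvg_hnormP => e e0.
move/(@cvg_hnormP _ _ (val @ F)) : Fl => /(_ e e0).
move=> Fe; apply: (@filterS _ F _ (fun x => hnorm (l - val x) < e) _ _ Fe) => x.
by rewrite csub_norm.
Qed.

HB.instance Definition _ := Uniform_isComplete.Build csub csub_complete.

Let csub_val_linear : linear csub_val.
Proof. by []. Qed.

Let csub_val_continuous : continuous csub_val.
Proof.
apply: (@bounded_continuous _ _ _ _ 1 csub_val_linear) => x.
by rewrite mul1r csub_norm.
Qed.

Definition csub_inc : bop csub H := mkbop csub_val_linear csub_val_continuous.

Section corestrict.
Variables (K : hilbertType R) (f : bop K H).
Hypothesis fA : forall x, f x \in csub_pred.

Let cores_fun (x : K) : csub := CSub (fA x).
Let cores_linear : linear cores_fun.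
Proof. by move=> a x y; apply: val_inj; rewrite /= linearP. Qed.
Let cores_continuous : continuous cores_fun.
Proof.
have [M _ fM] := bop_bounded f.
apply: (@bounded_continuous _ _ _ _ M cores_linear) => x.
by rewrite csub_norm; exact: fM.
Qed.
Definition corestrict : bop K csub := mkbop cores_linear cores_continuous.
End corestrict.

End ClosedSubspace.

Section ClosedRange.
Variables (R : realType) (K H : hilbertType R) (f : bop K H).

Let clrange_submod : submod_closed (mem (closure (range f)) : {pred H}).
Proof.
split=> [|a x y]; rewrite !inE.
  by apply: subset_closure; exists 0 => //; rewrite linear0.
move=> xf yf.
have clsub (S B : set H) : closed B -> S `<=` B -> closure S `<=` B.
  by move=> cB SB z; rewrite closureE; apply.
have cB u v : range f u -> closure (range f) v -> closure (range f) (a *: u + v).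
  move=> [s _ <-]; apply: (clsub _ ((fun v => a *: f s + v) @^-1` closure (range f))).
    apply: preimage_closed; last exact: closed_closure.
    by move=> w _; apply: cvgD; [exact: cvg_cst|exact: cvg_id].
  move=> _ [t _ <-]; apply: subset_closure.
  by exists (a *: s + t); rewrite // linearP.
move: x xf; apply: (clsub _ ((fun u => a *: u + y) @^-1` closure (range f))).
  apply: preimage_closed; last exact: closed_closure.
  by move=> w _; apply: cvgD; [apply: cvgZl_tmp; exact: cvg_id|exact: cvg_cst].
by move=> u uf; exact: cB.
Qed.

Definition clrange : closed_subspace H :=
  ClosedSubspace clrange_submod (@closed_closure _ (range f)).

Let clrangeP x : f x \in csub_pred clrange.
Proof. by rewrite inE; apply: subset_closure; exists x. Qed.

Definition to_clrange : bop K (csub clrange) := corestrict clrangeP.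

End ClosedRange.

Section hsum_approx.
Variables (R : realType) (I : choiceType) (H : I -> hilbertType R).

Lemma hsum_sumE (T : Type) (r : seq T) (P : pred T) (F : T -> hsum H) i :
  (\sum_(t <- r | P t) F t) i = \sum_(t <- r | P t) F t i.
Proof. exact: (big_morph (fun f : hsum H => f i)). Qed.

Lemma hsum_approx (f : hsum H) (e : R) : 0 < e ->
  exists A : {fset I}, hnorm (f - \sum_(i <- A) hin i (f i)) <= e.
Proof.
move=> e0; have [M fM] := hsumP f.
have [|A AP] := @fsum_tail I R _ M fM (e ^+ 2); first by rewrite exprn_gt0.
exists A; apply: hsum_norm_le => [|B]; first exact: ltW.
set g := f - _.
have gE i : g i = if i \in A then 0 else f i.
  rewrite /g -[LHS]/(f i - (\sum_(i <- A) hin i (f i) : hsum H) i) hsum_sumE.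
  case: ifPn => iA.
    rewrite (big_fsetD1 i)//= hin_fun_id big_seq big1 ?addr0 ?subrr// => j.
    by rewrite !inE => /andP[ji _] /=; rewrite hin_fun_neq.
  rewrite big_seq big1 ?subr0// => j jA /=; rewrite hin_fun_neq//.
  by apply: contraNneq iA => <-.
pose h i := hnorm (g i) ^+ 2.
have h0 C : 0 <= fsum h C by apply: sumr_ge0 => i _; exact: sqr_ge0.
apply: (@le_trans _ _ (fsum h (A `|` B)%fset)).
  by rewrite (fsumD h (fsubsetUr A B)) lerDl.
rewrite (fsumD h (fsubsetUl A B)) {1}/fsum big_seq big1 ?add0r; last first.
  by move=> i iA; rewrite /h gE iA hnorm0 expr0n.
apply: le_trans (ltW (AP _ (fsubsetUl A B))).
apply: ler_sum => i _; rewrite /h gE.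
by case: ifP => _; rewrite ?hnorm0 ?expr0n ?sqr_ge0.
Qed.
End hsum_approx.

Section OrthonormalBasis.
Variables (R : realType) (H : hilbertType R).

Definition orthonormal_set (B : set H) :=
  forall x y, B x -> B y -> <|x, y|> = (x == y)%:R.

Lemma maximal_orthonormal : exists B, orthonormal_set B /\
  forall C, B `<` C -> ~ orthonormal_set C.
Proof.
apply: Zorn_bigcup => F Fo Ft x y [X FX Xx] [Y FY Yy].
have [XY|YX] := Ft _ _ FX FY.
  by apply: (Fo _ FY) => //; exact: XY.
by apply: (Fo _ FX) => //; exact: YX.
Qed.

Definition hbasis : set H := sval (cid maximal_orthonormal).

Lemma hbasis_orthonormal : orthonormal_set hbasis.
Proof. by rewrite /hbasis; case: cid => B []. Qed.

Lemma hbasis_total (x : H) : (forall b, hbasis b -> <|x, b|> = 0) -> x = 0.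
Proof.
rewrite /hbasis; case: cid => B [/= oB mB] xB; apply: contrapT => /eqP x0.
have nx : `|x| != 0 by rewrite normr_eq0.
pose u := `|x|^-1 *: x.
have uu : <|u, u|> = 1.
  rewrite dotZl dotZr dotxx geC0_conj ?invr_ge0//.
  by rewrite expr2 mulrA mulrACA !mulVf ?mul1r.
have uB b : B b -> <|u, b|> = 0 by move=> Bb; rewrite dotZl xB ?mulr0.
have nBu : ~ B u by move=> /uB; rewrite uu => /eqP; rewrite oner_eq0.
apply: (mB (B `|` [set u])).
  split; first by move=> y By; left.
  by move=> /(_ u (or_intror erefl)).
move=> y z [By|->] [Bz|->].
- exact: oB.
- rewrite dot_conj uB// rmorph0; case: eqP => // yu; case: nBu; by rewrite -yu.
- rewrite uB//; case: eqP => // yu; case: nBu; by rewrite yu.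
- by rewrite eqxx uu.
Qed.

End OrthonormalBasis.

Lemma dot_cvgl (R : realType) (H : preHilbertType R) (T : Type)
    (F : set_system T) (FF : Filter F) (f : T -> H) (l y : H) :
  f @ F --> l -> (<|f t, y|> : scalars R) @[t --> F] --> (<|l, y|> : scalars R).
Proof.
move=> fl; apply/cvgrPdist_le => e e0.
have e1 : 0 < e / (`|y| + 1) by rewrite divr_gt0// ltr_wpDl.
move/cvgrPdist_lt: fl => /(_ _ e1); apply: filterS => t ft.
rewrite -[X in `|X| <= _]dotBl (le_trans (cauchy_schwarz _ _))//.
apply: (@le_trans _ _ (e / (`|y| + 1) * (`|y| + 1))).
  by apply: ler_pM => //; [exact: ltW|rewrite lerDl].
by rewrite divfK// gt_eqF// ltr_wpDl.
Qed.

Section Expansion.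
Variables (R : realType) (H : hilbertType R).
Let I : choiceType := set_type (@hbasis R H).

Let dot_basis (b c : I) : <|val b, val c|> = (b == c)%:R :> R[i].
Proof. by rewrite (hbasis_orthonormal (set_valP b) (set_valP c)). Qed.

Let dot_fsum (a : I -> R[i]) (c : I) (A : {fset I}) :
  <|fsum (fun b : I => a b *: val b) A, val c|> = if c \in A then a c else 0.
Proof.
rewrite /fsum dot_suml; case: ifPn => cA.
  rewrite (big_fsetD1 c)//= dotZl dot_basis eqxx mulr1 big_seq big1 ?addr0// => b.
  by rewrite !inE => /andP[/negPf bc _]; rewrite dotZl dot_basis bc mulr0.
rewrite big_seq big1// => b bA; rewrite dotZl dot_basis.
have [bc|_] := eqVneq b c; last by rewrite mulr0.
by move: cA; rewrite -bc bA.
Qed.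

Let hnorm_fsum (a : I -> R[i]) (A : {fset I}) :
  hnorm (fsum (fun b : I => a b *: val b) A) ^+ 2 =
  fsum (fun b => complex.Re `|a b| ^+ 2) A.
Proof.
apply: complexI; rewrite rmorphXn/= -hnormE -dotxx {2}/fsum dot_sumr.
rewrite /fsum rmorph_sum/= big_seq [RHS]big_seq; apply: eq_bigr => b bA.
rewrite dotZr [X in _ * X]dot_fsum bA mulrC -normCK rmorphXn/=.
by congr (_ ^+ 2); rewrite normc_def.
Qed.

Let bessel (x : H) (A : {fset I}) :
  fsum (fun b : I => complex.Re `|<|x, val b|>| ^+ 2) A <= hnorm x ^+ 2.
Proof.
pose s := fsum (fun b : I => <|x, val b|> *: val b) A.
rewrite -hnorm_fsum -/s.
have xs : <|x, s|> = <|s, s|>.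
  rewrite {1 3}/s /fsum !dot_sumr big_seq [RHS]big_seq.
  by apply: eq_bigr => b bA; rewrite !dotZr [X in _ = _ * X]dot_fsum bA.
have : hnorm s ^+ 2 <= hnorm x * hnorm s.
  rewrite -lecR rmorphXn/= rmorphM/= -!hnormE -dotxx -xs.
  apply: le_trans (cauchy_schwarz x s).
  by rewrite xs ger0_norm// dotxx exprn_ge0.
have := hnorm_ge0 s; rewrite le_eqVlt => /predU1P[<- _|s0].
  by rewrite expr0n sqr_ge0.
move=> sx; rewrite lerXn2r ?nnegrE ?hnorm_ge0//.
by rewrite -(ler_pM2r s0) -expr2.
Qed.

Lemma hbasis_expand (x : H) :
  fsum (fun b : I => <|x, val b|> *: val b) @ totally --> x.
Proof.
have /cvg_ex[/= l fl] : cvg (fsum (fun b : I => <|x, val b|> *: val b) @ totally).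
  apply: fsum_cvg => [F FF|e e0]; first exact: cauchy_cvg.
  have [|A AP] := @fsum_tail I R _ _ (bessel x) (e ^+ 2).
    by rewrite exprn_gt0.
  exists A => B AB; rewrite -(@ltr_pXn2r _ 2) ?nnegrE ?hnorm_ge0//; last exact: ltW.
  by rewrite hnorm_fsum AP.
suff xl : x = l by rewrite -xl in fl.
apply/eqP; rewrite -subr_eq0; apply/eqP; apply: hbasis_total => b Bb.
pose c : I := SigSub (mem_set Bb).
have lc : (<|fsum (fun b : I => <|x, val b|> *: val b) A, val c|> : scalars R)
    @[A --> totally] --> (<|x, b|> : scalars R).
  apply/cvgrPdist_le => e e0; exists [fset c]%fset => // A cA.
  have {}cA : c \in A by apply: (fsubsetP cA); rewrite inE.
  have := dot_fsum (fun b : I => <|x, val b|>) c A; rewrite cA /= => ->.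
  by rewrite subrr normr0 ltW.
rewrite dotBl; apply/eqP; rewrite subr_eq0; apply/eqP.
by apply: (cvg_unique _ lc (dot_cvgl _ fl)); exact: norm_hausdorff.
Qed.

Lemma hbasis_bessel (x : H) (A : {fset I}) :
  fsum (fun b : I => complex.Re `|<|x, val b|>| ^+ 2) A <= hnorm x ^+ 2.
Proof. exact: bessel. Qed.

End Expansion.

(* The Hilbert tensor product H ⊗ K, realized as the sum of copies of K indexed by
   an orthonormal basis of H, with (x ⊗ y)_b = <x, b> y.  Lemmas tensDl, tensDr,
   tensZl, tensZr, dot_tens and tens_dense characterize the pair (htensor, tens)
   up to a unique unitary. *)
Section Tensor.
Variables (R : realType) (H K : hilbertType R).
Let I : choiceType := set_type (@hbasis R H).

Definition htensor : hilbertType R := hsum (fun _ : I => K).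

Lemma tens_subproof (x : H) (y : K) :
  sq_summable (fun b : I => <|x, val b|> *: y).
Proof.
exists (hnorm x ^+ 2 * hnorm y ^+ 2) => A.
apply: le_trans (_ : fsum (fun b : I => complex.Re `|<|x, val b|>| ^+ 2) A
  * hnorm y ^+ 2 <= _).
  rewrite /fsum mulr_suml; apply: ler_sum => b _.
  by rewrite hnormZ exprMn.
by rewrite ler_wpM2r ?sqr_ge0// hbasis_bessel.
Qed.

Definition tens (x : H) (y : K) : htensor := HSum (tens_subproof x y).

Lemma tensDl x x' y : tens (x + x') y = tens x y + tens x' y.
Proof. by apply: hsum_ext => b /=; rewrite dotDl scalerDl. Qed.

Lemma tensDr x y y' : tens x (y + y') = tens x y + tens x y'.
Proof. by apply: hsum_ext => b /=; rewrite scalerDr. Qed.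

Lemma tensZl a x y : tens (a *: x) y = a *: tens x y.
Proof. by apply: hsum_ext => b /=; rewrite dotZl -scalerA. Qed.

Lemma tensZr a x y : tens x (a *: y) = a *: tens x y.
Proof. by apply: hsum_ext => b /=; rewrite !scalerA mulrC. Qed.

Lemma dot_tens x x' y y' :
  <|tens x y, tens x' y'|> = <|x, x'|> * <|y, y'|>.
Proof.
rewrite -[LHS]/(hsum_dot (tens x y) (tens x' y')).
have h1 := @hsum_dot_cvg _ _ _ (tens x y) (tens x' y').
have h2 : (<|fsum (fun b : I => <|x, val b|> *: val b) A, x'|>
   : scalars R) @[A --> totally] --> (<|x, x'|> : scalars R).
  by apply: dot_cvgl; exact: hbasis_expand.
have h3 : (<|y, y'|> : R[i]) *: (<|fsum (fun b : I => <|x, val b|> *: val b) A, x'|>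
   : scalars R) @[A --> totally] --> ((<|y, y'|> : R[i]) *: <|x, x'|> : scalars R).
  by apply: cvgZl_tmp.
rewrite mulrC; apply: (cvg_unique _ h1); first exact: norm_hausdorff.
rewrite (_ : fsum _ = (fun A => (<|y, y'|> : R[i]) *:
   (<|fsum (fun b : I => <|x, val b|> *: val b) A, x'|> : scalars R))).
  exact: h3.
apply/funext => A.
rewrite /fsum dot_suml scaler_sumr; apply: eq_bigr => b _ /=.
rewrite !dotZl dotZr [<|val b, _|>]dot_conj /GRing.scale/=; ring.
Qed.

Lemma tens_dense (z : htensor) (e : R) : 0 < e ->
  exists s : seq (H * K), hnorm (z - \sum_(p <- s) tens p.1 p.2) <= e.
Proof.
move=> e0; have [A AP] := @hsum_approx _ _ _ z e e0.
exists [seq (val b, z b) | b <- A].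
suff -> : \sum_(p <- [seq (val b, z b) | b <- A]) tens p.1 p.2 =
  \sum_(b <- A) hin b (z b) by [].
rewrite big_map; apply: eq_bigr => b _; apply: hsum_ext => c /=.
rewrite (hbasis_orthonormal (set_valP b) (set_valP c)).
have [<-|bc] := eqVneq b c; first by rewrite eqxx scale1r hin_fun_id.
by rewrite hin_fun_neq// val_eqE (negPf bc) scale0r.
Qed.

End Tensor.

Section TensorMaps.
Variables (R : realType) (H K : hilbertType R) (y : K).

Lemma hnorm_tens (x : H) : hnorm (tens x y) = hnorm x * hnorm y.
Proof.
apply/eqP; rewrite -(@eqrXn2 _ 2) ?mulr_ge0 ?hnorm_ge0//; apply/eqP/complexI.
rewrite exprMn [RHS]rmorphM [LHS]rmorphXn/= !rmorphXn/= -!hnormE -!dotxx.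
exact: dot_tens.
Qed.

Let tensl_linear : linear (fun x : H => tens x y).
Proof. by move=> a u v; rewrite tensDl tensZl. Qed.

Let tensl_continuous : continuous (fun x : H => tens x y).
Proof.
apply: (@bounded_continuous _ _ _ _ (hnorm y) tensl_linear) => x.
by rewrite hnorm_tens mulrC.
Qed.

Definition tensl : bop H (htensor H K) := mkbop tensl_linear tensl_continuous.

End TensorMaps.

Section Operators.
Variable R : realType.
Implicit Types H K L M : hilbertType R.

(* Operators that are determined by a characteristic property are introduced
   by choice; the default value 0 is irrelevant when the property is
   satisfiable. *)
Definition the_bop H K (P : bop H K -> Prop) : bop H K := xget 0 [set f | P f].

Definition opnorm H K (f : bop H K) : R :=
  sup [set hnorm (f x) | x in [set x | hnorm x <= 1]].

Definition contraction H K (f : bop H K) : Prop := opnorm f <= 1.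

Definition adj H K (f : bop H K) : bop K H :=
  the_bop (fun g => forall x y, <|f x, y|> = <|x, g y|>).

Definition bpos H (f : bop H H) : Prop := forall x, 0 <= <|f x, x|>.

Definition ble H (f g : bop H H) : Prop := bpos (g - f).

Definition bsqrt H (f : bop H H) : bop H H :=
  the_bop (fun g => bpos g /\ g \bo g = f).

Definition is_inverse H (f g : bop H H) : Prop :=
  f \bo g = bid H /\ g \bo f = bid H.

Definition invertible H (f : bop H H) : Prop := exists g, is_inverse f g.

Definition binv H (f : bop H H) : bop H H := the_bop (is_inverse f).

Definition tens_op H H' K K' (f : bop H H') (g : bop K K') :
    bop (htensor H K) (htensor H' K') :=
  the_bop (fun w => forall x y, w (tens x y) = tens (f x) (g y)).

Definition defect H K (f : bop H K) : bop H H := bsqrt (bid H - adj f \bo f).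

Definition defect_space H K (f : bop H K) : hilbertType R :=
  csub (clrange (defect f)).

Definition to_defect H K (f : bop H K) : bop H (defect_space f) :=
  to_clrange (defect f).

Definition infinite_dim H : Prop :=
  ~ exists (m : nat) (v : 'I_m -> H),
      forall x, exists c : 'I_m -> R[i], x = \sum_i c i *: v i.

Definition is_onb n H (e : 'I_n -> H) : Prop :=
  (forall i j, <|e i, e j|> = (i == j)%:R) /\
  (forall x, exists c : 'I_n -> R[i], x = \sum_i c i *: e i).

Definition hpow H (n : nat) : hilbertType R := hsum (fun _ : 'I_n => H).

Definition blockop n (G G' : 'I_n -> hilbertType R)
    (f : forall i j, bop (G j) (G' i)) : bop (hsum G) (hsum G') :=
  \sum_i \sum_j hin i \bo f i j \bo hpr j.

Definition colvec n (G : 'I_n -> hilbertType R) (y : forall i, G i) : hsum G :=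
  \sum_i hin i (y i).

End Operators.

(* H^{⊗(k+1)} is H ⊗ H^{⊗k}, with H^{⊗0} the scalars; thus H^{⊗1} is H ⊗ C. *)
Fixpoint tpow (R : realType) (H : hilbertType R) (k : nat) : hilbertType R :=
  if k is k'.+1 then htensor H (tpow H k') else scalars R.

Definition fock (R : realType) (H : hilbertType R) : hilbertType R :=
  hsum (tpow H).

Section Fock.
Variables (R : realType) (n : nat) (Hn : hilbertType R) (e : 'I_n -> Hn).

(* A word g_{i_1} ... g_{i_k} is the sequence [:: i_1; ...; i_k]. *)
Fixpoint etens (a : seq 'I_n) : tpow Hn (size a) :=
  if a is i :: a' then tens (e i) (etens a') else (1 : scalars R).

Definition evec (a : seq 'I_n) : fock Hn := @hin R nat (tpow Hn) (size a) (etens a).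

(* S_i phi = e_i ⊗ phi, componentwise in the grading. *)
Definition creation (i : 'I_n) : bop (fock Hn) (fock Hn) :=
  the_bop (fun s => forall phi : fock Hn, hpr 0%N (s phi) = 0 /\
    forall k, hpr k.+1 (s phi) = tens (e i) (hpr k phi)).

End Fock.

Section FreeHolomorphic.
Variables (R : realType) (n : nat) (Z : hilbertType R).

Definition row_ball (z : 'I_n -> bop Z Z) : Prop :=
  Num.sqrt (opnorm (\sum_i z i \bo adj (z i))) < 1.

Definition word_op (z : 'I_n -> bop Z Z) (a : seq 'I_n) : bop Z Z :=
  foldr (fun i f => z i \bo f) (bid Z) a.

Variables (M L : hilbertType R).

Definition words_gram (C : seq 'I_n -> bop M L) (k : nat) : bop M M :=
  \sum_(a : k.-tuple 'I_n) adj (C a) \bo C a.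

(* A free holomorphic function is represented by its coefficients. *)
Definition free_holomorphic (C : seq 'I_n -> bop M L) : Prop :=
  (limn_esup (fun k => (opnorm (words_gram C k) `^ ((2 * k)%:R)^-1)%:E) <= 1)%E.

(* The series converges in operator norm, summed by homogeneous parts. *)
Definition feval (C : seq 'I_n -> bop M L) (z : 'I_n -> bop Z Z) :
    bop (htensor M Z) (htensor L Z) :=
  the_bop (fun w => (fun N : nat => opnorm (w -
    \sum_(k < N) \sum_(a : k.-tuple 'I_n) tens_op (C a) (word_op z a)))
      @ \oo --> (0 : R)).

Definition fsup_norm (C : seq 'I_n -> bop M L) : \bar R :=
  ereal_sup [set (opnorm (feval C z))%:E | z in [set z | row_ball z]].

(* sum_a C_a^* C_a <= c I, as a bound on the increasing partial sums. *)
Definition H2ball (C : seq 'I_n -> bop M L) : Prop :=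
  free_holomorphic C /\
  exists c : R, 0 < c /\
    forall N : nat, ble (\sum_(k < N) words_gram C k) (c%:C%C *: bid M).

Definition fsymbol (Hn : hilbertType R) (e : 'I_n -> Hn)
    (C : seq 'I_n -> bop M L) : bop M (htensor L (fock Hn)) :=
  the_bop (fun g => forall x, (fun N : nat =>
    \sum_(k < N) \sum_(a : k.-tuple 'I_n) tens (C a x) (evec e (rev a)))
      @ \oo --> g x).

Definition frestr (N : closed_subspace M) (C : seq 'I_n -> bop M L)
    (D : bop (csub N) L) : Prop :=
  C [::] \bo csub_inc N = D /\
  forall a : seq 'I_n, (0 < size a)%N -> C a \bo csub_inc N = 0.

End FreeHolomorphic.

Section GNCL.
Variables (R : realType) (n : nat) (Hn Z H X : hilbertType R).
Variables (G : 'I_n -> hilbertType R) (e : 'I_n -> Hn).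
Variables (A : bop X H) (T : 'I_n -> bop H H).
Variables (C Q : forall i, bop (G i) X).

Definition row_contraction : Prop := ble (\sum_i T i \bo adj (T i)) (bid H).

(* Delta_T *)
Definition row_defect : bop (hpow H n) (hpow H n) :=
  bsqrt (blockop (fun i j : 'I_n =>
    (if i == j then bid H else 0) - adj (T i) \bo T j)).

Definition row_defect_space : hilbertType R := csub (clrange row_defect).

Definition to_row_defect : bop (hpow H n) row_defect_space :=
  to_clrange row_defect.

Definition dilation_space : hilbertType R :=
  hplus H (htensor row_defect_space (fock Hn)).

Definition dilation_delta (i : 'I_n) :
    bop H (htensor row_defect_space (fock Hn)) :=
  tensl _ (evec e [::]) \bo to_row_defect \bo hin i.

Definition dilation (i : 'I_n) : bop dilation_space dilation_space :=
  hinl \bo T i \bo hprl +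
  hinr \bo (dilation_delta i \bo hprl +
            tens_op (bid row_defect_space) (creation e i) \bo hprr).

Definition gncl_data : Prop :=
  [/\ row_contraction,
      ble (blockop (fun i j : 'I_n =>
             if i == j then adj (C i) \bo C j else 0))
          (blockop (fun i j : 'I_n => adj (Q i) \bo Q j)),
      contraction A &
      forall i, T i \bo A \bo C i = A \bo Q i].

Definition contractive_interpolant (B : bop X dilation_space) : Prop :=
  [/\ contraction B, hprl \bo B = A &
      forall i, dilation i \bo B \bo C i = B \bo Q i].

(* (y_i) |-> sum_i D_A Q_i y_i *)
Definition defectQ : bop (hsum G) (defect_space A) :=
  \sum_i to_defect A \bo Q i \bo hpr i.

Definition Fspace : closed_subspace (defect_space A) := clrange defectQ.

Definition schur_target : hilbertType R :=
  hplus row_defect_space (hpow (defect_space A) n).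

Definition Omega : bop (csub Fspace) schur_target :=
  the_bop (fun w => forall y : hsum G, w (to_clrange defectQ y) =
    hinl (to_row_defect (colvec (fun i => A (C i (y i))))) +
    hinr (colvec (fun i => to_defect A (C i (y i))))).

Definition schur_class_Omega
    (Psi : seq 'I_n -> bop (defect_space A) schur_target) : Prop :=
  [/\ free_holomorphic Psi, (fsup_norm Z Psi <= 1)%E & frestr Psi Omega].

(* Psi = [L; M_1; ...; M_n] *)
Definition entryL (Psi : seq 'I_n -> bop (defect_space A) schur_target)
    (a : seq 'I_n) : bop (defect_space A) row_defect_space :=
  hprl \bo Psi a.

Definition entryM (Psi : seq 'I_n -> bop (defect_space A) schur_target)
    (i : 'I_n) (a : seq 'I_n) : bop (defect_space A) (defect_space A) :=
  hpr i \bo hprr \bo Psi a.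

(* I - sum_i (I ⊗ z_i) M_i(z) *)
Definition pencil (Psi : seq 'I_n -> bop (defect_space A) schur_target)
    (z : 'I_n -> bop Z Z) :
    bop (htensor (defect_space A) Z) (htensor (defect_space A) Z) :=
  bid _ - \sum_i tens_op (bid (defect_space A)) (z i) \bo feval (entryM Psi i) z.

Definition transfer_formula
    (Psi : seq 'I_n -> bop (defect_space A) schur_target)
    (Theta : seq 'I_n -> bop (defect_space A) row_defect_space) : Prop :=
  forall z : 'I_n -> bop Z Z, row_ball z ->
    invertible (pencil Psi z) /\
    feval Theta z = feval (entryL Psi) z \bo binv (pencil Psi z).

End GNCL.

(* Main.v *)
Require Import Defs.
From mathcomp Require Import all_boot all_order all_algebra finmap complex.
From mathcomp Require Import ring lra.
From mathcomp Require Import boolp classical_sets functions cardinality reals ereal.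
From mathcomp Require Import topology normedtype sequences exp.
From mathcomp.analysis.showcase Require Import summability.
(* Imported again: [all_algebra] shadows [hnormN]. *)
Require Import Defs.
Set Implicit Arguments.
Unset Strict Implicit.
Unset Printing Implicit Defensive.
Import Order.TTheory GRing.Theory Num.Theory.
Import numFieldNormedType.Exports.
Local Open Scope classical_set_scope.
Local Open Scope ring_scope.

(* Every contractive interpolant is B = [A; Gamma D_A] with Gamma a contraction on D_A,
   and V_i B C_i = B Q_i says that for f in F the coefficients of Gamma f satisfy
     (Gamma f)_[] = Omega_1 f,   (Gamma f)_(i w) = (Gamma (Omega_2 f)_i)_w.
   Given Psi = [L; M] in the Schur class, feed the output M_i at a node w of the tree
   of words back as the input at the child i w. With u_w the input and y_w the output
   at w, started from x at the root, Theta(Z) = L(Z) (1 - sum_i Z_i M_i(Z))^-1 is the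
   series of the maps x |-> y_w. Evaluating Psi at truncated creation operators on Z
   shows that its Toeplitz truncations are contractive, so that the energy balance
   telescopes to sum_(|w| <= N) |y_w|^2 + sum_(|w| = N+1) |u_w|^2 <= |x|^2; and
   Psi = Omega on F gives the two equations above.
   Conversely, given Gamma, the backward shifts on the coefficients of Gamma together
   with a contraction W such that W D_Gamma f = (D_Gamma (Omega_2 f)_i)_i form a
   contractive system on l^2(words; D) + D_A, in which x |-> (Gamma x, D_Gamma x) is an
   isometry J. Composing the shifts with 1 - J J^* opens the feedback loop, and the
   transfer function of the resulting system is Psi. *)

(* A Schur function is known only through its norm on the ball of an arbitrary infinite dimensional
   [Z], and bounds on its coefficients have to be extracted from that. Such a [Z] contains an
   orthonormal family indexed by words, on which creation operators can be imitated. Cutting them at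
   length N makes every power series finite, and a factor r < 1 puts the tuple inside the open ball;
   r tends to 1 at the end. The same evaluation shows that [Theta] is determined by its values,
   which matters because the theorem admits any [Theta] satisfying the formula. Two orders of
   letters meet. Multiplication of series makes the loop recursive in the first letter, whereas on F
   it is the last letter that can be removed; the reversal of words in the symbol reconciles the
   two. The operator 1 - J J^* serves twice. The states that it leaves are orthogonal to the inputs,
   which gives the norm estimate on the ball; and it annihilates U_i J f for f in F, so that the
   coefficients of nonempty words vanish on F. *)
#[local] Existing Instance totally_filter.

(** * Hilbert spaces and adjoints *)

Section HilbertBasics.
Variable R : realType.
Implicit Types H K L M : hilbertType R.

Lemma sqr_normE (z : R[i]) : `|z| ^+ 2 = (complex.Re `|z| ^+ 2)%:C%C.
Proof. by rewrite normc_def -rmorphXn. Qed.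

Lemma dotxx_hnorm H (x : H) : <|x, x|> = (hnorm x ^+ 2)%:C%C.
Proof. by rewrite dotxx hnormE rmorphXn. Qed.

Lemma sqr_hnormE H (x : H) : hnorm x ^+ 2 = complex.Re <|x, x|>.
Proof. by rewrite dotxx_hnorm. Qed.

Lemma Re_dotC H (x y : H) : complex.Re <|y, x|> = complex.Re <|x, y|>.
Proof. by rewrite (dot_conj x y); case: <|x, y|>. Qed.

Lemma Re_cauchy_schwarz H (x y : H) :
  complex.Re <|x, y|> <= hnorm x * hnorm y.
Proof.
rewrite -lecR rmorphM/= -!hnormE; apply: le_trans (cauchy_schwarz x y).
by apply: le_trans (normc_ge_Re _); rewrite lecR ler_norm.
Qed.

Lemma sqr_hnormD H (x y : H) :
  hnorm (x + y) ^+ 2 = hnorm x ^+ 2 + hnorm y ^+ 2 + complex.Re <|x, y|> *+ 2.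
Proof.
rewrite !sqr_hnormE dotDl !dotDr !raddfD/= (Re_dotC x y); ring.
Qed.

Lemma hnorm_orthD H (x y : H) :
  <|x, y|> = 0 -> hnorm (x + y) ^+ 2 = hnorm x ^+ 2 + hnorm y ^+ 2.
Proof. by move=> xy; rewrite sqr_hnormD xy /= mul0rn addr0. Qed.

Lemma dot_ext H (x y : H) : (forall z, <|x, z|> = <|y, z|>) -> x = y.
Proof.
move=> xy; apply/eqP; rewrite -subr_eq0; apply/eqP/hnorm0_eq0/eqP.
by rewrite -sqrf_eq0 sqr_hnormE dotBl xy subrr.
Qed.

Lemma dot_extr H (x y : H) : (forall z, <|z, x|> = <|z, y|>) -> x = y.
Proof. by move=> xy; apply: dot_ext => z; rewrite dot_conj xy -dot_conj. Qed.

Lemma hnormB_sym H (x y : H) : hnorm (x - y) = hnorm (y - x).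
Proof. by rewrite -hnormN opprB. Qed.

Lemma hnormZr H (r : R) (x : H) : hnorm (r%:C%C *: x) = `|r| * hnorm x.
Proof. by rewrite hnormZ normc_def/= expr0n addr0 sqrtr_sqr. Qed.

Lemma hnorm_sum H (I : Type) (r : seq I) (P : pred I) (F : I -> H) :
  hnorm (\sum_(i <- r | P i) F i) <= \sum_(i <- r | P i) hnorm (F i).
Proof.
elim/big_ind2: _ => [|x1 x2 y1 y2 h1 h2|//]; first by rewrite hnorm0.
by rewrite (le_trans (hnormD _ _))// lerD.
Qed.

(** Density arguments end here: the difference of two candidates is bounded by a fixed constant
    times an arbitrary approximation error. *)
Lemma hnorm_small H (x : H) (c : R) :
  (forall e : R, 0 < e -> hnorm x <= c * e) -> x = 0.
Proof.
move=> xe; apply: hnorm0_eq0; apply/eqP; rewrite eq_le hnorm_ge0 andbT.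
have [c0|c0] := leP c 0; first by rewrite (le_trans (xe 1 ltr01))// mulr1.
apply/ler_addgt0Pr => e e0; rewrite add0r; have := xe (e / c).
by rewrite divr_gt0// mulrC divfK ?gt_eqF//; apply.
Qed.

Section bounds.
Variables (H K : hilbertType R).
Implicit Type f : bop H K.

Lemma bopDE f g x : (f + g) x = f x + g x. Proof. by []. Qed.
Lemma bopBE f g x : (f - g) x = f x - g x. Proof. by []. Qed.
Lemma bopZE a f x : (a *: f) x = a *: f x. Proof. by []. Qed.
Lemma bop0E x : (0 : bop H K) x = 0. Proof. by []. Qed.

(* Folded forms of [linearD] and the like: simplification would unfold [hin] and [hpr]. *)
Lemma bopD f x y : f (x + y) = f x + f y. Proof. exact: linearD. Qed.
Lemma bopB f x y : f (x - y) = f x - f y. Proof. exact: linearB. Qed.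
Lemma bopZ f a x : f (a *: x) = a *: f x. Proof. exact: linearZ. Qed.
Lemma bop0 f : f 0 = 0. Proof. exact: linear0. Qed.
Lemma bop_sum f (J : Type) (r : seq J) (P : pred J) (F : J -> H) :
  f (\sum_(j <- r | P j) F j) = \sum_(j <- r | P j) f (F j).
Proof. exact: linear_sum. Qed.
Lemma bcompE (L : hilbertType R) (g : bop K L) f x : (g \bo f) x = g (f x).
Proof. by []. Qed.

Definition bop_of_bound (f : H -> K) (M : R) (lf : linear f)
    (fM : forall x, hnorm (f x) <= M * hnorm x) : bop H K :=
  mkbop lf (bounded_continuous lf fM).

Lemma opnorm_has_sup f : has_sup [set hnorm (f x) | x in [set x | hnorm x <= 1]].
Proof.
split; first by exists (hnorm (f 0)); exists 0 => //=; rewrite hnorm0.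
have [M M0 fM] := bop_bounded f; exists M => _ [x /= x1 <-].
by rewrite (le_trans (fM x))// ler_piMr.
Qed.

Lemma hnorm_opnorm f x : hnorm (f x) <= opnorm f * hnorm x.
Proof.
have [->|x0] := eqVneq x 0; first by rewrite linear0 !hnorm0 mulr0.
have nx : 0 < hnorm x.
  by rewrite lt_def hnorm_ge0 andbT; apply: contra_neq x0; exact: hnorm0_eq0.
rewrite -ler_pdivrMr// mulrC.
have -> : (hnorm x)^-1 * hnorm (f x) = hnorm (f ((hnorm x)^-1%:C%C *: x)).
  by rewrite linearZ /= hnormZr ger0_norm// invr_ge0 ltW.
apply: ub_le_sup; first exact: (opnorm_has_sup f).2.
exists ((hnorm x)^-1%:C%C *: x) => //=.
by rewrite hnormZr ger0_norm ?mulVf ?gt_eqF// invr_ge0 ltW.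
Qed.

Lemma opnorm_ge0 f : 0 <= opnorm f.
Proof.
apply: ub_le_sup; first exact: (opnorm_has_sup f).2.
by exists 0; rewrite /= ?linear0 hnorm0.
Qed.

Lemma opnorm_le f c : 0 <= c -> (forall x, hnorm (f x) <= c * hnorm x) ->
  opnorm f <= c.
Proof.
move=> c0 fc; apply: sup_le_ub; first exact: (opnorm_has_sup f).1.
by move=> _ [x /= x1 <-]; rewrite (le_trans (fc x))// ler_piMr.
Qed.

Lemma contractionP f : contraction f <-> forall x, hnorm (f x) <= hnorm x.
Proof.
split=> [f1 x|fx]; last by apply: opnorm_le => // x; rewrite mul1r.
by rewrite (le_trans (hnorm_opnorm f x))// ler_piMl// hnorm_ge0.
Qed.

Lemma bop_hnorm_cvg (T : Type) (F : set_system T) (FF : Filter F)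
    f (u : T -> H) l : u @ F --> l -> f (u t) @[t --> F] --> f l.
Proof. by move=> ul; apply: cvg_comp ul _; exact: bop_continuous. Qed.

Lemma the_bopP (P : bop H K -> Prop) : (exists f, P f) -> P (the_bop P).
Proof. by move=> [f Pf]; exact: (xgetPex 0 (ex_intro [set g | P g] f Pf)). Qed.

Lemma the_bop_eq (P : bop H K -> Prop) f :
  P f -> (forall g, P g -> g = f) -> the_bop P = f.
Proof. by move=> Pf; apply; apply: the_bopP; exists f. Qed.

End bounds.

Lemma dot_cvgr H (T : Type) (F : set_system T) (FF : Filter F)
    (f : T -> H) (l y : H) :
  f @ F --> l -> (<|y, f t|> : scalars R) @[t --> F] --> (<|y, l|> : scalars R).
Proof.
move=> /(@dot_cvgl R H T F FF f l y) fl; apply/cvgrPdist_lt => e e0.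
move/cvgrPdist_lt: fl => /(_ e e0); apply: filterS => t.
by rewrite -norm_conjC rmorphB/= -!dot_conj.
Qed.

(* [g y] is the sum of [conj <f b, y> b] over an orthonormal basis of [H]. *)
Lemma adj_exists H K (f : bop H K) :
  exists g : bop K H, forall x y, <|f x, y|> = <|x, g y|>.
Proof.
have [M M0 fM] := bop_bounded f.
pose I : choiceType := set_type (@hbasis R H).
pose F (y : K) (b : I) : H := <|y, f (val b)|> *: val b.
have orth (b c : I) : <|val b, val c|> = (b == c)%:R :> R[i].
  by rewrite (hbasis_orthonormal (set_valP b) (set_valP c)).
(* A partial sum s satisfies |s|^2 = <f s, y> <= M |s| |y|; dividing by |s| bounds all partial sums
   by M |y|. *)
have nF y A : (hnorm (fsum (F y) A) ^+ 2)%:C%C = <|f (fsum (F y) A), y|>.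
  rewrite -dotxx_hnorm {2 3}/fsum linear_sum dot_sumr [RHS]dot_suml/=.
  rewrite big_seq [RHS]big_seq; apply: eq_bigr => b bA.
  rewrite linearZ dotZl /F dotZr -dot_conj mulrC; congr (_ * _).
  rewrite /fsum dot_suml (big_fsetD1 b)//= dotZl orth eqxx mulr1.
  rewrite big_seq big1 ?addr0// => c.
  by rewrite !inE => /andP[/negPf cb _]; rewrite dotZl orth cb mulr0.
have bF y A : hnorm (fsum (F y) A) <= M * hnorm y.
  set s := fsum _ _; have := hnorm_ge0 s; rewrite le_eqVlt => /predU1P[<-|s0].
    by rewrite mulr_ge0// hnorm_ge0.
  rewrite -(ler_pM2r s0) -expr2 -[X in X <= _]/(complex.Re (hnorm s ^+ 2)%:C%C).
  rewrite nF (le_trans (Re_cauchy_schwarz _ _))// mulrAC ler_wpM2r ?hnorm_ge0//.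
have nF2 y A : hnorm (fsum (F y) A) ^+ 2 =
    fsum (fun b => complex.Re `|<|y, f (val b)|>| ^+ 2) A.
  apply: complexI; rewrite nF /fsum linear_sum dot_suml rmorph_sum.
  apply: eq_bigr => b _; rewrite linearZ dotZl [<|f _, y|>]dot_conj -normCK.
  exact: sqr_normE.
have cF y : cvg (fsum (F y) @ totally).
  apply: fsum_cvg => [G GG|e e0]; first exact: cauchy_cvg.
  have nFM A : fsum (fun b : I => complex.Re `|<|y, f (val b)|>| ^+ 2) A <=
      (M * hnorm y) ^+ 2.
    by rewrite -[X in X <= _]nF2 lerXn2r ?nnegrE ?hnorm_ge0 ?mulr_ge0 ?hnorm_ge0.
  have [|A AP] := fsum_tail nFM (e := e ^+ 2).
    by rewrite exprn_gt0.
  exists A => B AB; rewrite -(@ltr_pXn2r _ 2) ?nnegrE ?hnorm_ge0 ?ltW//.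
  by rewrite nF2 AP.
pose g y := lim (fsum (F y) @ totally).
have gE y l : fsum (F y) @ totally --> l -> g y = l.
  by move=> /cvg_lim; apply; exact: norm_hausdorff.
have gl : linear g.
  move=> a x y; apply: gE.
  rewrite (_ : fsum _ = (fun A => a *: fsum (F x) A + fsum (F y) A)).
    by apply: cvgD; [apply: cvgZl_tmp; exact: cF|exact: cF].
  apply/funext => A; rewrite /fsum scaler_sumr -big_split/=.
  by apply: eq_bigr => b _; rewrite /F dotDl dotZl scalerDl scalerA.
have gM y : hnorm (g y) <= M * hnorm y.
  have /hnorm_cvg := cF y; move/cvgr_to_le; apply.
  by apply: nearW => A; exact: bF.
exists (bop_of_bound gl gM) => x y.
have h1 : (<|x, fsum (F y) A|> : scalars R) @[A --> totally] --> (<|x, g y|> : scalars R).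
  by apply: dot_cvgr; exact: cF.
have h2 : (<|f (fsum (fun b : I => <|x, val b|> *: val b) A), y|> : scalars R)
    @[A --> totally] --> (<|f x, y|> : scalars R).
  by apply: dot_cvgl; apply: bop_hnorm_cvg; exact: hbasis_expand.
have E A : <|f (fsum (fun b : I => <|x, val b|> *: val b) A), y|> = <|x, fsum (F y) A|>.
  rewrite [in LHS]/fsum linear_sum dot_suml [in RHS]/fsum dot_sumr.
  by apply: eq_bigr => b _; rewrite linearZ dotZl /F dotZr -dot_conj mulrC.
have h3 : (<|x, fsum (F y) A|> : scalars R) @[A --> totally] --> (<|f x, y|> : scalars R).
  by apply: cvg_trans h2; apply: near_eq_cvg; apply: nearW => A; exact: E.
by apply: (cvg_unique _ h3 h1); exact: norm_hausdorff.
Qed.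

Lemma adjP H K (f : bop H K) x y : <|f x, y|> = <|x, adj f y|>.
Proof. exact: (the_bopP (adj_exists f)). Qed.

Lemma adjPr H K (f : bop H K) x y : <|y, f x|> = <|adj f y, x|>.
Proof. by rewrite dot_conj adjP -dot_conj. Qed.

Lemma adj_eq H K (f : bop H K) (g : bop K H) :
  (forall x y, <|f x, y|> = <|x, g y|>) -> adj f = g.
Proof. by move=> fg; apply: bopP => y; apply: dot_extr => x; rewrite -adjP. Qed.

Lemma hnorm_adj_comp H K (f : bop H K) x :
  hnorm (f x) ^+ 2 = complex.Re <|(adj f \bo f) x, x|>.
Proof. by rewrite sqr_hnormE adjPr. Qed.

(** Strong convergence only: the index may depend on x. Symbols need this form, since their partial
    sums need not converge in norm. *)
Lemma bop_pointwise_cvg H K (s : nat -> bop H K) (M : R) :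
  (forall x (e : R), 0 < e -> exists m, forall k, (m <= k)%N ->
    hnorm (s k x - s m x) <= e) ->
  (forall m x, hnorm (s m x) <= M * hnorm x) ->
  exists w : bop H K, forall x, (fun k => s k x) @ \oo --> w x.
Proof.
move=> sd sM.
have cs x : cvg ((fun k => s k x) @ \oo).
  apply: cauchy_cvg; apply/(@cauchy_hnormP _ _ ((fun k => s k x) @ \oo)) => e e0.
  have [|m mP] := sd x (e / 3); first by rewrite divr_gt0.
  exists [set s k x | k in [set k | (m <= k)%N]].
    by exists m => // k mk; exists k.
  move=> _ _ [k mk <-] [l ml <-].
  rewrite -(subrKA (s m x)) (le_lt_trans (hnormD _ _))// [X in _ + X]hnormB_sym.
  by have := mP k mk; have := mP l ml; lra.
pose w x := lim ((fun k => s k x) @ \oo).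
have wE x l : (fun k => s k x) @ \oo --> l -> w x = l.
  by move=> /cvg_lim; apply; exact: norm_hausdorff.
have wl : linear w.
  move=> a x y; apply: wE.
  rewrite (_ : (fun k => _) = (fun k => a *: s k x + s k y)).
    by apply: cvgD; [apply: cvgZl_tmp; exact: cs|exact: cs].
  by apply/funext => k; rewrite linearP.
have wM x : hnorm (w x) <= M * hnorm x.
  have /hnorm_cvg := cs x; move/cvgr_to_le; apply; apply: nearW => k; exact: sM.
by exists (bop_of_bound wl wM) => x; exact: cs.
Qed.

Lemma bop_cauchy_cvg H K (s : nat -> bop H K) (d : nat -> R) :
  d @ \oo --> (0 : R) ->
  (forall m k x, (m <= k)%N -> hnorm (s k x - s m x) <= d m * hnorm x) ->
  exists w : bop H K, forall m x, hnorm (w x - s m x) <= d m * hnorm x.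
Proof.
move=> d0 sd.
have [||w ws] := @bop_pointwise_cvg _ _ s (`|d 0%N| + opnorm (s 0%N)).
- move=> x e e0.
  have dx : (d k * hnorm x) @[k --> \oo] --> (0 : R).
    by rewrite -[X in _ --> X](mul0r (hnorm x)); apply: cvgM => //; exact: cvg_cst.
  have /cvgrPdist_lt /(_ e e0)[m _ mP] := dx; exists m => k mk.
  apply: le_trans (sd _ _ _ mk) _; have := mP m (leqnn m).
  by rewrite sub0r normrN => /ltW; apply: le_trans; rewrite ler_norm.
- move=> m x; rewrite -(subrK (s 0%N x) (s m x)) (le_trans (hnormD _ _))// mulrDl lerD//.
    apply: le_trans (sd _ _ _ (leq0n m)) _.
    by rewrite ler_wpM2r ?hnorm_ge0// ler_norm.
  exact: hnorm_opnorm.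
exists w => m x.
have : hnorm (s k x - s m x) @[k --> \oo] --> hnorm (w x - s m x).
  by apply: hnorm_cvg; apply: cvgB; [exact: ws|exact: cvg_cst].
move/cvgr_to_le; apply; exists m => // k /= mk; exact: sd.
Qed.

End HilbertBasics.

(** * Positive operators and square roots *)

Section Positive.
Variable R : realType.
Implicit Types H K L M : hilbertType R.

Definition selfadjoint H (f : bop H H) := forall x y, <|f x, y|> = <|x, f y|>.

Lemma ReP (z : R[i]) : 0 <= z -> z = (complex.Re z)%:C%C /\ 0 <= complex.Re z.
Proof. by case: z => a b; rewrite lecE /= => /andP[/eqP ->]. Qed.

Lemma ReZ (t : R) (z : R[i]) : complex.Re (t%:C%C * z) = t * complex.Re z.
Proof. by case: z => ? ?; rewrite /= mul0r subr0. Qed.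

Lemma conjc_real (t : R) : Num.conj t%:C%C = t%:C%C :> R[i].
Proof. by apply/CrealP; rewrite complex_real. Qed.

Lemma bpos_Re H (f : bop H H) x : bpos f -> 0 <= complex.Re <|f x, x|>.
Proof. by move=> /(_ x)/ReP[]. Qed.

Lemma bpos_selfadjoint H (f : bop H H) : bpos f -> selfadjoint f.
Proof.
move=> f0.
have fr x : complex.Im <|f x, x|> = 0 by have := f0 x; rewrite lecE => /andP[/eqP].
have h x y : complex.Im <|f x, y|> + complex.Im <|f y, x|> = 0.
  by have := fr (x + y); rewrite linearD dotDl !dotDr !raddfD/= !fr addr0 add0r.
move=> x y.
have := h x ('i%C *: y); have := h x y.
rewrite linearZ dotZl dotZr [<|x, f y|>]dot_conj.
case: <|f x, y|> => a b; case: <|f y, x|> => c d /=.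
move=> bd ac.
by congr (_ +i* _)%C; lra.
Qed.

Lemma selfadjoint_bpos H (f : bop H H) : selfadjoint f ->
  (forall x, 0 <= complex.Re <|f x, x|>) -> bpos f.
Proof.
move=> fs f0 x; rewrite lecE f0 andbT; apply/eqP.
have := dot_conj x (f x); rewrite -fs.
by case: <|f x, x|> => a b /= [] /eqP; rewrite -addr_eq0 -mulr2n mulrn_eq0/= => /eqP.
Qed.

Lemma bpos_adj_comp H K (f : bop H K) : bpos (adj f \bo f).
Proof. by move=> x /=; rewrite -adjPr dotxx_hnorm lecR sqr_ge0. Qed.

Lemma selfadjoint_adj_comp H K (f : bop H K) : selfadjoint (adj f \bo f).
Proof. exact/bpos_selfadjoint/bpos_adj_comp. Qed.

(* Cauchy-Schwarz for the form [<f x, y>], at [y = f x]. *)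
Lemma bpos_hnorm_le H (f : bop H H) (c : R) : bpos f ->
  (forall x, complex.Re <|f x, x|> <= c * hnorm x ^+ 2) ->
  forall x, hnorm (f x) <= c * hnorm x.
Proof.
move=> f0 fc x; have fs := bpos_selfadjoint f0.
have [fx0|fx0] := eqVneq (hnorm (f x)) 0.
  rewrite fx0; have [->|x0] := eqVneq (hnorm x) 0; first by rewrite mulr0.
  rewrite mulr_ge0 ?hnorm_ge0//.
  have := le_trans (bpos_Re x f0) (fc x); rewrite pmulr_lge0//.
  by rewrite exprn_gt0// lt_def x0 hnorm_ge0.
have fxp : 0 < hnorm (f x) by rewrite lt_def fx0 hnorm_ge0.
pose q u := complex.Re <|f u, u|>.
have q0 u : 0 <= q u := bpos_Re u f0.
have key (t : R) : 0 <= q x - t * hnorm (f x) ^+ 2 *+ 2 + t ^+ 2 * q (f x).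
  have := q0 (x - t%:C%C *: f x); rewrite /q linearB linearZ.
  rewrite dotBl !dotBr !dotZl !dotZr (fs (f x) x) !raddfB/=.
  rewrite !ReZ conjc_real !ReZ -sqr_hnormE; lra.
have q1 : q (f x) <= c * hnorm (f x) ^+ 2 := fc (f x).
have q2 : q x <= c * hnorm x ^+ 2 := fc x.
have c0 : 0 < c.
  rewrite ltNge; apply/negP => c0.
  have : q x <= 0 by rewrite (le_trans q2)// mulr_le0_ge0 ?sqr_ge0.
  have : q (f x) <= 0 by rewrite (le_trans q1)// mulr_le0_ge0 ?sqr_ge0.
  have := key 1; have := exprn_gt0 2 fxp; lra.
(* At t = 1/c the quadratic term is at most c^-1 |f x|^2, half of what the linear term subtracts,
   which leaves c^-1 |f x|^2 <= q x. *)
have := key c^-1; rewrite exprVn.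
have h3 : c ^- 2 * q (f x) <= c^-1 * hnorm (f x) ^+ 2.
  by rewrite ler_pdivrMl ?exprn_gt0// expr2 mulrA mulfK ?gt_eqF.
move=> h4; have h5 : c^-1 * hnorm (f x) ^+ 2 <= c * hnorm x ^+ 2 by lra.
rewrite -(@ler_pXn2r _ 2) ?nnegrE ?mulr_ge0 ?hnorm_ge0 ?(ltW c0)// exprMn.
by rewrite [c ^+ 2]expr2 -mulrA -ler_pdivrMl.
Qed.

Lemma bpos_bid_sub H (f : bop H H) : selfadjoint f ->
  (forall x, hnorm (f x) <= hnorm x) -> bpos (bid H - f).
Proof.
move=> fs f1; apply: selfadjoint_bpos => [x y|x].
  by rewrite !bopBE dotBl dotBr fs.
rewrite bopBE dotBl raddfB/= -sqr_hnormE subr_ge0.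
by rewrite (le_trans (Re_cauchy_schwarz _ _))// expr2 ler_wpM2r// hnorm_ge0.
Qed.

End Positive.

Section SquareRoot.
Variables (R : realType) (H : hilbertType R) (B : bop H H).
Hypothesis Bs : selfadjoint B.
Hypothesis B1 : forall x, hnorm (B x) <= hnorm x.

(* The limit S solves 2 S = B + S^2, so that (1 - S)^2 = 1 - B. *)
Let Y m := iter m (fun S : bop H H => (2^-1)%:C%C *: (B + S \bo S)) 0.
(** The same iteration with the scalar 1 in place of [B]. It dominates [Y] and its increments in
    norm, so the convergence of this bounded monotone sequence carries over to [Y]. *)
Let y m := iter m (fun s : R => 2^-1 * (1 + s ^+ 2)) 0.

Let YS m x : Y m.+1 x = (2^-1)%:C%C *: (B x + Y m (Y m x)). Proof. by []. Qed.
Let yS m : y m.+1 = 2^-1 * (1 + y m ^+ 2). Proof. by []. Qed.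

Let y0 m : 0 <= y m.
Proof.
by case: m => [//|m]; rewrite yS mulr_ge0 ?invr_ge0// addr_ge0 ?sqr_ge0.
Qed.

Let y1 m : y m <= 1.
Proof.
elim: m => [|m IH]; first exact: ler01.
by rewrite yS; have := y0 m; nra.
Qed.

Let y_incr m : y m <= y m.+1.
Proof. by rewrite yS; have := sqr_ge0 (1 - y m); nra. Qed.

Let y_nd : {homo y : m k / (m <= k)%N >-> m <= k}.
Proof. by apply/nondecreasing_seqP. Qed.

Let Yy m x : hnorm (Y m x) <= y m * hnorm x.
Proof.
elim: m x => [|m IH] x; first by rewrite mul0r hnorm0.
rewrite YS hnormZr ger0_norm ?invr_ge0// yS -mulrA ler_wpM2l ?invr_ge0//.
rewrite (le_trans (hnormD _ _))// mulrDl mul1r lerD// expr2 -mulrA.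
by rewrite (le_trans (IH _))// ler_wpM2l.
Qed.

Let YB m x : hnorm (Y m.+1 x - Y m x) <= (y m.+1 - y m) * hnorm x.
Proof.
elim: m x => [|m IH] x.
  rewrite YS yS -![Y 0%N _]/(0 : H) -![y 0%N]/(0 : R) !subr0 addr0.
  by rewrite hnormZr ger0_norm ?invr_ge0// expr0n addr0 mulr1 ler_wpM2l ?invr_ge0.
(* The difference of squares is split as P (P - Q) + (P - Q) Q, which requires no commutation. *)
have -> : Y m.+2 x - Y m.+1 x = (2^-1)%:C%C *: (Y m.+1 (Y m.+1 x - Y m x) +
    (Y m.+1 (Y m x) - Y m (Y m x))).
  by rewrite [Y m.+2 x]YS [X in _ - X = _]YS -scalerBr opprD addrACA subrr add0r [Y _
    (_ - _)]linearB [in RHS]addrA subrK.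
rewrite hnormZr ger0_norm ?invr_ge0//.
have -> : y m.+2 - y m.+1 = 2^-1 * (y m.+1 * (y m.+1 - y m) + (y m.+1 - y m) * y m).
  by rewrite yS (yS m); ring.
rewrite -mulrA ler_wpM2l ?invr_ge0// (le_trans (hnormD _ _))// mulrDl lerD//.
  by rewrite (le_trans (Yy _ _))// -mulrA ler_wpM2l.
by rewrite (le_trans (IH _))// -mulrA ler_wpM2l ?subr_ge0.
Qed.

Let YBk m k x : (m <= k)%N -> hnorm (Y k x - Y m x) <= (y k - y m) * hnorm x.
Proof.
move=> /subnK <-; elim: (k - m)%N => [|j IH]; first by rewrite !subrr mul0r hnorm0.
rewrite addSn -(subrK (Y (j + m) x) (Y _.+1 x)) -addrA (le_trans (hnormD _ _))//.
rewrite -(subrK (y (j + m)) (y _.+1)) -[X in _ <= X * _]addrA mulrDl lerD//.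
Qed.

Lemma one_sub_sqrt : exists S : bop H H,
  [/\ selfadjoint S, forall x, hnorm (S x) <= hnorm x &
      forall x, S x *+ 2 = B x + S (S x)].
Proof.
have yc : cvg (y @ \oo).
  by apply: nondecreasing_is_cvgn => //; exists 1 => _ [m _ <-].
pose l : R := lim (y @ \oo).
have yl m : y m <= l by exact: nondecreasing_cvgn_le.
have dl : (fun m => l - y m) @ \oo --> (0 : R).
  by rewrite -[X in _ --> X](subrr l); apply: cvgB => //; exact: cvg_cst.
have [m k x mk|S SP] := bop_cauchy_cvg (s := Y) dl.
  by rewrite (le_trans (YBk x mk))// ler_wpM2r ?hnorm_ge0// lerB.
have SY x : (fun m => Y m x) @ \oo --> S x.
  apply/(@cvg_hnormP _ _ ((fun m => Y m x) @ \oo)) => e e0.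
  have /cvgrPdist_lt /(_ e e0) : (fun m => (l - y m) * hnorm x) @ \oo --> (0 : R).
    by rewrite -[X in _ --> X](mul0r (hnorm x)); apply: cvgM => //; exact: cvg_cst.
  apply: filterS => m; rewrite sub0r normrN; apply: le_lt_trans.
  exact: le_trans (SP m x) (ler_norm _).
have S1 x : hnorm (S x) <= hnorm x.
  have /hnorm_cvg := SY x; move/cvgr_to_le; apply; apply: nearW => m.
  by rewrite (le_trans (Yy m x))// ler_piMl// hnorm_ge0.
exists S; split=> //.
- move=> x z.
  have h1 : (<|Y m x, z|> : scalars R) @[m --> \oo] --> (<|S x, z|> : scalars R).
    exact: dot_cvgl.
  have h2 : (<|x, Y m z|> : scalars R) @[m --> \oo] --> (<|x, S z|> : scalars R).
    exact: dot_cvgr.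
  have E m : <|Y m x, z|> = <|x, Y m z|>.
    elim: m x z {h1 h2} => [|m IH] x z; first by rewrite dot0l dot0r.
    by rewrite !YS dotZl dotZr geC0_conj ?lecR ?invr_ge0// dotDl dotDr Bs !IH.
  have h3 : (<|Y m x, z|> : scalars R) @[m --> \oo] --> (<|x, S z|> : scalars R).
    by apply: cvg_trans h2; apply: near_eq_cvg; apply: nearW => m; exact: esym (E m).
  by apply: (cvg_unique _ h1 h3); exact: norm_hausdorff.
- move=> x.
  suff : S x *+ 2 - (B x + S (S x)) = 0 by move/eqP; rewrite subr_eq0 => /eqP.
  (* Subtracting the recursion for [Y] leaves two copies of S - Y_(m+1), one of (S - Y_m) S and one
     of Y_m (S - Y_m), each at most e |x| at [x]: hence the 4. *)
  apply: (@hnorm_small _ _ _ (4 * hnorm x)) => e e0.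
  have /cvgrPdist_lt /(_ e e0) := dl; move=> [m _ mP].
  have lm k : (m <= k)%N -> l - y k <= e.
    by move=> mk; have := mP k mk; rewrite sub0r normrN ger0_norm ?subr_ge0// => /ltW.
  have d k u : (m <= k)%N -> hnorm (S u - Y k u) <= e * hnorm u.
    by move=> mk; rewrite (le_trans (SP k u))// ler_wpM2r ?hnorm_ge0// lm.
  have E : Y m.+1 x *+ 2 = B x + Y m (Y m x).
    rewrite YS -scaler_nat scalerA -[2%:R](rmorph_nat (real_complex R)) -rmorphM/=.
    by rewrite divff ?scale1r// pnatr_eq0.
  have -> : S x *+ 2 - (B x + S (S x)) =
      (S x - Y m.+1 x) *+ 2 - (S (S x) - Y m (S x)) - Y m (S x - Y m x).
    rewrite mulrnBl E [Y _ (_ - _)]linearB /=.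
    move: (S x *+ 2) (S (S x)) (Y m (S x)) (Y m (Y m x)) => u v w z.
    rewrite -!addrA; congr (_ + _); rewrite -!opprD; congr (- _).
    by rewrite -!addrA addKr [z + _]addrC subrK.
  have h1 := d _ x (leqnSn m); have h2 := d _ x (leqnn m).
  have h3 := d _ (S x) (leqnn m); have h4 := Yy m (S x - Y m x).
  have h5 : y m * hnorm (S x - Y m x) <= hnorm (S x - Y m x).
    by rewrite ler_piMl ?hnorm_ge0.
  have h6 : e * hnorm (S x) <= e * hnorm x by rewrite ler_wpM2l// ltW.
  apply: le_trans (hnormD _ _) _; rewrite hnormN.
  apply: (@le_trans _ _ (hnorm ((S x - Y m.+1 x) *+ 2) + hnorm (S (S x) - Y m (S x)) +
    hnorm (Y m (S x - Y m x)))).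
    by rewrite lerD2r -(hnormN (S (S x) - _)) hnormD.
  have h7 := hnormD (S x - Y m.+1 x) (S x - Y m.+1 x).
  by rewrite mulr2n; lra.
Qed.

End SquareRoot.

(** * Defect operators and factorization through a closed range *)

Section Defect.
Variable R : realType.
Implicit Types H K L M : hilbertType R.

Lemma Re_normr_ge0 (a : R[i]) : 0 <= complex.Re `|a|.
Proof. by rewrite normc_def sqrtr_ge0. Qed.

(** With c > |f| the operator B = 1 - f/c is a positive contraction, and sqrt c (1 - S) squares to c
    (1 - B) = f. The summand 1 in [c] keeps it positive when f = 0. *)
Lemma bsqrt_exists H (f : bop H H) : bpos f ->
  exists g : bop H H, bpos g /\ g \bo g = f.
Proof.
move=> f0; pose c := opnorm f + 1.
have c0 : 0 < c by rewrite ltr_wpDl// opnorm_ge0.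
have fs := bpos_selfadjoint f0.
pose B : bop H H := bid H - c^-1%:C%C *: f.
have BE x : B x = x - c^-1%:C%C *: f x by [].
have Bs : selfadjoint B.
  by move=> x z; rewrite !BE dotBl dotBr dotZl dotZr conjc_real fs.
have BRe x : complex.Re <|B x, x|> = hnorm x ^+ 2 - c^-1 * complex.Re <|f x, x|>.
  by rewrite BE dotBl dotZl raddfB/= ReZ -sqr_hnormE.
have B0 : bpos B.
  apply: selfadjoint_bpos => // x; rewrite BRe subr_ge0 ler_pdivrMl//.
  rewrite (le_trans (Re_cauchy_schwarz _ _))//.
  rewrite (le_trans (ler_wpM2r (hnorm_ge0 x) (hnorm_opnorm f x)))//.
  by rewrite -mulrA -expr2 ler_wpM2r ?sqr_ge0// lerDl.
have B1 x : hnorm (B x) <= hnorm x.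
  rewrite -[X in _ <= X]mul1r; apply: bpos_hnorm_le => // z.
  by rewrite BRe mul1r gerBl mulr_ge0 ?bpos_Re// invr_ge0 ltW.
have [S [Ss S1 SE]] := one_sub_sqrt Bs B1.
pose g : bop H H := (Num.sqrt c)%:C%C *: (bid H - S).
have gE y : g y = (Num.sqrt c)%:C%C *: (y - S y) by [].
exists g; split.
  move=> x; rewrite gE dotZl mulr_ge0//; first by rewrite lecR sqrtr_ge0.
  exact: bpos_bid_sub.
apply: bopP => x; rewrite -[LHS]/(g (g x)) !gE [S (_ *: _)]linearZ /= -scalerBr scalerA
  -rmorphM.
rewrite -expr2 sqr_sqrtr ?ltW// [S (_ - _)]linearB /=.
have -> : x - S x - (S x - S (S x)) = c^-1%:C%C *: f x.
  rewrite opprB addrACA -opprD -mulr2n SE BE.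
  by rewrite [x - _ + _]addrAC opprB addrC subrK.
by rewrite scalerA -rmorphM/= divff ?scale1r ?gt_eqF.
Qed.

Lemma bsqrtP H (f : bop H H) : bpos f -> bpos (bsqrt f) /\ bsqrt f \bo bsqrt f = f.
Proof. by move=> /bsqrt_exists /the_bopP. Qed.

Lemma hnorm_bsqrt H (f : bop H H) x : bpos f ->
  hnorm (bsqrt f x) ^+ 2 = complex.Re <|f x, x|>.
Proof.
move=> /bsqrtP[g0 {2}<-]; rewrite sqr_hnormE.
by rewrite -(bpos_selfadjoint g0).
Qed.

Lemma hnorm_to_clrange H K (f : bop H K) x : hnorm (to_clrange f x) = hnorm (f x).
Proof. exact: csub_norm. Qed.

Lemma bpos_defect H K (f : bop H K) : contraction f -> bpos (bid H - adj f \bo f).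
Proof.
move=> /contractionP f1; apply: bpos_bid_sub; first exact: selfadjoint_adj_comp.
move=> z; rewrite -[X in _ <= X]mul1r; apply: bpos_hnorm_le => [|u].
  exact: bpos_adj_comp.
by rewrite mul1r -hnorm_adj_comp lerXn2r ?nnegrE ?hnorm_ge0.
Qed.

Lemma hnorm_defect H K (f : bop H K) x : contraction f ->
  hnorm (to_defect f x) ^+ 2 = hnorm x ^+ 2 - hnorm (f x) ^+ 2.
Proof.
move=> f1; rewrite hnorm_to_clrange hnorm_bsqrt; last exact: bpos_defect.
by rewrite bopBE dotBl raddfB/= -hnorm_adj_comp -sqr_hnormE.
Qed.

Lemma clrange_approx H K (f : bop H K) (v : csub (clrange f)) (e : R) : 0 < e ->
  exists x, hnorm (v - to_clrange f x) < e.
Proof.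
move=> e0; have := csub_valP v; rewrite inE => /= /(_ [set u | hnorm (csub_val v - u) < e]).
case; first by apply/nbhs_ballP; exists e%:C%C => /=; rewrite ?ltcR// => u; rewrite
  -ball_normE /= hnormE ltcR.
by move=> _ [[x _ <-] /= xe]; exists x; rewrite csub_norm.
Qed.

Lemma clrange_ext H K L (f : bop H K) (g h : bop (csub (clrange f)) L) :
  (forall x, g (to_clrange f x) = h (to_clrange f x)) -> g = h.
Proof.
move=> gh; apply: bopP => v; apply/eqP; rewrite -subr_eq0; apply/eqP.
apply: (@hnorm_small _ _ _ (opnorm g + opnorm h)) => e e0.
have [x xe] := clrange_approx v e0.
have -> : g v - h v = g (v - to_clrange f x) - h (v - to_clrange f x).
  by rewrite (linearB g) (linearB h) /= gh opprB addrA subrK.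
rewrite (le_trans (hnormD _ _))// hnormN mulrDl lerD//.
  by rewrite (le_trans (hnorm_opnorm _ _))// ler_wpM2l ?opnorm_ge0// ltW.
by rewrite (le_trans (hnorm_opnorm _ _))// ler_wpM2l ?opnorm_ge0// ltW.
Qed.

(** The correspondence f x |-> g x is well defined and contractive on the range of [f], hence
    extends to the closure by limits along chosen approximations. *)
Lemma clrange_factor H K L (f : bop H K) (g : bop H L) :
  (forall x, hnorm (g x) <= hnorm (f x)) ->
  exists w : bop (csub (clrange f)) L, (forall x, w (to_clrange f x) = g x) /\
    forall v, hnorm (w v) <= hnorm v.
Proof.
move=> gf.
have e0 k : 0 < k.+1%:R^-1 :> R by rewrite invr_gt0.
pose u (v : csub (clrange f)) k := sval (cid (clrange_approx v (e0 k))).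
have uP v k : hnorm (v - to_clrange f (u v k)) < k.+1%:R^-1.
  by rewrite /u; case: cid.
have gT x y : hnorm (g x - g y) <= hnorm (to_clrange f x - to_clrange f y).
  by rewrite -!linearB hnorm_to_clrange gf.
have cg v : cvg ((fun k => g (u v k)) @ \oo).
  apply: cauchy_cvg; apply/(@cauchy_hnormP _ _ ((fun k => g (u v k)) @ \oo)) => e ep.
  have [m _ mP] := near_infty_natSinv_lt (PosNum (divr_gt0 ep (ltr0Sn R 1))).
  exists [set g (u v k) | k in [set k | (m <= k)%N]].
    by exists m => // k mk; exists k.
  move=> _ _ [k mk <-] [l ml <-]; rewrite (le_lt_trans (gT _ _))//.
  rewrite -(subrKA v) (le_lt_trans (hnormD _ _))// (splitr e) ltrD//.
    by rewrite hnormB_sym (lt_trans (uP _ _))// mP.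
  by rewrite (lt_trans (uP _ _))// mP.
pose w v := lim ((fun k => g (u v k)) @ \oo).
(* This bound makes the limit independent of the approximations chosen; the values on the range,
   linearity and contractivity all follow from it. *)
have wg v x : hnorm (w v - g x) <= hnorm (v - to_clrange f x).
  apply/ler_addgt0Pr => e ep.
  have : hnorm (g (u v k) - g x) @[k --> \oo] --> hnorm (w v - g x).
    by apply: hnorm_cvg; apply: cvgB; [exact: cg|exact: cvg_cst].
  move/cvgr_to_le; apply.
  have := near_infty_natSinv_lt (PosNum ep); apply: filterS => k /= ke.
  rewrite (le_trans (gT _ _))// -(subrKA v) (le_trans (hnormD _ _))// addrC lerD2l.
  by rewrite hnormB_sym ltW// (lt_trans (uP _ _)).
have wE x : w (to_clrange f x) = g x.
  by apply/eqP; rewrite -subr_eq0; apply/eqP/hnorm0_eq0/eqP;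
    rewrite eq_le hnorm_ge0 andbT (le_trans (wg _ _))// subrr hnorm0.
have wl : linear w.
  move=> a v1 v2; apply/eqP; rewrite -subr_eq0; apply/eqP.
  apply: (@hnorm_small _ _ _ ((complex.Re `|a| + 1) * 2)) => e ep.
  have [x1 x1e] := clrange_approx v1 ep; have [x2 x2e] := clrange_approx v2 ep.
  have h0 := wg (a *: v1 + v2) (a *: x1 + x2).
  have h1 : hnorm (a *: v1 + v2 - to_clrange f (a *: x1 + x2)) <=
      (complex.Re `|a| + 1) * e.
    rewrite linearP opprD addrACA -scalerBr (le_trans (hnormD _ _))// hnormZ.
    by rewrite mulrDl mul1r lerD ?(ltW x2e)// ler_wpM2l ?(ltW x1e)// Re_normr_ge0.
  have h2 : hnorm (a *: (g x1 - w v1) + (g x2 - w v2)) <= (complex.Re `|a| + 1) * e.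
    rewrite (le_trans (hnormD _ _))// hnormZ mulrDl mul1r.
    rewrite hnormB_sym [X in _ + X]hnormB_sym lerD//.
      by rewrite ler_wpM2l ?Re_normr_ge0// (le_trans (wg _ _))// ltW.
    by rewrite (le_trans (wg _ _))// ltW.
  rewrite mulrAC [_ * 2]mulr_natr mulr2n.
  rewrite (_ : w _ - _ = (w (a *: v1 + v2) - g (a *: x1 + x2)) +
     (a *: (g x1 - w v1) + (g x2 - w v2))).
    by rewrite (le_trans (hnormD _ _))// lerD// (le_trans h0).
  by rewrite (linearP g) scalerBr [X in _ = _ + X]addrACA -opprD [in RHS]addrA subrK.
have w1 v : hnorm (w v) <= 1 * hnorm v.
  by rewrite mul1r; have := wg v 0; rewrite (linear0 g) (linear0 (to_clrange f)) /= !subr0.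
exists (bop_of_bound wl w1); split=> [x|v]; first exact: wE.
by rewrite -[X in _ <= X]mul1r; exact: w1.
Qed.

Lemma adj_csub_inc H (N : closed_subspace H) (x : csub N) :
  adj (csub_inc N) (csub_inc N x) = x.
Proof. by apply: dot_ext => z; rewrite -adjPr. Qed.

Lemma hnorm_adj_le H K (f : bop H K) : (forall x, hnorm (f x) <= hnorm x) ->
  forall y, hnorm (adj f y) <= hnorm y.
Proof.
move=> f1 y; have [a0|a0] := eqVneq (hnorm (adj f y)) 0.
  by rewrite a0 hnorm_ge0.
have ap : 0 < hnorm (adj f y) by rewrite lt_def a0 hnorm_ge0.
rewrite -(ler_pM2r ap) -expr2 sqr_hnormE -adjPr.
by rewrite (le_trans (Re_cauchy_schwarz _ _))// ler_wpM2l ?hnorm_ge0.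
Qed.

(** The adjoint of the inclusion is the orthogonal projection onto the closed range, so the factor
    is extended by 0 on the orthogonal complement. *)
Lemma factor_through_clrange H K L (f : bop H K) (g : bop H L) :
  (forall x, hnorm (g x) <= hnorm (f x)) ->
  exists w : bop K L, (forall x, w (f x) = g x) /\
    forall v, hnorm (w v) <= hnorm v.
Proof.
move=> /clrange_factor[w [wE w1]].
exists (w \bo adj (csub_inc (clrange f))); split=> [x|v] /=.
  by rewrite -wE -[f x]/(csub_inc _ (to_clrange f x)) adj_csub_inc.
rewrite (le_trans (w1 _))//; apply: hnorm_adj_le => x.
by rewrite csub_norm.
Qed.

End Defect.

(** * Direct sums, rows and tensor products *)

Section HSumTheory.
Variables (R : realType) (I : choiceType) (H : I -> hilbertType R).
Implicit Types f g : hsum H.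

Lemma hpr_hin i (x : H i) : hpr i (hin i x) = x.
Proof. exact: hin_fun_id. Qed.

Lemma hin_neq i j (x : H i) : i != j -> hin i x j = 0.
Proof. exact: hin_fun_neq. Qed.

Lemma dot_hin i (x : H i) g : <|hin i x, g|> = <|x, g i|>.
Proof.
rewrite -[LHS]/(hsum_dot (hin i x) g).
have h1 := @hsum_dot_cvg _ _ _ (hin i x) g.
have h2 : fsum (fun j => <|hin i x j, g j|> : scalars R) A @[A --> totally] -->
    (<|x, g i|> : scalars R).
  apply/cvgrPdist_le => e e0; exists [fset i]%fset => // A iA.
  have {}iA : i \in A by apply: (fsubsetP iA); rewrite inE.
  rewrite /fsum (big_fsetD1 i)//= hin_fun_id big_seq big1 ?addr0 ?subrr ?normr0 ?ltW// => j.
  by rewrite !inE => /andP[ji _]; rewrite hin_fun_neq ?dot0l// eq_sym.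
by apply: (cvg_unique _ h1 h2); exact: norm_hausdorff.
Qed.

Lemma dot_hinr i (x : H i) g : <|g, hin i x|> = <|g i, x|>.
Proof. by rewrite dot_conj dot_hin -dot_conj. Qed.

Lemma hsum_sqr_norm_le f (M : R) :
  (forall A, fsum (fun i => hnorm (f i) ^+ 2) A <= M) -> hnorm f ^+ 2 <= M.
Proof.
move=> fM; have M0 : 0 <= M by have := fM fset0; rewrite /fsum big_seq_fset0.
rewrite -[leRHS]sqr_sqrtr// lerXn2r ?nnegrE ?hnorm_ge0 ?sqrtr_ge0//.
by apply: hsum_norm_le => [|A]; rewrite ?sqrtr_ge0// sqr_sqrtr.
Qed.

Lemma hsum_norm_cvg f :
  fsum (fun i => hnorm (f i) ^+ 2) A @[A --> totally] --> (hnorm f ^+ 2 : R).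
Proof.
have f0 i : 0 <= hnorm (f i) ^+ 2 by exact: sqr_ge0.
have := fsum_sup_cvg f0 (hsum_fsum_le f).
congr (_ --> _); apply/eqP; rewrite eq_le; apply/andP; split.
  apply: sup_le_ub; first by exists (fsum (fun i => hnorm (f i) ^+ 2) fset0), fset0.
  by move=> _ [A _ <-]; exact: hsum_fsum_le.
by apply: hsum_sqr_norm_le => A; exact: (fsum_sup (hsum_fsum_le f)).
Qed.

Lemma hsum_op_exists (K : hilbertType R) (f : forall i, bop K (H i)) (c : R) :
  0 <= c ->
  (forall x A, fsum (fun i => hnorm (f i x) ^+ 2) A <= (c * hnorm x) ^+ 2) ->
  exists g : bop K (hsum H),
    (forall x i, g x i = f i x) /\ forall x, hnorm (g x) <= c * hnorm x.
Proof.
move=> c0 fc.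
pose g x : hsum H := HSum (ex_intro _ _ (fc x)).
have gl : linear g by move=> a x y; apply: hsum_ext => i /=; rewrite linearP.
have gc x : hnorm (g x) <= c * hnorm x.
  by apply: hsum_norm_le => [|A]; rewrite ?mulr_ge0 ?hnorm_ge0//; exact: fc.
by exists (bop_of_bound gl gc).
Qed.

End HSumTheory.

(** Passes from coordinates to norms for all j at once, as estimates on a column require: separate
    bounds on the [f j] would not add up to the joint one. *)
Lemma hsum_sum_norm_le (R : realType) (I : choiceType) (J : Type) (r : seq J)
    (H : J -> I -> hilbertType R) (f : forall j, hsum (H j)) (M : R) :
  (forall A, \sum_(j <- r) fsum (fun i => hnorm (f j i) ^+ 2) A <= M) ->
  \sum_(j <- r) hnorm (f j) ^+ 2 <= M.
Proof.
move=> fM.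
have : \sum_(j <- r) fsum (fun i => hnorm (f j i) ^+ 2) A @[A --> totally] -->
    (\sum_(j <- r) hnorm (f j) ^+ 2 : R).
  elim: r {fM} => [|j r IH].
    rewrite big_nil (_ : (fun _ => _) = cst 0); first exact: cvg_cst.
    by apply/funext => A; rewrite big_nil.
  rewrite big_cons (_ : (fun _ => _) = (fun A => fsum (fun i => hnorm (f j i) ^+ 2) A)
    \+ (fun A => \sum_(j <- r) fsum (fun i => hnorm (f j i) ^+ 2) A)).
    by apply: cvgD => //; exact: hsum_norm_cvg.
  by apply/funext => A; rewrite big_cons.
by move/cvgr_to_le; apply; apply: nearW.
Qed.

Section HSumFin.
Variables (R : realType) (I : finType) (H : I -> hilbertType R).

Lemma hsum_fin_sum (f : hsum H) : f = \sum_i hin i (f i).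
Proof.
apply: hsum_ext => j; rewrite hsum_sumE (bigD1 j)//= -[hin_fun _ j]/(hpr j (hin j (f
  j))) hpr_hin.
by rewrite big1 ?addr0// => i ij; rewrite hin_fun_neq.
Qed.

Lemma dot_hsum_fin (f g : hsum H) : <|f, g|> = \sum_i <|f i, g i|>.
Proof. by rewrite {1}(hsum_fin_sum f) dot_suml; apply: eq_bigr => i _; exact: dot_hin. Qed.

Lemma hnorm_hsum_fin (f : hsum H) : hnorm f ^+ 2 = \sum_i hnorm (f i) ^+ 2.
Proof.
rewrite sqr_hnormE dot_hsum_fin raddf_sum; apply: eq_bigr => i _.
by rewrite /= -sqr_hnormE.
Qed.

End HSumFin.

Section HPlus.
Variables (R : realType) (H K : hilbertType R).
Implicit Types p q : hplus H K.

Lemma hprl_hinl (x : H) : hprl (hinl x : hplus H K) = x.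
Proof. exact: (@hpr_hin R bool (fun b => if b then H else K) true). Qed.
Lemma hprr_hinr (y : K) : hprr (hinr y : hplus H K) = y.
Proof. exact: (@hpr_hin R bool (fun b => if b then H else K) false). Qed.
Lemma hprl_hinr (y : K) : hprl (hinr y : hplus H K) = 0.
Proof. exact: (@hin_neq R bool (fun b => if b then H else K) false true). Qed.
Lemma hprr_hinl (x : H) : hprr (hinl x : hplus H K) = 0.
Proof. exact: (@hin_neq R bool (fun b => if b then H else K) true false). Qed.

Lemma hprl_pair (x : H) (y : K) : hprl (hinl x + hinr y) = x.
Proof. by rewrite bopD hprl_hinl hprl_hinr addr0. Qed.
Lemma hprr_pair (x : H) (y : K) : hprr (hinl x + hinr y) = y.
Proof. by rewrite bopD hprr_hinl hprr_hinr add0r. Qed.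

Lemma hplus_ext p q : hprl p = hprl q -> hprr p = hprr q -> p = q.
Proof. by move=> l r; apply: hsum_ext => -[]. Qed.

Lemma hnorm_hplus p : hnorm p ^+ 2 = hnorm (hprl p) ^+ 2 + hnorm (hprr p) ^+ 2.
Proof. by rewrite hnorm_hsum_fin big_bool. Qed.

Lemma hplus_dot p q : <|p, q|> = <|hprl p, hprl q|> + <|hprr p, hprr q|>.
Proof. by rewrite dot_hsum_fin big_bool. Qed.

End HPlus.

Section Rows.
Variable R : realType.
Implicit Types H K L : hilbertType R.

Lemma colvecE n (G : 'I_n -> hilbertType R) (y : forall i, G i) i :
  colvec y i = y i.
Proof.
rewrite hsum_sumE (bigD1 i)//= -[hin_fun _ i]/(hpr i (hin i (y i))) hpr_hin.
by rewrite big1 ?addr0// => j ij; rewrite hin_fun_neq.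
Qed.

Lemma dot_blockop n (G G' : 'I_n -> hilbertType R)
    (f : forall i j, bop (G j) (G' i)) x y :
  <|blockop f x, y|> = \sum_i \sum_j <|f i j (x j), y i|>.
Proof.
rewrite bop_sumE dot_suml; apply: eq_bigr => i _.
by rewrite bop_sumE dot_suml; apply: eq_bigr => j _; exact: dot_hin.
Qed.

(* The cross terms [<z_j, t_j^* s>], with [s] the sum, are bounded by AM-GM with weight [c^2]. *)
Lemma row_bound H K (J : Type) (r : seq J) (t : J -> bop K H) (c : R) (z : J -> K) :
  0 <= c ->
  (forall h, \sum_(j <- r) hnorm (adj (t j) h) ^+ 2 <= c ^+ 2 * hnorm h ^+ 2) ->
  hnorm (\sum_(j <- r) t j (z j)) ^+ 2 <= c ^+ 2 * \sum_(j <- r) hnorm (z j) ^+ 2.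
Proof.
move=> c0 tc; set s := \sum_(j <- r) t j (z j).
have sE : hnorm s ^+ 2 = \sum_(j <- r) complex.Re <|z j, adj (t j) s|>.
  rewrite sqr_hnormE {1}/s dot_suml raddf_sum; apply: eq_bigr => j _ /=.
  by rewrite adjP.
set a := \sum_(j <- r) hnorm (z j) ^+ 2.
have a0 : 0 <= a by apply: sumr_ge0 => j _; exact: sqr_ge0.
have key (l : R) : 0 < l -> hnorm s ^+ 2 *+ 2 <= l * a + l^-1 * (c ^+ 2 * hnorm s ^+ 2).
  move=> l0; apply: (@le_trans _ _ (l * a + l^-1 * \sum_(j <- r) hnorm (adj (t j) s) ^+ 2)).
    rewrite sE -sumrMnl !mulr_sumr -big_split/=; apply: ler_sum => j _.
    apply: le_trans (_ : (hnorm (z j) * hnorm (adj (t j) s)) *+ 2 <= _).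
      by rewrite lerMn2r /= Re_cauchy_schwarz.
    have -> : l * hnorm (z j) ^+ 2 + l^-1 * hnorm (adj (t j) s) ^+ 2 =
       (hnorm (z j) * hnorm (adj (t j) s)) *+ 2 +
        l^-1 * (l * hnorm (z j) - hnorm (adj (t j) s)) ^+ 2.
      by field; rewrite gt_eqF.
    by rewrite lerDl mulr_ge0 ?sqr_ge0// invr_ge0 ltW.
  by rewrite lerD2l ler_wpM2l ?invr_ge0 ?(ltW l0).
apply/ler_addgt0Pr => d d0.
(* The natural weight c^2 may be 0. Adding d / (a + 1) makes it positive and costs at most d. *)
have e0 : 0 < d / (a + 1) by rewrite divr_gt0// ltr_wpDl.
have l0 : 0 < c ^+ 2 + d / (a + 1) by rewrite ltr_wpDl ?sqr_ge0.
have := key _ l0; rewrite mulrA.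
have : (c ^+ 2 + d / (a + 1))^-1 * c ^+ 2 * hnorm s ^+ 2 <= hnorm s ^+ 2.
  by rewrite ler_piMl ?sqr_ge0// ler_pdivrMl// mulr1 lerDl ltW.
have : d / (a + 1) * a <= d.
  rewrite mulrAC ler_pdivrMr ?ltr_wpDl//; last by rewrite ler_wpM2l ?lerDl ?ltW.
rewrite mulrDl; lra.
Qed.

Lemma row_contraction_adj H n (T : 'I_n -> bop H H) h : row_contraction T ->
  \sum_i hnorm (adj (T i) h) ^+ 2 <= hnorm h ^+ 2.
Proof.
move=> Tc; have := bpos_Re h Tc; rewrite bopBE dotBl raddfB/= -sqr_hnormE subr_ge0.
rewrite bop_sumE dot_suml raddf_sum; congr (_ <= _); apply: eq_bigr => i _ /=.
by rewrite adjP -sqr_hnormE.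
Qed.

Lemma row_contraction_bound H n (T : 'I_n -> bop H H) (y : hpow H n) :
  row_contraction T -> hnorm (\sum_i T i (y i)) ^+ 2 <= hnorm y ^+ 2.
Proof.
move=> Tc; rewrite hnorm_hsum_fin -[leRHS]mul1r -(expr1n _ 2).
by apply: row_bound => // h; rewrite expr1n mul1r; exact: row_contraction_adj.
Qed.

Lemma hnorm_to_row_defect H n (T : 'I_n -> bop H H) y : row_contraction T ->
  hnorm (to_row_defect T y) ^+ 2 = hnorm y ^+ 2 - hnorm (\sum_i T i (y i)) ^+ 2.
Proof.
move=> Tc; rewrite hnorm_to_clrange /row_defect.
set f := blockop _; have fE u v : <|f u, v|> = <|u, v|> - <|\sum_i T i (u i), \sum_i T
  i (v i)|>.
  rewrite dot_blockop dot_hsum_fin dot_sumr -sumrB; apply: eq_bigr => i _.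
  under eq_bigr do rewrite bopBE dotBl.
  rewrite sumrB; congr (_ - _).
    rewrite (bigD1 i)//= eqxx big1 ?addr0// => j ji.
    by rewrite eq_sym (negPf ji) dot0l.
  by rewrite dot_suml; apply: eq_bigr => j _; rewrite -adjPr.
have fRe u : complex.Re <|f u, u|> = hnorm u ^+ 2 - hnorm (\sum_i T i (u i)) ^+ 2.
  by rewrite fE raddfB/= -!sqr_hnormE.
rewrite hnorm_bsqrt -/f ?fRe//; apply: selfadjoint_bpos => [u v|u].
  by rewrite fE [RHS]dot_conj fE rmorphB/= -!dot_conj.
by rewrite fRe subr_ge0 row_contraction_bound.
Qed.

End Rows.

(** * Tensor products of operators *)

Section TensorOps.
Variable R : realType.
Implicit Types H K L M : hilbertType R.

Lemma tens_ext H K L (f g : bop (htensor H K) L) :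
  (forall x y, f (tens x y) = g (tens x y)) -> f = g.
Proof.
move=> fg; apply: bopP => v; apply/eqP; rewrite -subr_eq0; apply/eqP.
apply: (@hnorm_small _ _ _ (opnorm f + opnorm g)) => e e0.
have [s sP] := @tens_dense _ _ _ v e e0.
set w := \sum_(p <- s) _ in sP.
have -> : f v - g v = f (v - w) - g (v - w).
  rewrite (linearB f) (linearB g) /= (_ : g w = f w) ?opprB ?addrA ?subrK//.
  by rewrite /w !linear_sum; apply: eq_bigr => p _ /=; rewrite fg.
rewrite (le_trans (hnormD _ _))// hnormN mulrDl lerD//.
  by rewrite (le_trans (hnorm_opnorm _ _))// ler_wpM2l ?opnorm_ge0.
by rewrite (le_trans (hnorm_opnorm _ _))// ler_wpM2l ?opnorm_ge0.
Qed.

Lemma htensor_map_exists H K L (g : bop K L) :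
  exists w : bop (htensor H K) (htensor H L), forall v b, w v b = g (v b).
Proof.
have [|v A|w [wE _]] := @hsum_op_exists R _ (fun=> L) (htensor H K)
    (fun b => g \bo hpr b) (opnorm g); first exact: opnorm_ge0.
  rewrite exprMn; apply: le_trans (_ : opnorm g ^+ 2 * fsum (fun b => hnorm (v b) ^+ 2)
    A <= _).
    rewrite /fsum mulr_sumr; apply: ler_sum => b _ /=; rewrite -exprMn.
    by rewrite lerXn2r ?nnegrE ?mulr_ge0 ?hnorm_ge0 ?opnorm_ge0// hnorm_opnorm.
  by rewrite ler_wpM2l ?sqr_ge0// hsum_fsum_le.
by exists w.
Qed.

Lemma hnorm_sum_orth H (J : eqType) (r : seq J) (f : J -> H) : uniq r ->
  (forall i j, i \in r -> j \in r -> i != j -> <|f i, f j|> = 0) ->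
  hnorm (\sum_(j <- r) f j) ^+ 2 = \sum_(j <- r) hnorm (f j) ^+ 2.
Proof.
elim: r => [|i r IH] /= => [_ _|/andP[ir ur] fo].
  by rewrite !big_nil hnorm0 expr0n.
rewrite !big_cons hnorm_orthD ?IH// => [j k jr kr|].
  by apply: fo; rewrite inE ?jr ?kr orbT.
rewrite dot_sumr big_seq big1// => j jr; apply: fo; rewrite ?inE ?eqxx ?jr ?orbT//.
by apply: contraNneq ir => ->.
Qed.

Lemma tensr_bound H K (x : K) (y : H) : hnorm (tens x y) <= hnorm x * hnorm y.
Proof. by rewrite hnorm_tens. Qed.

Lemma tensr_linear H K (x : K) : linear (fun y : H => tens x y).
Proof. by move=> a u v; rewrite tensDr tensZr. Qed.

Definition tensr_bop H K (x : K) : bop H (htensor K H) :=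
  bop_of_bound (tensr_linear x) (tensr_bound x).

(** The two factors are not treated alike: an operator on the second one acts coordinatewise, an
    operator on the first does not. The flip, an orthogonal sum of the vectors v_b ⊗ b, moves the
    latter to the second factor. *)
Lemma flip_exists H K : exists F : bop (htensor H K) (htensor K H),
  (forall x y, F (tens x y) = tens y x) /\ forall v, hnorm (F v) <= hnorm v.
Proof.
pose I : choiceType := set_type (@hbasis R H).
pose S (v : htensor H K) (b : I) : htensor K H := tens (v b) (val b).
have orth (b c : I) : <|val b, val c|> = (b == c)%:R :> R[i].
  by rewrite (hbasis_orthonormal (set_valP b) (set_valP c)).
have nS v A : hnorm (fsum (S v) A) ^+ 2 = fsum (fun b => hnorm (v b) ^+ 2) A.
  rewrite /fsum hnorm_sum_orth//; last first.
    by move=> b c _ _ /negPf bc; rewrite dot_tens orth bc mulr0.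
  apply: eq_bigr => b _; rewrite /S hnorm_tens.
  suff -> : hnorm (val b) = 1 by rewrite mulr1.
  by apply/eqP; rewrite -(@eqrXn2 _ 2) ?hnorm_ge0// sqr_hnormE orth eqxx expr1n.
have cS v : cvg (fsum (S v) @ totally).
  apply: fsum_cvg => [G GG|e e0]; first exact: cauchy_cvg.
  have [|A AP] := fsum_tail (@hsum_fsum_le _ _ _ v) (e := e ^+ 2).
    by rewrite exprn_gt0.
  exists A => B AB; rewrite -(@ltr_pXn2r _ 2) ?nnegrE ?hnorm_ge0 ?(ltW e0)//.
  by rewrite nS AP.
pose F v : htensor K H := lim (fsum (S v) @ totally).
have FE v l : fsum (S v) @ totally --> l -> F v = l.
  by move=> /cvg_lim; apply; exact: norm_hausdorff.
have Fl : linear F.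
  move=> a x y; apply: FE.
  rewrite (_ : fsum _ = (fun A => a *: fsum (S x) A + fsum (S y) A)).
    by apply: cvgD; [apply: cvgZl_tmp; exact: cS|exact: cS].
  apply/funext => A; rewrite /fsum scaler_sumr -big_split/=.
  by apply: eq_bigr => b _; rewrite /S tensDl tensZl.
have F1 v : hnorm (F v) <= 1 * hnorm v.
  rewrite mul1r; have /hnorm_cvg := cS v; move/cvgr_to_le; apply.
  apply: nearW => A; rewrite -(@ler_pXn2r _ 2) ?nnegrE ?hnorm_ge0// nS.
  exact: hsum_fsum_le.
exists (bop_of_bound Fl F1); split=> [x y|v]; last by rewrite -[leRHS]mul1r; exact: F1.
apply: FE.
have -> : fsum (S (tens x y)) =
    (fun A => tensr_bop H y (fsum (fun b : I => <|x, val b|> *: val b) A)).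
  apply/funext => A; rewrite /fsum bop_sum; apply: eq_bigr => b _.
  by rewrite bopZ /S /= tensZl.
exact: (bop_hnorm_cvg _ (@hbasis_expand R H x)).
Qed.

Lemma tens_op_exists H H' K K' (f : bop H H') (g : bop K K') :
  exists w : bop (htensor H K) (htensor H' K'),
    forall x y, w (tens x y) = tens (f x) (g y).
Proof.
have [F1 [F1E _]] := flip_exists H K'; have [F2 [F2E _]] := flip_exists K' H'.
have [G GE] := @htensor_map_exists H K K' g.
have [G' G'E] := @htensor_map_exists K' H H' f.
exists (F2 \bo G' \bo F1 \bo G) => x y; rewrite !bcompE.
have -> : G (tens x y) = tens x (g y) by apply: hsum_ext => b; rewrite GE /= linearZ.
rewrite F1E -F2E; congr (F2 _).
by apply: hsum_ext => b; rewrite G'E /= linearZ.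
Qed.

Lemma tens_opE H H' K K' (f : bop H H') (g : bop K K') x y :
  tens_op f g (tens x y) = tens (f x) (g y).
Proof. exact: (the_bopP (tens_op_exists f g)). Qed.

Lemma tens_op_comp H H' H'' K K' K'' (f : bop H' H'') (f' : bop H H')
    (g : bop K' K'') (g' : bop K K') :
  tens_op (f \bo f') (g \bo g') = tens_op f g \bo tens_op f' g'.
Proof. by apply: tens_ext => x y; rewrite bcompE !tens_opE. Qed.

Lemma tens_opDl H H' K K' (f f' : bop H H') (g : bop K K') :
  tens_op (f + f') g = tens_op f g + tens_op f' g.
Proof. by apply: tens_ext => x y; rewrite bopDE !tens_opE tensDl. Qed.

Lemma tens_op0l H H' K K' (g : bop K K') : tens_op (0 : bop H H') g = 0.
Proof.
by apply: tens_ext => x y; rewrite tens_opE -[(0 : bop _ _) x](scale0r 0) tensZl scale0r.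
Qed.

Lemma tens_op_suml H H' K K' (J : Type) (r : seq J) (P : pred J)
    (f : J -> bop H H') (g : bop K K') :
  tens_op (\sum_(j <- r | P j) f j) g = \sum_(j <- r | P j) tens_op (f j) g.
Proof.
by apply: (big_morph (fun f => tens_op f g)) => [u v|]; rewrite ?tens_opDl ?tens_op0l.
Qed.

Lemma tens_op_id H K : tens_op (bid H) (bid K) = bid (htensor H K).
Proof. by apply: tens_ext => x y; rewrite tens_opE. Qed.

Lemma tens_op_idl_coord H K K' (g : bop K K') (v : htensor H K) b :
  tens_op (bid H) g v b = g (v b).
Proof.
have [w wE] := @htensor_map_exists H K K' g; rewrite -wE.
suff -> : tens_op (bid H) g = w by [].
apply: tens_ext => x y; rewrite tens_opE; apply: hsum_ext => c.
by rewrite wE /= linearZ.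
Qed.

Lemma tens_op_row H K K' (J : Type) (r : seq J) (t : J -> bop K K') (c : R) :
  (forall z : J -> K, hnorm (\sum_(j <- r) t j (z j)) ^+ 2 <=
     c * \sum_(j <- r) hnorm (z j) ^+ 2) -> 0 <= c ->
  forall v : J -> htensor H K,
    hnorm (\sum_(j <- r) tens_op (bid H) (t j) (v j)) ^+ 2 <=
    c * \sum_(j <- r) hnorm (v j) ^+ 2.
Proof.
move=> tc c0 v; apply: hsum_sqr_norm_le => A.
apply: (@le_trans _ _ (c * \sum_(j <- r) fsum (fun b => hnorm (v j b) ^+ 2) A)).
  rewrite /fsum exchange_big mulr_sumr; apply: ler_sum => b _ /=.
  apply: le_trans (tc (fun j => v j b)); rewrite hsum_sumE le_eqVlt; apply/orP; left.
  apply/eqP; congr (hnorm _ ^+ 2).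
  by apply: eq_bigr => j _; exact: tens_op_idl_coord.
by rewrite ler_wpM2l//; apply: ler_sum => j _; exact: hsum_fsum_le.
Qed.

(** After a flip the operators act coordinatewise and the bound holds in each coordinate. The
    targets [L j] may differ, so that a single column can combine outputs and states of a system. *)
Lemma tens_op_column H (J : Type) (r : seq J) (L : J -> hilbertType R) K
    (a : forall j, bop H (L j)) (c : R) :
  (forall x, \sum_(j <- r) hnorm (a j x) ^+ 2 <= c * hnorm x ^+ 2) -> 0 <= c ->
  forall v : htensor H K,
    \sum_(j <- r) hnorm (tens_op (a j) (bid K) v) ^+ 2 <= c * hnorm v ^+ 2.
Proof.
move=> ac c0 v; have [F [FE F1]] := flip_exists H K.
apply: (@le_trans _ _ (\sum_(j <- r) hnorm (tens_op (bid K) (a j) (F v)) ^+ 2)).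
  apply: ler_sum => j _; have [F2 [F2E F21]] := flip_exists K (L j).
  have -> : tens_op (a j) (bid K) = F2 \bo tens_op (bid K) (a j) \bo F.
    by apply: tens_ext => x y; rewrite tens_opE !bcompE FE tens_opE F2E.
  by rewrite lerXn2r ?nnegrE ?hnorm_ge0// F21.
apply: (@le_trans _ _ (c * hnorm (F v) ^+ 2)); last first.
  by rewrite ler_wpM2l// lerXn2r ?nnegrE ?hnorm_ge0.
apply: hsum_sum_norm_le => A.
apply: (@le_trans _ _ (c * fsum (fun b => hnorm (F v b) ^+ 2) A)); last first.
  by rewrite ler_wpM2l// hsum_fsum_le.
rewrite /fsum exchange_big mulr_sumr; apply: ler_sum => b _ /=.
apply: le_trans (ac (F v b)); apply: ler_sum => j _.
by rewrite [tens_op _ _ _ _]tens_op_idl_coord.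
Qed.

Lemma tens_op_contraction H L K (a : bop H L) :
  (forall x, hnorm (a x) <= hnorm x) ->
  forall v : htensor H K, hnorm (tens_op a (bid K) v) <= hnorm v.
Proof.
move=> a1 v; rewrite -(@ler_pXn2r _ 2) ?nnegrE ?hnorm_ge0//.
have := @tens_op_column H unit [:: tt] (fun=> L) K (fun=> a) 1 _ ler01 v.
rewrite big_seq1 mul1r; apply => x; rewrite big_seq1 mul1r.
by rewrite lerXn2r ?nnegrE ?hnorm_ge0.
Qed.

End TensorOps.

(** * Evaluation of free power series *)

#[local] Opaque opnorm adj tens tens_op feval.

Lemma geom_sum_le (R : realType) (q : R) N : 0 <= q < 1 ->
  \sum_(i < N) q ^+ i <= (1 - q)^-1.
Proof.
move=> /andP[q0 q1]; have q2 : 0 < 1 - q by rewrite subr_gt0.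
rewrite -[leRHS]mul1r ler_pdivlMr// mulrC -opprB mulNr -subrX1 opprB.
by rewrite lerBlDr lerDl exprn_ge0.
Qed.

Lemma cvg_geom_mul (R : realType) (c q : R) : 0 <= q < 1 ->
  (fun N => c * q ^+ N) @ \oo --> (0 : R).
Proof.
move=> /andP[q0 q1]; rewrite -[X in _ --> X](mulr0 c).
by apply: cvgM; [exact: cvg_cst|apply: cvg_expr; rewrite ger0_norm].
Qed.

Lemma cvg0_near (R : realType) (u : nat -> R) (e : R) :
  u @ \oo --> (0 : R) -> 0 < e -> \forall N \near \oo, u N < e.
Proof.
move=> u0 e0; move/cvgrPdist_lt: u0 => /(_ e e0); apply: filterS => N.
by rewrite sub0r normrN; apply: le_lt_trans; exact: ler_norm.
Qed.

Section Words.
Variable n : nat.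

Lemma big_tuple_cons (V : nmodType) (F : seq 'I_n -> V) k :
  \sum_(a : k.+1.-tuple 'I_n) F a = \sum_i \sum_(a : k.-tuple 'I_n) F (i :: a).
Proof.
rewrite pair_big (reindex (fun p : 'I_n * k.-tuple 'I_n => [tuple of p.1 :: p.2]))//=.
exists (fun a : k.+1.-tuple 'I_n => (thead a, [tuple of behead a])) => [[i a] _|a _] /=.
  by congr pair; exact: val_inj.
by rewrite [RHS]tuple_eta; apply: val_inj.
Qed.

Lemma big_tuple0 (V : nmodType) (F : seq 'I_n -> V) :
  \sum_(a : 0.-tuple 'I_n) F a = F [::].
Proof.
rewrite (big_pred1 [tuple])// => a; apply/esym/eqP; exact: tuple0.
Qed.

Lemma big_tuple_split (V : nmodType) (F : seq 'I_n -> seq 'I_n -> V) i k :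
  (i <= k)%N -> \sum_(a : k.-tuple 'I_n) F (take i a) (drop i a) =
    \sum_(u : i.-tuple 'I_n) \sum_(v : (k - i).-tuple 'I_n) F u v.
Proof.
elim: i k F => [|i IH] k F.
  rewrite subn0 (big_tuple0 (fun u => \sum_(v : k.-tuple 'I_n) F u v)) => _.
  by apply: eq_bigr => a _; rewrite take0 drop0.
case: k => // k; rewrite ltnS => ik; rewrite subSS.
rewrite (big_tuple_cons (fun s => F (take i.+1 s) (drop i.+1 s))).
rewrite (big_tuple_cons (fun u => \sum_(v : (k - i).-tuple 'I_n) F u v)).
by apply: eq_bigr => j _; exact: (IH k (fun u v => F (j :: u) v)).
Qed.

Variables (R : realType) (Z : hilbertType R) (z : 'I_n -> bop Z Z).

Lemma word_op_cat a b : word_op z (a ++ b) = word_op z a \bo word_op z b.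
Proof. by apply: bopP => x; elim: a => //= i a ->. Qed.

Lemma word_op_bound (rho : R) k (x : seq 'I_n -> Z) : 0 <= rho ->
  (forall y : 'I_n -> Z, hnorm (\sum_i z i (y i)) ^+ 2 <=
     rho ^+ 2 * \sum_i hnorm (y i) ^+ 2) ->
  hnorm (\sum_(a : k.-tuple 'I_n) word_op z a (x a)) ^+ 2 <=
     (rho ^+ k) ^+ 2 * \sum_(a : k.-tuple 'I_n) hnorm (x a) ^+ 2.
Proof.
move=> r0 zr; elim: k x => [|k IH] x.
  rewrite (big_tuple0 (fun a => word_op z a (x a))).
  by rewrite (big_tuple0 (fun a => hnorm (x a) ^+ 2)) expr0 expr1n mul1r.
rewrite (big_tuple_cons (fun a => word_op z a (x a))).
rewrite (big_tuple_cons (fun a => hnorm (x a) ^+ 2)).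
have -> : \sum_i \sum_(a : k.-tuple 'I_n) word_op z (i :: a) (x (i :: a)) =
    \sum_i z i (\sum_(a : k.-tuple 'I_n) word_op z a (x (i :: a))).
  by apply: eq_bigr => i _; rewrite bop_sum.
rewrite (le_trans (zr _))// [rho ^+ k.+1]exprS exprMn -[leRHS]mulrA ler_wpM2l
  ?sqr_ge0// mulr_sumr.
by apply: ler_sum => i _; exact: (IH (fun a => x (i :: a))).
Qed.

End Words.

Lemma row_ball_bound (R : realType) n (Z : hilbertType R) (z : 'I_n -> bop Z Z) :
  row_ball z -> exists2 rho : R, 0 <= rho < 1 &
    forall y : 'I_n -> Z, hnorm (\sum_i z i (y i)) ^+ 2 <=
      rho ^+ 2 * \sum_i hnorm (y i) ^+ 2.
Proof.
rewrite /row_ball; set f := \sum_i _ => f1.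
exists (Num.sqrt (opnorm f)); first by rewrite sqrtr_ge0.
move=> y; apply: row_bound => [|h]; first exact: sqrtr_ge0.
rewrite sqr_sqrtr ?opnorm_ge0//.
apply: (@le_trans _ _ (complex.Re <|f h, h|>)).
  rewrite bop_sumE dot_suml raddf_sum; apply: ler_sum => i _ /=.
  by rewrite adjP -sqr_hnormE.
rewrite (le_trans (Re_cauchy_schwarz _ _))// expr2 mulrA ler_wpM2r ?hnorm_ge0//.
exact: hnorm_opnorm.
Qed.

Section Evaluation.
Variables (R : realType) (n : nat) (Z : hilbertType R).
Implicit Types M L K : hilbertType R.
Implicit Types z : 'I_n -> bop Z Z.

Definition hpart M L (C : seq 'I_n -> bop M L) z k : bop (htensor M Z) (htensor L Z) :=
  \sum_(a : k.-tuple 'I_n) tens_op (C a) (word_op z a).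

Definition psum M L (C : seq 'I_n -> bop M L) z N : bop (htensor M Z) (htensor L Z) :=
  \sum_(k < N) hpart C z k.

(** The property by which [feval] is chosen; identities between values of series are proved for it
    and transferred by uniqueness of the limit. *)
Definition feval_is M L (C : seq 'I_n -> bop M L) z
    (w : bop (htensor M Z) (htensor L Z)) : Prop :=
  (fun N => opnorm (w - psum C z N)) @ \oo --> (0 : R).

(** A bound in each degree separately. It suffices for geometric convergence on the ball, and it
    holds for the loop inputs, whose energies are only controlled level by level. *)
Definition col_contractive M L (C : seq 'I_n -> bop M L) : Prop :=
  forall k x, \sum_(a : k.-tuple 'I_n) hnorm (C a x) ^+ 2 <= hnorm x ^+ 2.

Lemma feval_is_bound M L (C : seq 'I_n -> bop M L) z (w : bop (htensor M Z) (htensor L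
  Z)) (d : nat -> R) :
  d @ \oo --> (0 : R) -> (forall N, 0 <= d N) ->
  (forall N v, hnorm (w v - psum C z N v) <= d N * hnorm v) -> feval_is C z w.
Proof.
move=> d0 dge wd; apply: (@squeeze_cvgr _ _ _ _ (cst 0) d) => //; last exact: cvg_cst.
by apply: nearW => N; rewrite opnorm_ge0 /=; apply: opnorm_le => // x; exact: wd.
Qed.

Lemma feval_is_uniq M L (C : seq 'I_n -> bop M L) z w w' :
  feval_is C z w -> feval_is C z w' -> w = w'.
Proof.
move=> h h'; apply: bopP => v; apply/eqP; rewrite -subr_eq0; apply/eqP.
apply: (@hnorm_small _ _ _ (2 * hnorm v)) => e e0.
have [N [N1 N2]] := filter_ex (filterI (cvg0_near h e0) (cvg0_near h' e0)).
have b1 : hnorm (w v - psum C z N v) <= opnorm (w - psum C z N) * hnorm v.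
  exact: (hnorm_opnorm (w - psum C z N) v).
have b2 : hnorm (w' v - psum C z N v) <= opnorm (w' - psum C z N) * hnorm v.
  exact: (hnorm_opnorm (w' - psum C z N) v).
have nv := hnorm_ge0 v.
rewrite -(subrKA (psum C z N v)) (le_trans (hnormD _ _))// [X in _ + X]hnormB_sym.
apply: le_trans (lerD b1 b2) _; rewrite mulrAC mulr_natl mulr2n mulrDl.
by apply: lerD; [exact: (ler_wpM2r nv (ltW N1))|exact: (ler_wpM2r nv (ltW N2))].
Qed.

Lemma feval_eq M L (C : seq 'I_n -> bop M L) z w :
  feval_is C z w -> feval C z = w.
Proof. by move=> h; apply: the_bop_eq => // g gC; exact: (feval_is_uniq (C := C) gC h). Qed.

Lemma feval_is_finite M L (C : seq 'I_n -> bop M L) z m :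
  (forall k, (m <= k)%N -> hpart C z k = 0) -> feval_is C z (psum C z m).
Proof.
move=> C0; apply/cvgrPdist_lt => e e0; exists m => // N /= mN.
rewrite (_ : psum C z N = psum C z m) ?subrr; last first.
  rewrite /psum -!(big_mkord xpredT (hpart C z)) (big_cat_nat _ mN)//=.
  rewrite [X in _ + X](_ : _ = 0) ?addr0// big_nat big1// => k /andP[mk _]; exact: C0.
rewrite sub0r normrN ger0_norm ?opnorm_ge0// (@le_lt_trans _ _ 0)//.
by apply: opnorm_le => // x; rewrite bop0E hnorm0 mul0r.
Qed.

Lemma feval_is_comp M L K (C : seq 'I_n -> bop M L) z w (t : bop L K) :
  feval_is C z w ->
  feval_is (fun a => t \bo C a) z (tens_op t (bid Z) \bo w).
Proof.
move=> h; set T := tens_op t _.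
have TE N : psum (fun a => t \bo C a) z N = T \bo psum C z N.
  apply: bopP => x; rewrite bcompE /psum !bop_sumE bop_sum; apply: eq_bigr => k _.
  rewrite /hpart !bop_sumE bop_sum; apply: eq_bigr => a _.
  rewrite -[word_op z a](_ : bid Z \bo word_op z a = _); last exact: bopP.
  by rewrite tens_op_comp.
apply: (@squeeze_cvgr _ _ _ _ (cst 0) (fun N => opnorm T * opnorm (w - psum C z N))).
- apply: nearW => N; rewrite opnorm_ge0 TE /=.
  apply: opnorm_le => [|x]; first by rewrite mulr_ge0 ?opnorm_ge0.
  rewrite bopBE !bcompE -bopB -mulrA (le_trans (hnorm_opnorm _ _))//.
  by rewrite ler_wpM2l ?opnorm_ge0// -bopBE hnorm_opnorm.
- exact: cvg_cst.
- by rewrite -[X in _ --> X](mulr0 (opnorm T)); apply: cvgM => //; exact: cvg_cst.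
Qed.

Section bounds.
Variables (z : 'I_n -> bop Z Z) (rho : R).
Hypothesis rho01 : 0 <= rho < 1.
Hypothesis z_rho : forall y : 'I_n -> Z, hnorm (\sum_i z i (y i)) ^+ 2 <=
  rho ^+ 2 * \sum_i hnorm (y i) ^+ 2.

Let rho0 : 0 <= rho. Proof. by case/andP: rho01. Qed.
Let d N := rho ^+ N * (1 - rho)^-1.
Let d0 N : 0 <= d N.
Proof. by rewrite mulr_ge0 ?exprn_ge0// invr_ge0 subr_ge0; case/andP: rho01 => _ /ltW. Qed.
Let dcvg : d @ \oo --> (0 : R).
Proof.
rewrite (_ : d = fun N => (1 - rho)^-1 * rho ^+ N); first exact: cvg_geom_mul.
by apply/funext => N; rewrite mulrC.
Qed.

Lemma tens_row_bound H (v : 'I_n -> htensor H Z) :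
  hnorm (\sum_i tens_op (bid H) (z i) (v i)) ^+ 2 <= rho ^+ 2 * \sum_i hnorm (v i) ^+ 2.
Proof. by apply: tens_op_row; rewrite ?sqr_ge0. Qed.

(** The part of degree k is the column of the [C a] ⊗ 1 followed by the row of the 1 ⊗ z_a; the
    column is contractive and the row has norm at most rho^k. *)
Lemma hpart_bound M L (C : seq 'I_n -> bop M L) k v : col_contractive C ->
  hnorm (hpart C z k v) <= rho ^+ k * hnorm v.
Proof.
move=> Cc; rewrite -(@ler_pXn2r _ 2) ?nnegrE ?mulr_ge0 ?exprn_ge0 ?hnorm_ge0//.
have -> : hpart C z k v = \sum_(a : k.-tuple 'I_n)
    tens_op (bid L) (word_op z a) (tens_op (C a) (bid Z) v).
  rewrite bop_sumE; apply: eq_bigr => a _; rewrite -bcompE -tens_op_comp.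
  by congr (tens_op _ _ v); exact: bopP.
apply: le_trans (tens_op_row (c := (rho ^+ k) ^+ 2) _ _ _) _; rewrite ?sqr_ge0//.
  (* [word_op_bound] takes families indexed by all words; the default 0 is never read on words of
     length k. *)
  move=> y; pose x a := if insub a is Some t then y (t : k.-tuple 'I_n) else 0.
  have xE (a : k.-tuple 'I_n) : x a = y a by rewrite /x valK.
  have := word_op_bound k x rho0 z_rho.
  by under eq_bigr do rewrite xE; under [X in _ * X]eq_bigr do rewrite xE.
rewrite exprMn ler_wpM2l ?sqr_ge0// -[leRHS]mul1r.
by apply: tens_op_column => // x; rewrite mul1r; exact: Cc.
Qed.

Lemma feval_exists M L (C : seq 'I_n -> bop M L) : col_contractive C ->
  feval_is C z (feval C z) /\
  forall N v, hnorm (feval C z v - psum C z N v) <= d N * hnorm v.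
Proof.
move=> Cc.
have [m k v mk|w wP] := bop_cauchy_cvg (s := psum C z) dcvg.
  rewrite -bopBE /psum -!(big_mkord xpredT (hpart C z)) (big_cat_nat _ mk)//= addrC addKr.
  rewrite bop_sumE (le_trans (hnorm_sum _ _ _))//.
  apply: (@le_trans _ _ (\sum_(m <= i < k) rho ^+ i * hnorm v)).
    by apply: ler_sum => i _; exact: hpart_bound.
  rewrite -mulr_suml ler_wpM2r ?hnorm_ge0//.
  rewrite -{1}(add0n m) big_addn big_mkord /d.
  under eq_bigr do rewrite exprD.
  by rewrite -mulr_suml mulrC ler_wpM2l ?exprn_ge0// geom_sum_le.
have wis : feval_is C z w by exact: feval_is_bound dcvg d0 wP.
by rewrite (feval_eq wis).
Qed.

(** The Cauchy product: [j] runs over the factorizations of the word into a prefix and a suffix. *)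
Definition conv M L K (C : seq 'I_n -> bop L K) (D : seq 'I_n -> bop M L) s : bop M K :=
  \sum_(j < (size s).+1) C (take j s) \bo D (drop j s).

Lemma hpart_conv M L K (C : seq 'I_n -> bop L K) (D : seq 'I_n -> bop M L) k :
  hpart (conv C D) z k = \sum_(i < k.+1) hpart C z i \bo hpart D z (k - i).
Proof.
apply: bopP => v; rewrite /hpart /conv !bop_sumE.
transitivity (\sum_(a : k.-tuple 'I_n) \sum_(i < k.+1)
    tens_op (C (take i a) \bo D (drop i a)) (word_op z (take i a) \bo word_op z (drop i
      a)) v).
  apply: eq_bigr => a _; rewrite tens_op_suml bop_sumE size_tuple.
  by apply: eq_bigr => i _; rewrite -word_op_cat cat_take_drop.
rewrite exchange_big; apply: eq_bigr => i _ /=.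
rewrite (big_tuple_split (fun u w => tens_op (C u \bo D w) (word_op z u \bo word_op z
  w) v)) -1?ltnS//.
rewrite !bop_sumE; apply: eq_bigr => u _; rewrite bop_sum.
by apply: eq_bigr => w _; rewrite tens_op_comp.
Qed.

Lemma psum_conv M L K (C : seq 'I_n -> bop L K) (D : seq 'I_n -> bop M L) N v :
  psum (conv C D) z N v = \sum_(i < N) hpart C z i (psum D z (N - i) v).
Proof.
elim: N => [|N IH]; first by rewrite /psum !big_ord0.
have psumS m : psum D z m.+1 = psum D z m + hpart D z m by rewrite /psum big_ord_recr.
rewrite [psum _ z N.+1]/psum big_ord_recr bopDE -[\sum_(i < N) _]/(psum _ z N) IH.
rewrite hpart_conv bop_sumE.
rewrite [RHS](eq_bigr (fun i : 'I_N.+1 => hpart C z i (psum D z (N - i) v) +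
   hpart C z i (hpart D z (N - i) v))); last first.
  by move=> i _; rewrite subSn -1?ltnS// psumS bopDE bopD.
rewrite big_split; congr (_ + _).
by rewrite big_ord_recr/= subnn /psum big_ord0 bop0E bop0 addr0.
Qed.

Lemma feval_conv M L K (C : seq 'I_n -> bop L K) (D : seq 'I_n -> bop M L) :
  col_contractive C -> col_contractive D ->
  feval_is (conv C D) z (feval C z \bo feval D z).
Proof.
move=> Cc Dc; have [_ Cd] := feval_exists Cc; have [_ Dd] := feval_exists Dc.
have /andP[_ rho1] := rho01.
have r0 := rho0.
(* The tail of the Cauchy product has N terms of order rho^N. With s > rho this becomes s^N times a
   geometric series in q = rho / s. *)
have [s s01 rs] : exists2 s : R, 0 < s < 1 & rho < s.
  by exists ((1 + rho) / 2); [apply/andP; split|]; lra.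
have [s0 s1] := andP s01.
pose q := rho / s.
have q01 : 0 <= q < 1 by rewrite divr_ge0 ?(ltW s0)//= ltr_pdivrMr// mul1r.
pose c := (1 - rho)^-1 * (opnorm (feval D z) + (1 - q)^-1).
have rho10 : 0 <= (1 - rho)^-1 by rewrite invr_ge0 subr_ge0 ltW.
have q10 : 0 <= (1 - q)^-1 by rewrite invr_ge0 subr_ge0; case/andP: q01 => _ /ltW.
have c0 : 0 <= c by rewrite mulr_ge0// addr_ge0 ?opnorm_ge0.
apply: (@feval_is_bound _ _ _ _ _ (fun N => c * s ^+ N)).
- by apply: cvg_geom_mul; rewrite (ltW s0).
- by move=> N; rewrite mulr_ge0// exprn_ge0// ltW.
move=> N v; rewrite psum_conv bcompE.
have -> : feval C z (feval D z v) - \sum_(i < N) hpart C z i (psum D z (N - i) v) =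
    (feval C z (feval D z v) - psum C z N (feval D z v)) +
    \sum_(i < N) hpart C z i (feval D z v - psum D z (N - i) v).
  under [X in _ = _ + X]eq_bigr do rewrite bopB.
  by rewrite sumrB /psum !bop_sumE addrA subrK.
rewrite (le_trans (hnormD _ _))// (_ : c * s ^+ N * hnorm v =
  (1 - rho)^-1 * s ^+ N * opnorm (feval D z) * hnorm v +
  (1 - rho)^-1 * s ^+ N * (1 - q)^-1 * hnorm v); last by rewrite /c; ring.
have rsN m : rho ^+ m <= s ^+ m by rewrite lerXn2r ?nnegrE ?(ltW s0) ?(ltW rs).
apply: lerD.
  rewrite (le_trans (Cd _ _))// -mulrA ler_pM ?hnorm_ge0 ?d0 ?hnorm_opnorm//.
  by rewrite /d mulrC ler_wpM2l.
rewrite (le_trans (hnorm_sum _ _ _))//.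
apply: (@le_trans _ _ (\sum_(i < N) (1 - rho)^-1 * s ^+ N * q ^+ i * hnorm v)); last first.
  rewrite -mulr_suml ler_wpM2r ?hnorm_ge0// -mulr_sumr ler_wpM2l ?geom_sum_le//.
  by rewrite mulr_ge0 ?exprn_ge0 ?(ltW s0).
apply: ler_sum => i _; rewrite (le_trans (hpart_bound _ _ Cc))//.
apply: (@le_trans _ _ (rho ^+ i * (d (N - i) * hnorm v))).
  by rewrite ler_wpM2l ?exprn_ge0.
rewrite mulrA ler_wpM2r ?hnorm_ge0// -[leRHS]mulrA.
have -> : s ^+ N * q ^+ i = rho ^+ i * s ^+ (N - i).
  rewrite -{1}(subnK (ltnW (ltn_ord i))) exprD /q [(rho / s) ^+ i]exprMn exprVn.
  by rewrite mulrACA divff ?mulr1 ?expf_neq0 ?gt_eqF// mulrC.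
rewrite /d mulrA [leRHS]mulrC ler_wpM2r// ler_wpM2l ?exprn_ge0//.
Qed.

End bounds.
End Evaluation.

(** * Evaluation at truncated creation operators *)

Section ShortWords.
Variable n : nat.
Implicit Types s a b : seq 'I_n.

Definition short N : seq (seq 'I_n) :=
  [seq tval t | k <- iota 0 N, t <- enum {: k.-tuple 'I_n}].

Lemma big_short (V : nmodType) (F : seq 'I_n -> V) N :
  \sum_(s <- short N) F s = \sum_(k < N) \sum_(a : k.-tuple 'I_n) F a.
Proof.
rewrite big_allpairs_dep -[X in iota 0 X]subn0 -/(index_iota 0 N) big_mkord.
by apply: eq_bigr => k _; rewrite big_enum.
Qed.

Lemma mem_short N s : (s \in short N) = (size s < N)%N.
Proof.
apply/allpairsPdep/idP => [[k [t [kN _ ->]]]|sN].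
  by rewrite size_tuple; move: kN; rewrite mem_iota.
by exists (size s), (in_tuple s); rewrite mem_iota mem_enum.
Qed.

Lemma short_uniq N : uniq (short N).
Proof.
apply: allpairs_uniq_dep; [exact: iota_uniq|by move=> k _; exact: enum_uniq|].
move=> [k t] [k' t'] _ _ /= tt'.
have kk' : k = k' by rewrite -(size_tuple t) -(size_tuple t') tt'.
by subst k'; congr existT; exact: val_inj.
Qed.

Lemma big_shortS (V : nmodType) (F : seq 'I_n -> V) N :
  \sum_(s <- short N.+1) F s = F [::] + \sum_i \sum_(s <- short N) F (i :: s).
Proof.
rewrite big_short big_ord_recl big_tuple0; congr (_ + _).
under [RHS]eq_bigr do rewrite (big_short (fun s => F (_ :: s))).
by rewrite exchange_big; apply: eq_bigr => k _; rewrite big_tuple_cons.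
Qed.

Lemma big_short_recr (V : nmodType) (F : seq 'I_n -> V) N :
  \sum_(s <- short N.+1) F s = \sum_(s <- short N) F s + \sum_(a : N.-tuple 'I_n) F a.
Proof. by rewrite !big_short big_ord_recr. Qed.

Lemma big_short_leq (V : nmodType) (F : seq 'I_n -> V) m N : (m <= N)%N ->
  \sum_(s <- short m) F s = \sum_(s <- short N | (size s < m)%N) F s.
Proof.
move=> mN; rewrite -[RHS]big_filter; apply: perm_big.
apply: uniq_perm; rewrite ?filter_uniq ?short_uniq// => s.
by rewrite mem_filter !mem_short; case: ltnP => // sm; rewrite (leq_trans sm).
Qed.

Lemma big_short_split (V : nmodType) (F : seq 'I_n -> seq 'I_n -> V) N :
  \sum_(s <- short N) \sum_(j < (size s).+1) F (take j s) (drop j s) =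
  \sum_(a <- short N) \sum_(b <- short N | (size a + size b < N)%N) F a b.
Proof.
transitivity (\sum_(a <- short N) \sum_(b <- short (N - size a)) F a b); last first.
  apply: eq_bigr => a _; rewrite (big_short_leq _ (leq_subr (size a) N)).
  by apply: eq_bigl => b; rewrite ltn_subRL.
elim: N F => [|N IH] F; first by rewrite !big_short !big_ord0.
rewrite 2!big_shortS /= subn0 big_shortS big_ord_recl big_ord0 addr0 -!addrA; congr (_ + _).
rewrite -big_split; apply: eq_bigr => i _ /=.
under eq_bigr do rewrite big_ord_recl/=.
rewrite big_split /=; congr (_ + _).
by rewrite -(IH (fun a b => F (i :: a) b)).
Qed.

End ShortWords.

(** Lets r tend to 1. One factor r is split off at a time, the mixed product being dominated by a
    power of the larger of the two numbers. *)
Lemma le_of_expr_mul (R : realType) (a b : R) k :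
  (forall r : R, 0 < r < 1 -> r ^+ k * a <= b) -> 0 <= a -> a <= b.
Proof.
elim: k a => [|k IH] a ab a0.
  by have := ab (2^-1); rewrite expr0 mul1r; apply; apply/andP; split; lra.
have key (r : R) : 0 < r < 1 -> r * a <= b.
  move=> /andP[r0 r1]; apply: IH => [s /andP[s0 s1]|]; last by rewrite mulr_ge0 ?(ltW r0).
  pose t := Num.max r s.
  have t01 : 0 < t < 1 by rewrite /t lt_max gt_max r0 r1 s1.
  apply: le_trans (ab t t01); rewrite mulrA ler_wpM2r// exprSr.
  have [t0 _] := andP t01.
  rewrite ler_pM ?exprn_ge0 ?(ltW s0) ?(ltW r0)//; last by rewrite le_max lexx.
  by rewrite lerXn2r ?nnegrE ?(ltW s0) ?(ltW t0)// le_max lexx orbT.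
rewrite leNgt; apply/negP => ba.
have ap : 0 < a by rewrite lt_def a0 andbT; apply/eqP => a00; have := key (2^-1);
  rewrite a00 mulr0 in ba *; lra.
have b0 : 0 <= b.
  by rewrite (le_trans _ (key 2^-1 _))//; [rewrite mulr_ge0 ?invr_ge0|apply/andP;
    split; lra].
(* If b < a, the midpoint of b / a and 1 is admissible and its product with a is (a + b) / 2 > b. *)
have := key ((b / a + 1) / 2).
have q1 : b / a < 1 by rewrite ltr_pdivrMr// mul1r.
have q0 : 0 <= b / a by rewrite divr_ge0.
have e : (b / a + 1) / 2 * a = (b + a) / 2 by field; rewrite gt_eqF.
rewrite e => /(_ _) h; have : 0 < (b / a + 1) / 2 < 1 by apply/andP; split; lra.
by move=> /h; lra.
Qed.

Section Orthonormal.
Variables (R : realType) (Z : hilbertType R).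

(** The [s j] are components of [x] in mutually orthogonal directions, with no normalization. If p
    is their sum, then |x|^2 - |p|^2 = |x - p|^2. *)
Lemma bessel (J : eqType) (r : seq J) (s : J -> Z) (x : Z) : uniq r ->
  (forall i j, i \in r -> j \in r -> i != j -> <|s i, s j|> = 0) ->
  (forall j, j \in r -> <|x, s j|> = <|s j, s j|>) ->
  \sum_(j <- r) hnorm (s j) ^+ 2 <= hnorm x ^+ 2.
Proof.
move=> ur so xs; rewrite -hnorm_sum_orth//; set p := \sum_(j <- r) s j.
have xp : <|x, p|> = <|p, p|>.
  rewrite {1}/p dot_sumr {1}/p dot_suml big_seq [RHS]big_seq; apply: eq_bigr => j jr.
  rewrite xs// /p dot_sumr (bigD1_seq j)//= big_seq_cond big1 ?addr0// => i /andP[ir ij].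
  by apply: so; rewrite // eq_sym.
rewrite -subr_ge0 (_ : _ - _ = hnorm (x - p) ^+ 2) ?sqr_ge0//.
rewrite [RHS]sqr_hnormD dotNr hnormN xp raddfN/= -sqr_hnormE; lra.
Qed.

(** A finite maximal orthonormal set would span [Z]; so [hbasis] is infinite, and the countable type
    [J] injects into it. *)
Lemma infinite_dim_orthonormal (J : countType) : infinite_dim Z ->
  exists v : J -> Z, forall i j, <|v i, v j|> = (i == j)%:R.
Proof.
move=> iZ; have iB : infinite_set (@hbasis R Z).
  move=> /finite_fsetP[B BE]; apply: iZ.
  exists (size (enum_fset B)), (fun i => nth 0 (enum_fset B) i) => x.
  exists (fun i => <|x, nth 0 (enum_fset B) i|>).
  rewrite -(big_mkord xpredT (fun i => <|x, nth 0 (enum_fset B) i|> *: nth 0 (enum_fset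
    B) i)).
  rewrite -(big_nth 0 xpredT (fun b => <|x, b|> *: b)).
  apply/eqP; rewrite -subr_eq0; apply/eqP; apply: hbasis_total => b Bb.
  have bB : b \in enum_fset B by move: Bb; rewrite BE.
  rewrite dotBl dot_suml (big_rem b)//= dotZl (hbasis_orthonormal Bb Bb) eqxx mulr1.
  rewrite big_seq big1 ?addr0 ?subrr// => c cB.
  have cb : c != b by move: cB; rewrite mem_rem_uniq ?fset_uniq// inE => /andP[].
  have Bc : hbasis c by rewrite BE; exact: (mem_rem cB).
  by rewrite dotZl (hbasis_orthonormal Bc Bb) (negPf cb) mulr0.
move/infiniteP: iB => /card_leP[f].
pose p (k : nat) : [set: nat] := SigSub (mem_set (I : [set: nat]%classic k)).
have pI : injective p by move=> k l [].
exists (fun i : J => val (f (p (choice.pickle i)))) => i j.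
rewrite (hbasis_orthonormal (set_valP (f _)) (set_valP (f _))).
rewrite (_ : (_ == _) = (i == j))//; apply/eqP/eqP => [|->//].
move=> /val_inj/(@inj _ _ _ f _ _ (mem_set I) (mem_set I))/pI; exact: (pcan_inj
  (@choice.pickleK J)).
Qed.

Definition rank1_fun (u w x : Z) := <|x, u|> *: w.

Lemma rank1_linear u w : linear (rank1_fun u w).
Proof. by move=> a x y; rewrite /rank1_fun dotDl dotZl scalerDl scalerA. Qed.

Lemma rank1_bound u w x : hnorm (rank1_fun u w x) <= hnorm u * hnorm w * hnorm x.
Proof.
rewrite hnormZ mulrAC ler_wpM2r ?hnorm_ge0// mulrC.
rewrite -lecR rmorphM/= -!hnormE (le_trans _ (cauchy_schwarz x u))//.
Qed.

Definition rank1 u w : bop Z Z := bop_of_bound (rank1_linear u w) (rank1_bound u w).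

Lemma rank1E u w x : rank1 u w x = <|x, u|> *: w. Proof. by []. Qed.

(** Turns extensionality of operators into totality: if x is orthogonal to vectors that determine an
    operator, then [rank1 x x] is 0. *)
Lemma rank1_eq0 x : rank1 x x = 0 -> x = 0.
Proof.
move=> /(congr1 (fun f : bop _ _ => <|f x, x|>)); rewrite rank1E dotZl bop0E dot0l.
rewrite dotxx_hnorm -rmorphM => /eqP; rewrite (inj_eq (@complexI _)) mulf_eq0 orbb.
by rewrite sqrf_eq0 => /eqP/hnorm0_eq0.
Qed.

End Orthonormal.

Lemma tens_total (R : realType) (H K : hilbertType R) (z : htensor H K) :
  (forall x y, <|z, tens x y|> = 0) -> z = 0.
Proof.
move=> h; apply: rank1_eq0; apply: tens_ext => x y.
by rewrite rank1E dot_conj h rmorph0 scale0r.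
Qed.

Lemma adj_tens_op (R : realType) (H H' K K' : hilbertType R) (f : bop H H') (g : bop K K') :
  adj (tens_op f g) = tens_op (adj f) (adj g).
Proof.
apply: tens_ext => x y; apply/eqP; rewrite -subr_eq0; apply/eqP; apply: tens_total => x' y'.
by rewrite dotBl -adjPr !tens_opE !dot_tens -!adjPr subrr.
Qed.

Section TruncatedCreation.
Variables (R : realType) (n : nat) (Z : hilbertType R) (v : seq 'I_n -> Z).
Hypothesis v_orth : forall a b, <|v a, v b|> = (a == b)%:R.
Variables (r : R) (N : nat).
Hypothesis r01 : 0 < r < 1.

(** The left creation operator on a copy of Fock space inside [Z], compressed to words of length at
    most N so that long products vanish, and scaled by r so that the tuple lies in the open ball. *)
Definition trunc_creation (i : 'I_n) : bop Z Z :=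
  \sum_(a <- short n N) r%:C%C *: rank1 (v a) (v (i :: a)).

Let z := trunc_creation.

Lemma trunc_creationE i x :
  z i x = \sum_(a <- short n N) (r%:C%C * <|x, v a|>) *: v (i :: a).
Proof. by rewrite bop_sumE; apply: eq_bigr => a _; rewrite bopZE rank1E scalerA. Qed.

Lemma trunc_creation_v i b :
  z i (v b) = if (size b < N)%N then r%:C%C *: v (i :: b) else 0.
Proof.
rewrite trunc_creationE -mem_short; case: ifPn => bN.
  rewrite (bigD1_seq b) ?short_uniq//= v_orth eqxx mulr1 big1 ?addr0// => a ab.
  by rewrite v_orth eq_sym (negPf ab) mulr0 scale0r.
rewrite big_seq big1// => a aN; rewrite v_orth (_ : (b == a) = false) ?mulr0 ?scale0r//.
by apply: contraNF bN => /eqP ->.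
Qed.

Lemma word_trunc_v a b : (size b <= N)%N -> word_op z a (v b) =
  if (size a + size b <= N)%N then (r ^+ size a)%:C%C *: v (a ++ b) else 0.
Proof.
move=> bN; elim: a => [|i a IH]; first by rewrite /= add0n bN expr0 scale1r.
rewrite -[word_op z (i :: a) (v b)]/(z i (word_op z a (v b))) IH.
case: ifPn => abN; last first.
  by rewrite bop0 ifN// addSn; apply: contraNN abN => /ltnW.
rewrite bopZ trunc_creation_v size_cat addSn; case: ifP => _; last by rewrite scaler0.
by rewrite scalerA -rmorphM/= -exprSr.
Qed.

Lemma word_trunc0 a : (N < size a)%N -> word_op z a = 0.
Proof.
(* The last letter acts first and lands in the span of the v (i :: b), where N further letters
   already give 0. *)
case/lastP: a => // a i; rewrite size_rcons ltnS => aN; apply: bopP => x.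
rewrite -cats1 word_op_cat bcompE -[word_op z [:: i] x]/(z i x) trunc_creationE.
rewrite bop_sum big_seq big1// => b; rewrite mem_short => bN.
rewrite bopZ word_trunc_v// ifN ?scaler0// -ltnNge /= addnS ltnS.
by rewrite (leq_trans aN)// leq_addr.
Qed.

Lemma adj_trunc_creation i : adj (z i) = \sum_(a <- short n N) r%:C%C *: rank1 (v (i ::
  a)) (v a).
Proof.
apply: adj_eq => x y; rewrite trunc_creationE dot_suml bop_sumE dot_sumr.
apply: eq_bigr => a _; rewrite bopZE rank1E !dotZl !dotZr conjc_real -dot_conj.
by rewrite -mulrA [<|x, v a|> * _]mulrC.
Qed.

Lemma hnorm_v a : hnorm (v a) = 1.
Proof. by apply/eqP; rewrite -(@eqrXn2 _ 2) ?hnorm_ge0// sqr_hnormE v_orth eqxx expr1n. Qed.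

(** Together the adjoints read the coefficients at nonempty words, each word once, so Bessel's
    inequality bounds the sum of the z_i z_i^* by r^2. *)
Lemma row_ball_trunc : row_ball z.
Proof.
have /andP[r0 r1] := r01; rewrite /row_ball.
rewrite (@le_lt_trans _ _ r)// -[leRHS]ger0_norm ?(ltW r0)// -sqrtr_sqr ler_wsqrtr//.
have pos : bpos (\sum_i z i \bo adj (z i)).
  move=> x; rewrite bop_sumE dot_suml sumr_ge0// => i _.
  by rewrite bcompE adjP dotxx_hnorm lecR sqr_ge0.
apply: opnorm_le => [|x]; first exact: sqr_ge0.
apply: bpos_hnorm_le => // {}x.
rewrite bop_sumE dot_suml raddf_sum.
apply: (@le_trans _ _ (\sum_i r ^+ 2 * \sum_(a <- short n N) hnorm (<|x, v (i :: a)|>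
  *: v (i :: a)) ^+ 2)).
  apply: ler_sum => i _ /=; rewrite adjP -sqr_hnormE adj_trunc_creation bop_sumE.
  rewrite hnorm_sum_orth ?short_uniq//; last first.
    move=> a b _ _ ab; rewrite !bopZE !rank1E !dotZl !dotZr v_orth (negPf ab) !mulr0//.
  rewrite mulr_sumr; apply: ler_sum => a _.
  by rewrite bopZE rank1E !hnormZ !hnorm_v !mulr1 exprMn normc_def/= expr0n addr0
    sqrtr_sqr ger0_norm ?(ltW r0).
rewrite -mulr_sumr ler_wpM2l ?sqr_ge0//.
apply: (@le_trans _ _ (\sum_(s <- short n N.+1) hnorm (<|x, v s|> *: v s) ^+ 2)).
  by rewrite big_shortS lerDr sqr_ge0.
apply: bessel; first exact: short_uniq.
  by move=> a b _ _ ab; rewrite !dotZl !dotZr v_orth (negPf ab) !mulr0.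
by move=> a _; rewrite !dotZl !dotZr v_orth eqxx mulr1 mulrC.
Qed.

Variables M L : hilbertType R.

Lemma feval_trunc (C : seq 'I_n -> bop M L) : feval C z = psum C z N.+1.
Proof.
apply: feval_eq; apply: feval_is_finite => k kN; rewrite /hpart big1// => a _.
rewrite word_trunc0 ?size_tuple//; apply: tens_ext => x y.
by rewrite tens_opE bop0E -(scale0r (0 : Z)) tensZr scale0r.
Qed.

(** The value is the truncated Toeplitz matrix of the coefficients. The weights r^|b| on the input
    are such that all terms landing on v s carry the same factor r^|s|. *)
Lemma feval_trunc_sum (C : seq 'I_n -> bop M L) (u : seq 'I_n -> M) :
  feval C z (\sum_(b <- short n N.+1) tens ((r ^+ size b)%:C%C *: u b) (v b)) =
  \sum_(s <- short n N.+1)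
    tens ((r ^+ size s)%:C%C *: \sum_(j < (size s).+1) C (take j s) (u (drop j s))) (v s).
Proof.
rewrite feval_trunc /psum bop_sumE.
transitivity (\sum_(a <- short n N.+1) \sum_(b <- short n N.+1 | (size a + size b < N.+1)%N)
    tens ((r ^+ (size a + size b))%:C%C *: C a (u b)) (v (a ++ b))).
  rewrite (big_short (fun a => \sum_(b <- short n N.+1 | (size a + size b < N.+1)%N) _)).
  apply: eq_bigr => k _; rewrite bop_sumE; apply: eq_bigr => a _.
  rewrite bop_sum big_seq [RHS]big_seq_cond [RHS]big_mkcondr/=; apply: eq_bigr => b.
  rewrite mem_short ltnS => bN; rewrite tens_opE word_trunc_v// ltnS; case: ifP => _;
    last first.
    by rewrite -(scale0r (0 : Z)) tensZr scale0r.
  by rewrite bopZ tensZr !tensZl scalerA -rmorphM/= -exprD.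
rewrite -(big_short_split (fun a b => tens ((r ^+ (size a + size b))%:C%C *: C a (u b))
  (v (a ++ b)))).
apply: eq_bigr => s _; rewrite scaler_sumr.
rewrite (big_morph (fun x => tens x (v s)) (fun x y => tensDl x y (v s)) (id1 := 0));
  last first.
  by rewrite -(scale0r (0 : L)) tensZl scale0r.
by apply: eq_bigr => j _; rewrite -size_cat cat_take_drop.
Qed.

Lemma hnorm_sum_tens_v m (t : seq 'I_n -> M) :
  hnorm (\sum_(s <- short n m) tens (t s) (v s)) ^+ 2 = \sum_(s <- short n m) hnorm (t
    s) ^+ 2.
Proof.
rewrite hnorm_sum_orth ?short_uniq// => [|a b _ _ ab].
  by apply: eq_bigr => s _; rewrite hnorm_tens hnorm_v mulr1.
by rewrite dot_tens v_orth (negPf ab) mulr0.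
Qed.

End TruncatedCreation.

Section NilpotentEvaluation.
Variables (R : realType) (n : nat) (Z M L : hilbertType R).
Hypothesis iZ : infinite_dim Z.

Lemma schur_toeplitz (C : seq 'I_n -> bop M L) (N : nat) (u : seq 'I_n -> M) :
  (fsup_norm Z C <= 1)%E ->
  \sum_(s <- short n N.+1) hnorm (\sum_(j < (size s).+1) C (take j s) (u (drop j s))) ^+ 2
  <= \sum_(s <- short n N.+1) hnorm (u s) ^+ 2.
Proof.
move=> C1; have [v v_orth] := @infinite_dim_orthonormal R Z (seq 'I_n) iZ.
have S0 (f : seq 'I_n -> R) : (forall s, 0 <= f s) -> 0 <= \sum_(s <- short n N.+1) f s.
  by move=> f0; apply: sumr_ge0 => s _; exact: f0.
(* In the squared norms each output carries the factor r^(2|s|) >= r^(2N), while the factors on the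
   inputs are at most 1. *)
apply: (@le_of_expr_mul _ _ _ (N + N)); last by apply: S0 => s; exact: sqr_ge0.
move=> r r01; have /andP[r0 r1] := r01.
pose z := trunc_creation v r N.
have zb : row_ball z by exact: row_ball_trunc.
have : opnorm (feval C z) <= 1.
  rewrite -lee_fin; apply: le_trans C1; apply: ereal_sup_ubound; by exists z.
move=> /contractionP.
move=> /(_ (\sum_(b <- short n N.+1) tens ((r ^+ size b)%:C%C *: u b) (v b))).
rewrite feval_trunc_sum// -(@ler_pXn2r _ 2) ?nnegrE ?hnorm_ge0// !hnorm_sum_tens_v//.
move=> h; apply: (@le_trans _ _ (\sum_(s <- short n N.+1) hnorm ((r ^+ size s)%:C%C *:
    \sum_(j < (size s).+1) C (take j s) (u (drop j s))) ^+ 2)).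
  rewrite mulr_sumr big_seq [leRHS]big_seq; apply: ler_sum => s; rewrite mem_short ltnS
    => sN.
  rewrite hnormZr exprMn ler_wpM2r ?sqr_ge0// ger0_norm ?exprn_ge0 ?(ltW r0)//.
  by rewrite -exprM muln2 addnn ler_wiXn2l ?(ltW r0) ?(ltW r1)// leq_double.
apply: (le_trans h); apply: ler_sum => s _.
rewrite hnormZr exprMn ler_piMl ?sqr_ge0// ger0_norm ?exprn_ge0 ?(ltW r0)//.
by rewrite -exprM exprn_ile1 ?(ltW r0) ?(ltW r1).
Qed.

(** One truncated tuple reads off the coefficient at a: an input placed at the empty word has
    [C a x] as its component at v a, up to a nonzero power of 1/2. *)
Lemma feval_inj (C D : seq 'I_n -> bop M L) :
  (forall z : 'I_n -> bop Z Z, row_ball z -> feval C z = feval D z) -> C = D.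
Proof.
move=> CD; have [v v_orth] := @infinite_dim_orthonormal R Z (seq 'I_n) iZ.
apply/funext => a; apply: bopP => x; apply: dot_ext => y.
have r01 : 0 < (2^-1 : R) < 1 by apply/andP; split; lra.
pose z := trunc_creation v (2^-1 : R) (size a).
have zb : row_ball z by exact: row_ball_trunc.
pose u (b : seq 'I_n) : M := if b is [::] then x else 0.
have key (E : seq 'I_n -> bop M L) :
  <|feval E z (\sum_(b <- short n (size a).+1) tens ((2^-1 ^+ size b)%:C%C *: u b) (v
    b)), tens y (v a)|>
    = (2^-1 ^+ size a)%:C%C * <|E a x, y|>.
  rewrite feval_trunc_sum// dot_suml (bigD1_seq a) ?short_uniq ?mem_short//=.
  rewrite dot_tens v_orth eqxx mulr1 [X in _ + X]big1; last first.
    by move=> s sa; rewrite dot_tens v_orth (negPf sa) mulr0.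
  rewrite addr0.
  rewrite dotZl big_ord_recr /= take_size drop_size big1 ?add0r// => j _.
  case E1 : (drop j a) => [|i b]; last by rewrite bop0.
  by have := ltn_ord j; rewrite -subn_gt0 -size_drop E1.
have := key D; rewrite -CD// key => /mulfI; apply.
by rewrite -(rmorph0 (real_complex R)) (inj_eq (@complexI _)) gt_eqF// exprn_gt0// invr_gt0.
Qed.

End NilpotentEvaluation.

(** * The closed loop of a Schur function *)

Section ColumnContractive.
Variables (R : realType) (n : nat).
Implicit Types M L K : hilbertType R.

Lemma bpos_words_gram M L (C : seq 'I_n -> bop M L) k : bpos (words_gram C k).
Proof.
move=> x; rewrite bop_sumE dot_suml sumr_ge0// => a _.
exact: bpos_adj_comp.
Qed.

Lemma Re_words_gram M L (C : seq 'I_n -> bop M L) k x :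
  complex.Re <|words_gram C k x, x|> = \sum_(a : k.-tuple 'I_n) hnorm (C a x) ^+ 2.
Proof.
rewrite bop_sumE dot_suml raddf_sum; apply: eq_bigr => a _.
by rewrite hnorm_adj_comp.
Qed.

Lemma col_contractive_free_holomorphic M L (C : seq 'I_n -> bop M L) :
  col_contractive C -> free_holomorphic C.
Proof.
move=> Cc; rewrite /free_holomorphic.
have C1 k : opnorm (words_gram C k) <= 1.
  apply: opnorm_le => // x; apply: bpos_hnorm_le; first exact: bpos_words_gram.
  by move=> y; rewrite mul1r Re_words_gram; exact: Cc.
(* The upper limit is an infimum over neighbourhoods of infinity, and the set of all k already gives
   the bound 1. *)
apply: le_trans (ereal_inf_lbound _) _; first by exists setT => //; exact: filterT.
apply: ge_ereal_sup => _ [k _ <-]; rewrite lee_fin.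
have p0 : 0 <= ((2 * k)%:R)^-1 :> R by rewrite invr_ge0.
have := @ge0_ler_powR R _ p0 (opnorm (words_gram C k)) 1 _ _ (C1 k).
by rewrite powR1 !nnegrE; apply; rewrite ?opnorm_ge0.
Qed.

Lemma short_contractive_H2ball M L (C : seq 'I_n -> bop M L) :
  (forall N x, \sum_(s <- short n N) hnorm (C s x) ^+ 2 <= hnorm x ^+ 2) -> H2ball C.
Proof.
move=> Cs; split.
  apply: col_contractive_free_holomorphic => k x; apply: le_trans (Cs k.+1 x).
  rewrite big_short big_ord_recr/= lerDr sumr_ge0// => i _.
  by rewrite sumr_ge0// => a _; rewrite sqr_ge0.
exists 1; split=> // N x; rewrite scale1r bopBE dotBl dotxx_hnorm.
have -> : <|(\sum_(k < N) words_gram C k) x, x|> =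
    (\sum_(s <- short n N) hnorm (C s x) ^+ 2)%:C%C.
  rewrite bop_sumE dot_suml big_short rmorph_sum; apply: eq_bigr => k _.
  by rewrite -Re_words_gram; have [-> _] := ReP (bpos_words_gram C k x).
by rewrite -rmorphB lecR subr_ge0.
Qed.

Lemma col_contractive_comp M L K (C : seq 'I_n -> bop M L) (t : bop L K) :
  (forall x, hnorm (t x) <= hnorm x) -> col_contractive C ->
  col_contractive (fun a => t \bo C a).
Proof.
move=> t1 Cc k x; apply: le_trans (Cc k x); apply: ler_sum => a _.
by rewrite lerXn2r ?nnegrE ?hnorm_ge0//; exact: t1.
Qed.

End ColumnContractive.

Section PrependLetter.
Variables (R : realType) (n : nat) (Z M L : hilbertType R).

(** A recursion of the coefficients on the first letter becomes U(z) = U_[] + sum_i z_i D_i(z). This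
    is the source of the resolvent equations of the closed loop and of the realization. *)
Lemma feval_is_cons (D : 'I_n -> seq 'I_n -> bop M L) (U : seq 'I_n -> bop M L)
    (z : 'I_n -> bop Z Z) (w : 'I_n -> bop (htensor M Z) (htensor L Z)) :
  (forall i s, U (i :: s) = D i s) -> (forall i, feval_is (D i) z (w i)) ->
  feval_is U z (tens_op (U [::]) (bid Z) + \sum_i tens_op (bid L) (z i) \bo w i).
Proof.
move=> UD Dw; set W := _ + _.
have psumS N : psum U z N.+1 = tens_op (U [::]) (bid Z) +
    \sum_i tens_op (bid L) (z i) \bo psum (D i) z N.
  apply: bopP => x; rewrite [psum U z _]/psum big_ord_recl bopDE [RHS]bopDE; congr (_ + _).
    by rewrite /hpart (big_tuple0 (fun a => tens_op (U a) (word_op z a))).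
  rewrite [LHS]bop_sumE [RHS]bop_sumE.
  rewrite [RHS](eq_bigr (fun i => \sum_(k < N) tens_op (bid L) (z i) (hpart (D i) z k
    x))); last first.
    by move=> i _; rewrite bcompE bop_sumE bop_sum.
  rewrite exchange_big; apply: eq_bigr => k _ /=.
  rewrite /hpart (big_tuple_cons (fun a => tens_op (U a) (word_op z a))) bop_sumE.
  apply: eq_bigr => i _; rewrite !bop_sumE bop_sum; apply: eq_bigr => a _.
  rewrite UD -bcompE -tens_op_comp; congr (tens_op _ _ x); exact: bopP.
rewrite /feval_is -cvg_shiftS.
have h : (\sum_i opnorm (tens_op (bid L) (z i)) * opnorm (w i - psum (D i) z N))
    @[N --> \oo] --> (0 : R).
  elim: (index_enum _) => [|i r IH].
    rewrite (_ : (fun _ => _) = cst 0); first exact: cvg_cst.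
    by apply/funext => N; rewrite big_nil.
  rewrite (_ : (fun _ => _) = (fun N => opnorm (tens_op (bid L) (z i)) * opnorm (w i -
    psum (D i) z N))
    \+ (fun N => \sum_(j <- r) opnorm (tens_op (bid L) (z j)) * opnorm (w j - psum (D
      j) z N))).
    rewrite -[X in _ --> X](addr0 0); apply: cvgD => //.
    rewrite -[X in _ --> X](mulr0 (opnorm (tens_op (bid L) (z i)))).
    by apply: cvgM; [exact: cvg_cst|exact: Dw].
  by apply/funext => N; rewrite big_cons.
apply: (@squeeze_cvgr _ _ _ _ (cst 0) _ _ _ _ _ h); last exact: cvg_cst.
apply: nearW => N; rewrite opnorm_ge0 /=; apply: opnorm_le => [|x].
  by apply: sumr_ge0 => i _; rewrite mulr_ge0 ?opnorm_ge0.
rewrite bopBE psumS /W !bopDE opprD addrACA subrr add0r [X in hnorm (X - _)]bop_sumE.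
rewrite [X in hnorm (_ - X)]bop_sumE -sumrB.
rewrite (le_trans (hnorm_sum _ _ _))// mulr_suml; apply: ler_sum => i _.
rewrite !bcompE -bopB -mulrA (le_trans (hnorm_opnorm _ _))// ler_wpM2l ?opnorm_ge0//.
exact: (hnorm_opnorm (w i - psum (D i) z N) x).
Qed.

End PrependLetter.

Section ClosedLoop.
Variables (R : realType) (n : nat) (M D : hilbertType R).
Variable Psi : seq 'I_n -> bop M (hplus D (hpow M n)).

Definition psiL a : bop M D := hprl \bo Psi a.
Definition psiM i a : bop M M := hpr i \bo hprr \bo Psi a.

(* [Psi] run with its [M_i] outputs fed back as inputs: [loop_in s] sends the
   initial vector to the input at the node [s] of the tree of words. *)
Fixpoint loop_in_rec k s : bop M M :=
  match s, k with
  | [::], _ => bid M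
  | i :: s', k'.+1 => \sum_(j < (size s').+1) psiM i (take j s') \bo loop_in_rec k'
    (drop j s')
  | _, _ => 0
  end.

(** [loop_in_rec] needs fuel because its recursive calls are on suffixes [drop j s']; the length of
    the word is enough. *)
Definition loop_in s := loop_in_rec (size s) s.
Definition loop_out s : bop M D := conv psiL loop_in s.

Lemma loop_in_nil : loop_in [::] = bid M. Proof. by []. Qed.

Lemma loop_in_recE k s : (size s <= k)%N -> loop_in_rec k s = loop_in s.
Proof.
move=> sk; suff : forall k' m s', (size s' <= k')%N -> (size s' <= m)%N ->
  loop_in_rec k' s' = loop_in_rec m s' by apply.
elim=> [|k' IH] m s'; first by case: s' => //; case: m.
case: s' => [|i s']; first by case: m.
case: m => //= m; rewrite !ltnS => s'k s'm; apply: eq_bigr => j _.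
have dj : (size (drop j s') <= size s')%N by rewrite size_drop leq_subr.
by rewrite (IH m) ?(leq_trans dj).
Qed.

Lemma loop_in_cons i s : loop_in (i :: s) = conv (psiM i) loop_in s.
Proof.
rewrite /loop_in /= /conv; apply: eq_bigr => j _.
by rewrite loop_in_recE// size_drop leq_subr.
Qed.

Definition loop_total s x := \sum_(j < (size s).+1) Psi (take j s) (loop_in (drop j s) x).

Lemma hprl_loop_total s x : hprl (loop_total s x) = loop_out s x.
Proof. by rewrite bop_sum /loop_out /conv bop_sumE. Qed.

Lemma hprr_loop_total i s x : hpr i (hprr (loop_total s x)) = loop_in (i :: s) x.
Proof. by rewrite !bop_sum loop_in_cons /conv bop_sumE. Qed.

Lemma hnorm_loop_total s x : hnorm (loop_total s x) ^+ 2 =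
  hnorm (loop_out s x) ^+ 2 + \sum_i hnorm (loop_in (i :: s) x) ^+ 2.
Proof.
rewrite hnorm_hplus hprl_loop_total hnorm_hsum_fin; congr (_ + _).
by apply: eq_bigr => i _; rewrite -hprr_loop_total.
Qed.

Variable Z : hilbertType R.
Hypothesis iZ : infinite_dim Z.
Hypothesis Psi1 : (fsup_norm Z Psi <= 1)%E.

Lemma loop_energy N x :
  \sum_(s <- short n N.+1) hnorm (loop_out s x) ^+ 2 +
  \sum_(a : N.+1.-tuple 'I_n) hnorm (loop_in a x) ^+ 2 <= hnorm x ^+ 2.
Proof.
have := schur_toeplitz iZ N (fun s => loop_in s x) Psi1.
under eq_bigr do rewrite -/(loop_total _ x) hnorm_loop_total.
rewrite big_split/= [leRHS]big_shortS loop_in_nil.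
(* The outputs passed to the children are the inputs at lengths 1 to N + 1. Those up to N occur on
   both sides and cancel, leaving the root on the right and level N + 1 on the left. *)
rewrite (big_short_recr (fun s => \sum_i hnorm (loop_in (i :: s) x) ^+ 2)).
rewrite (big_tuple_cons (fun a => hnorm (loop_in a x) ^+ 2)).
rewrite [X in _ <= _ + X -> _]exchange_big [X in _ -> _ + X <= _]exchange_big /=.
by rewrite [X in X <= _ -> _]addrCA [X in _ <= X -> _]addrC lerD2l.
Qed.

Lemma loop_out_contractive N x :
  \sum_(s <- short n N) hnorm (loop_out s x) ^+ 2 <= hnorm x ^+ 2.
Proof.
apply: le_trans (loop_energy N x); rewrite [X in _ <= X + _]big_short big_ord_recr/=.
rewrite big_short -addrA lerDl addr_ge0// ?sumr_ge0// => a _; exact: sqr_ge0.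
Qed.

Lemma col_contractive_loop_in : col_contractive loop_in.
Proof.
move=> [|k] x; first by rewrite (big_tuple0 (fun a => hnorm (loop_in a x) ^+ 2)).
apply: le_trans (loop_energy k x); rewrite lerDr sumr_ge0// => i _; exact: sqr_ge0.
Qed.

Lemma col_contractive_Psi : col_contractive Psi.
Proof.
move=> k x; pose u (b : seq 'I_n) : M := if b is [::] then x else 0.
have := schur_toeplitz iZ k u Psi1.
have -> : \sum_(s <- short n k.+1) hnorm (u s) ^+ 2 = hnorm x ^+ 2.
  rewrite big_shortS [X in _ + X]big1 ?addr0// => i _.
  by rewrite big1// => s _; rewrite hnorm0 expr0n.
apply: le_trans; rewrite big_short big_ord_recr/=.
apply: (@le_trans _ _ (\sum_(a : k.-tuple 'I_n)
   hnorm (\sum_(j < (size a).+1) Psi (take j a) (u (drop j a))) ^+ 2)).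
  apply: ler_sum => a _; rewrite big_ord_recr /= take_size drop_size big1 ?add0r// => j _.
  case E1 : (drop j a) => [|i b]; last by rewrite bop0.
  by have := ltn_ord j; rewrite -subn_gt0 -size_drop E1.
by rewrite lerDr sumr_ge0// => i _; rewrite sumr_ge0// => a _; rewrite sqr_ge0.
Qed.

Lemma hprl_contractive (p : hplus D (hpow M n)) : hnorm (hprl p) <= hnorm p.
Proof. exact: (hsum_coord_le p true). Qed.

Lemma hpr_hprr_contractive i (p : hplus D (hpow M n)) :
  hnorm ((hpr i \bo hprr) p) <= hnorm p.
Proof. exact: le_trans (hsum_coord_le _ i) (hsum_coord_le p false). Qed.

(** The recursion of [loop_in] gives a right inverse of the pencil 1 - K. Since K is the row z after
    a contractive column, its norm is at most rho < 1; so the pencil is injective and the inverse is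
    two-sided. *)
Lemma loop_transfer (z : 'I_n -> bop Z Z) : row_ball z ->
  let pencil := bid _ - \sum_i tens_op (bid M) (z i) \bo feval (psiM i) z in
  is_inverse pencil (feval loop_in z) /\
  feval loop_out z = feval psiL z \bo feval loop_in z.
Proof.
move=> zb /=; have [rho rho01 zr] := row_ball_bound zb.
have Pc := col_contractive_Psi; have Uc := col_contractive_loop_in.
have Lc : col_contractive psiL := col_contractive_comp hprl_contractive Pc.
have Mc i : col_contractive (psiM i).
  exact: (col_contractive_comp (hpr_hprr_contractive i) Pc).
have [Pis _] := feval_exists rho01 zr Pc.
have [Uis _] := feval_exists rho01 zr Uc.
split; last by apply: feval_eq; exact: feval_conv rho01 zr _ _ _ _ _ Lc Uc.
set K := \sum_i _; set w := feval loop_in z.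
have Kw u : w u - K (w u) = u.
  have := feval_is_cons loop_in_cons (fun i => feval_conv rho01 zr (Mc i) Uc).
  rewrite loop_in_nil tens_op_id => /(feval_is_uniq Uis) wE.
  apply/eqP; rewrite subr_eq; apply/eqP.
  by rewrite {1}/w wE bopDE /K !bop_sumE.
have K1 x : hnorm (K x) <= rho * hnorm x.
  have rho0 : 0 <= rho by case/andP: rho01.
  rewrite -(@ler_pXn2r _ 2) ?nnegrE ?mulr_ge0 ?hnorm_ge0// exprMn /K bop_sumE.
  rewrite (le_trans (tens_row_bound zr _))// ler_wpM2l ?sqr_ge0//.
  have -> : \sum_i hnorm (feval (psiM i) z x) ^+ 2 =
     \sum_i hnorm (tens_op (hpr i \bo hprr) (bid Z) (feval Psi z x)) ^+ 2.
    apply: eq_bigr => i _.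
    by rewrite (feval_eq (feval_is_comp (hpr i \bo hprr) Pis)).
  rewrite (le_trans (tens_op_column (c := 1) _ _ _))//.
    by move=> p; rewrite mul1r [leRHS]hnorm_hplus hnorm_hsum_fin lerDr sqr_ge0.
  rewrite mul1r lerXn2r ?nnegrE ?hnorm_ge0//.
  have P1 : opnorm (feval Psi z) <= 1.
    by rewrite -lee_fin; apply: le_trans Psi1; apply: ereal_sup_ubound; exists z.
  exact: (contractionP _).1 P1 _.
split; apply: bopP => x; rewrite bcompE; first by rewrite bopBE; exact: Kw.
apply/eqP; rewrite -subr_eq0; apply/eqP; set y := _ - _.
have yK : y = K y.
  have yE : y = w (x - K x) - x by [].
  by apply/eqP; rewrite -subr_eq0 yE (bopB K) opprD addrACA Kw -opprD subrr.
apply: hnorm0_eq0; apply/eqP; rewrite eq_le hnorm_ge0 andbT.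
have := K1 y; rewrite -{1}yK -subr_le0 -{1}[hnorm _]mul1r -mulrBl pmulr_rle0// subr_gt0.
by case/andP: rho01.
Qed.

End ClosedLoop.

(** * Fock space and symbols *)

Section FockTheory.
Variables (R : realType) (n : nat) (Hn : hilbertType R) (e : 'I_n -> Hn).
Hypothesis e_onb : is_onb e.
Implicit Types a b w : seq 'I_n.

Let creation_part i k : bop (fock Hn) (tpow Hn k) :=
  match k with
  | 0 => 0
  | k'.+1 => tensr_bop (tpow Hn k') (e i) \bo hpr k'
  end.

Lemma creation_exists i : exists s : bop (fock Hn) (fock Hn),
  forall phi : fock Hn, hpr 0%N (s phi) = 0 /\
    forall k, hpr k.+1 (s phi) = tens (e i) (hpr k phi).
Proof.
have [||s [sE _]] := @hsum_op_exists R nat (tpow Hn) (fock Hn) (creation_part i) (hnorm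
  (e i)).
- exact: hnorm_ge0.
- move=> phi A; rewrite exprMn.
  (* Degree 0 of the output vanishes; the other degrees in A, lowered by one, are degrees of the
     input. *)
  pose A' := [fset k.-1 | k in [fset k in A | (0 < k)%N]]%fset.
  apply: (@le_trans _ _ (hnorm (e i) ^+ 2 * fsum (fun k => hnorm (phi k) ^+ 2) A')).
    rewrite /fsum /A' big_imfset/=; last first.
      by move=> [|k] [|l]; rewrite !inE ?andbF//= => _ _ ->.
    rewrite (big_fsetID _ (fun k => (0 < k)%N))/= [X in _ + X]big1_fset ?addr0; last first.
      move=> k; rewrite !inE /= => /andP[_]; rewrite -eqn0Ngt => /eqP -> _.
      by rewrite hnorm0 expr0n.
    rewrite mulr_sumr big_seq [leRHS]big_seq; apply: ler_sum => k.
    rewrite !inE /= => /andP[_]; case: k => //= k _.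
    by rewrite hnorm_tens exprMn.
  by rewrite ler_wpM2l ?sqr_ge0// hsum_fsum_le.
exists s => phi; split=> [|k]; first exact: (sE phi 0%N).
exact: (sE phi k.+1).
Qed.

Lemma creation_hpr0 i phi : hpr 0%N (creation e i phi) = 0.
Proof. exact: (the_bopP (creation_exists i) phi).1. Qed.

Lemma creation_hprS i k phi : hpr k.+1 (creation e i phi) = tens (e i) (hpr k phi).
Proof. exact: (the_bopP (creation_exists i) phi).2. Qed.

Lemma evec_nil : hpr 0%N (evec e [::]) = (1 : scalars R).
Proof. exact: (@hpr_hin R nat (tpow Hn) 0%N). Qed.

Lemma evec_nil_neq k : hpr k.+1 (evec e [::]) = 0.
Proof. exact: (@hin_neq R nat (tpow Hn) 0%N k.+1). Qed.

Lemma evec_cons_neq i a : hpr 0%N (evec e (i :: a)) = 0.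
Proof. exact: (@hin_neq R nat (tpow Hn) (size a).+1 0%N). Qed.

Lemma evec_cons i a k : hpr k.+1 (evec e (i :: a)) = tens (e i) (hpr k (evec e a)).
Proof.
have [<-|ak] := eqVneq (size a) k.
  transitivity (tens (e i) (etens e a)).
    exact: (@hpr_hin R nat (tpow Hn) (size a).+1).
  congr (tens _ _); apply/esym; exact: (@hpr_hin R nat (tpow Hn) (size a)).
transitivity (0 : tpow Hn k.+1).
  by apply: (@hin_neq R nat (tpow Hn) (size a).+1 k.+1); rewrite eqSS.
rewrite [hpr k _](_ : _ = 0); first by rewrite -(scale0r (0 : tpow Hn k)) tensZr scale0r.
exact: (@hin_neq R nat (tpow Hn) (size a) k).
Qed.

Lemma dot_evecr a phi : <|phi, evec e a|> = <|hpr (size a) phi, etens e a|>.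
Proof. exact: dot_hinr. Qed.

Lemma dot_evec a b : <|evec e a, evec e b|> = (a == b)%:R.
Proof.
rewrite dot_evecr; elim: b a => [|j b IH] [|i a].
- rewrite evec_nil /= -[LHS]/(1 * Num.conj (1 : R[i])).
  by rewrite rmorph1 mulr1.
- by rewrite evec_cons_neq dot0l.
- by rewrite evec_nil_neq dot0l.
- rewrite [hpr _ _]evec_cons dot_tens IH e_onb.1 -natrM mulnb; congr (_%:R).
Qed.

Lemma dot_creation_nil i phi : <|creation e i phi, evec e [::]|> = 0.
Proof. by rewrite dot_evecr creation_hpr0 dot0l. Qed.

Lemma dot_creation_cons i j phi a :
  <|creation e i phi, evec e (j :: a)|> = (i == j)%:R * <|phi, evec e a|>.
Proof. by rewrite dot_evecr [hpr _ _]creation_hprS dot_tens e_onb.1 dot_evecr. Qed.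

(** Projecting [evec e a] to degree k gives the basis tensor of a, or 0 if a has another length;
    this avoids casts along [size a = k]. *)
Lemma tpow_ext k (K : hilbertType R) (g : bop (tpow Hn k) K) :
  (forall a, g (hpr k (evec e a)) = 0) -> g = 0.
Proof.
elim: k g => [|k IH] g ga.
  apply: bopP => x; have := ga [::]; rewrite evec_nil => g1.
  have -> : x = (x : R[i]) *: (1 : scalars R) by rewrite -[RHS]/(_ * _) mulr1.
  by rewrite bopZ g1 scaler0.
apply: (@tens_ext R Hn (tpow Hn k)) => x y; rewrite bop0E.
have [c ->] := e_onb.2 x.
have -> : tens (\sum_i c i *: e i) y = \sum_i c i *: tens (e i) y.
  rewrite (big_morph (fun x => tens x y) (fun u v => tensDl u v y) (id1 := 0)).
    by apply: eq_bigr => i _; rewrite tensZl.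
  by rewrite -(scale0r (0 : Hn)) tensZl scale0r.
rewrite bop_sum big1// => i _; rewrite bopZ.
have : (g : bop (htensor Hn (tpow Hn k)) K) \bo tensr_bop (tpow Hn k) (e i) = 0.
  by apply: IH => a; rewrite bcompE -(ga (i :: a)) evec_cons.
by move=> /(congr1 (fun f : bop _ _ => f y)) /= ->; rewrite scaler0.
Qed.

Lemma fock_ext (K : hilbertType R) (g : bop (fock Hn) K) :
  (forall a, g (evec e a) = 0) -> g = 0.
Proof.
move=> ga.
have gk k : g \bo hin k = 0.
  apply: tpow_ext => a; rewrite bcompE.
  have [<-|ak] := eqVneq (size a) k.
    rewrite -[RHS](ga a); congr (g _).
    by rewrite /evec [hpr _ _](@hpr_hin R nat (tpow Hn) (size a)).
  rewrite [hpr k _](_ : _ = 0) ?bop0//.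
  exact: (@hin_neq R nat (tpow Hn) (size a) k).
apply: bopP => phi; rewrite bop0E; apply: (@hnorm_small _ _ _ (opnorm g)) => d d0.
have [A AP] := @hsum_approx _ _ _ phi d d0.
have -> : g phi = g (phi - \sum_(i <- A) hin i (phi i)).
  rewrite bopB bop_sum big1 ?subr0// => i _.
  exact: (congr1 (fun f : bop _ _ => f (phi i)) (gk i)).
by rewrite (le_trans (hnorm_opnorm _ _))// ler_wpM2l ?opnorm_ge0.
Qed.

Lemma fock_total (phi : fock Hn) : (forall a, <|phi, evec e a|> = 0) -> phi = 0.
Proof.
move=> h; apply: rank1_eq0; apply: fock_ext => a.
by rewrite rank1E dot_conj h rmorph0 scale0r.
Qed.

Section coefficients.
Variable D : hilbertType R.

(* The coefficient of [e_w] in an element of D ⊗ F^2. *)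
Definition fcoef w : bop (htensor D (fock Hn)) D := adj (tensl D (evec e w)).

Lemma dot_fcoef w xi d : <|fcoef w xi, d|> = <|xi, tens d (evec e w)|>.
Proof. by rewrite /fcoef -adjPr. Qed.

Lemma fcoef_tens w d phi : fcoef w (tens d phi) = <|phi, evec e w|> *: d.
Proof. by apply: dot_ext => d'; rewrite dot_fcoef dot_tens dotZl mulrC. Qed.

Lemma fcoef_ext xi eta : (forall w, fcoef w xi = fcoef w eta) -> xi = eta.
Proof.
move=> h; apply/eqP; rewrite -subr_eq0; apply/eqP; set z := _ - _.
apply: tens_total => d phi; rewrite -[tens d phi]/(tensr_bop (fock Hn) d phi).
rewrite adjPr [adj _ _](_ : _ = 0) ?dot0l//; apply: fock_total => a.
by rewrite -adjPr /z dotBl /= -!dot_fcoef h subrr.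
Qed.

Lemma fcoef_creation_nil i xi :
  fcoef [::] (tens_op (bid D) (creation e i) xi) = 0.
Proof.
rewrite -bcompE (_ : _ \bo _ = 0)//; apply: tens_ext => d phi.
by rewrite bcompE tens_opE fcoef_tens dot_creation_nil scale0r.
Qed.

Lemma fcoef_creation_cons i j w xi :
  fcoef (j :: w) (tens_op (bid D) (creation e i) xi) =
  if i == j then fcoef w xi else 0.
Proof.
have E : fcoef (j :: w) \bo tens_op (bid D) (creation e i) =
    if i == j then fcoef w else 0.
  apply: tens_ext => d phi; rewrite bcompE tens_opE fcoef_tens dot_creation_cons.
  case: eqP => _; first by rewrite mul1r fcoef_tens.
  by rewrite mul0r scale0r.
transitivity ((if i == j then fcoef w else 0) xi); last by case: ifP.
exact: (congr1 (fun f : bop (htensor D (fock Hn)) D => f xi) E).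
Qed.

Lemma fcoef_bessel xi (A : {fset seq 'I_n}) :
  fsum (fun w => hnorm (fcoef w xi) ^+ 2) A <= hnorm xi ^+ 2.
Proof.
rewrite /fsum; have tn w : hnorm (tens (fcoef w xi) (evec e w)) = hnorm (fcoef w xi).
  rewrite hnorm_tens [X in _ * X](_ : _ = 1) ?mulr1//.
  by apply/eqP; rewrite -(@eqrXn2 _ 2) ?hnorm_ge0// sqr_hnormE dot_evec eqxx expr1n.
under eq_bigr do rewrite -tn.
apply: bessel; first exact: fset_uniq.
  by move=> a b _ _ ab; rewrite dot_tens dot_evec (negPf ab) mulr0.
by move=> w _; rewrite -dot_fcoef dot_tens dot_evec eqxx mulr1.
Qed.

Variables (M : hilbertType R) (Theta : seq 'I_n -> bop M D).
Hypothesis Theta1 : forall N x,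
  \sum_(s <- short n N) hnorm (Theta s x) ^+ 2 <= hnorm x ^+ 2.

Let p N : bop M (htensor D (fock Hn)) :=
  \sum_(s <- short n N) tensl D (evec e (rev s)) \bo Theta s.

Let pE N x : p N x = \sum_(s <- short n N) tens (Theta s x) (evec e (rev s)).
Proof. exact: bop_sumE. Qed.

Let p_orth (r : seq (seq 'I_n)) x : uniq r ->
  hnorm (\sum_(s <- r) tens (Theta s x) (evec e (rev s))) ^+ 2 =
  \sum_(s <- r) hnorm (Theta s x) ^+ 2.
Proof.
move=> ur; rewrite hnorm_sum_orth// => [|a b _ _ ab]; last first.
  by rewrite dot_tens dot_evec (inj_eq (can_inj revK)) (negPf ab) mulr0.
apply: eq_bigr => s _; rewrite hnorm_tens [X in _ * X](_ : _ = 1) ?mulr1//.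
by apply/eqP; rewrite -(@eqrXn2 _ 2) ?hnorm_ge0// sqr_hnormE dot_evec eqxx expr1n.
Qed.

Let pB m k x : (m <= k)%N -> hnorm (p k x - p m x) ^+ 2 =
  \sum_(s <- short n k) hnorm (Theta s x) ^+ 2 - \sum_(s <- short n m) hnorm (Theta s
    x) ^+ 2.
Proof.
move=> mk; rewrite !pE (big_short_leq _ mk) [X in _ = _ - X](big_short_leq _ mk).
rewrite (bigID (fun s => (size s < m)%N)) /= addrAC subrr add0r.
rewrite [X in _ = X - _](bigID (fun s => (size s < m)%N)) /= addrAC subrr add0r.
by rewrite -big_filter p_orth ?filter_uniq ?short_uniq// big_filter.
Qed.

Let p1 N x : hnorm (p N x) <= 1 * hnorm x.
Proof.
by rewrite mul1r -(@ler_pXn2r _ 2) ?nnegrE ?hnorm_ge0// pE p_orth ?short_uniq.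
Qed.

Lemma fsymbol_cvg x : (fun N => p N x) @ \oo --> fsymbol e Theta x.
Proof.
have [|g gP] := @bop_pointwise_cvg _ _ _ p 1 _ p1.
  move=> y d d0; pose a m := \sum_(s <- short n m) hnorm (Theta s y) ^+ 2.
  have sa : has_sup (range a).
    by split; [exists (a 0%N), 0%N|exists (hnorm y ^+ 2) => _ [m _ <-]; exact: Theta1].
  (* By orthogonality the squared increments of the partial sums are increments of the bounded
     sequence [a], so it suffices that [a m] is within d^2 of its supremum. *)
  have [_ [m _ <-] mP] := sup_adherent (exprn_gt0 2 d0) sa.
  exists m => k mk; rewrite -(@ler_pXn2r _ 2) ?nnegrE ?hnorm_ge0 ?(ltW d0)// pB//.
  have : a k <= sup (range a) by apply: ub_le_sup; [exact: sa.2|exists k].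
  rewrite -/(a k) -/(a m); lra.
pose P (g : bop M (htensor D (fock Hn))) := forall x, (fun N : nat =>
  \sum_(k < N) \sum_(a : k.-tuple 'I_n) tens (Theta a x) (evec e (rev a))) @ \oo --> g x.
have pP y : (fun N => p N y) = fun N : nat =>
    \sum_(k < N) \sum_(a : k.-tuple 'I_n) tens (Theta a y) (evec e (rev a)).
  by apply/funext => N; rewrite pE big_short.
have Pg : exists g, P g by exists g => y; rewrite -pP; exact: gP.
by rewrite pP; exact: (the_bopP Pg x).
Qed.

Lemma hnorm_fsymbol x : hnorm (fsymbol e Theta x) <= hnorm x.
Proof.
have /hnorm_cvg := @fsymbol_cvg x; move/cvgr_to_le; apply; apply: nearW => N.
by rewrite -[leRHS]mul1r; exact: p1.
Qed.

Lemma fcoef_fsymbol w x : fcoef w (fsymbol e Theta x) = Theta (rev w) x.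
Proof.
have h := @bop_hnorm_cvg _ _ _ _ _ eventually_filter (fcoef w) _ _ (@fsymbol_cvg x).
have h2 : (fun N => fcoef w (p N x)) @ \oo --> Theta (rev w) x.
  apply/(@cvg_hnormP _ _ ((fun N => fcoef w (p N x)) @ \oo)) => d d0.
  exists (size w).+1 => // N /= wN.
  rewrite pE bop_sum (bigD1_seq (rev w)) ?short_uniq ?mem_short ?size_rev//=.
  rewrite fcoef_tens revK dot_evec eqxx scale1r [X in _ - (_ + X)]big1 ?addr0 ?subrr
    ?hnorm0// => s sw.
  rewrite fcoef_tens dot_evec (_ : _ == _ = false) ?scale0r//.
  by apply: contra_neqF sw => /eqP <-; rewrite revK.
by apply: (cvg_unique _ h h2); exact: norm_hausdorff.
Qed.

End coefficients.
End FockTheory.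

(** * The closed loop on the subspace where the Schur function is prescribed *)

Section LoopRestriction.
Variables (R : realType) (n : nat) (M D : hilbertType R) (N : closed_subspace M).
Variables (Psi : seq 'I_n -> bop M (hplus D (hpow M n))).
Variables (Om : bop (csub N) (hplus D (hpow M n))).
Hypothesis PsiOm : frestr Psi Om.

Let om i f : M := hpr i (hprr (Om f)).

Let Psi0 f : Psi [::] (csub_inc N f) = Om f.
Proof. by rewrite -bcompE PsiOm.1. Qed.

Let PsiS a f : (0 < size a)%N -> Psi a (csub_inc N f) = 0.
Proof. by move=> /PsiOm.2 h; rewrite -bcompE h. Qed.

Let total0 f : loop_total Psi [::] (csub_inc N f) = Om f.
Proof. by rewrite /loop_total big_ord_recl big_ord0 addr0; exact: Psi0. Qed.

Let total_rcons s i f :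
  (forall j, (j <= size s)%N -> loop_in Psi (rcons (drop j s) i) (csub_inc N f) =
     loop_in Psi (drop j s) (om i f)) ->
  loop_total Psi (rcons s i) (csub_inc N f) = loop_total Psi s (om i f).
Proof.
move=> h; rewrite /loop_total big_ord_recr /= take_size drop_size loop_in_nil.
rewrite PsiS ?size_rcons// addr0; apply: eq_bigr => j _.
have js : (j <= size s)%N by rewrite -ltnS.
by rewrite -{1}cats1 takel_cat// drop_rcons// h.
Qed.

(** An input from N produces [Om f] at the root and nothing afterwards, as the coefficients of
    nonempty words vanish on N. The nodes whose words end in i thus form the closed loop started
    from the component i of [Om f]. *)
Lemma loop_in_rcons s i f :
  loop_in Psi (rcons s i) (csub_inc N f) = loop_in Psi s (hpr i (hprr (Om f))).
Proof.
move: {2}(size s) (leqnn (size s)) => m; elim: m s => [|m IH] s.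
  by case: s => // _ /=; rewrite -hprr_loop_total total0.
case: s => [|j s] /=; first by move=> _; rewrite -hprr_loop_total total0.
rewrite ltnS => sm; rewrite -!hprr_loop_total total_rcons// => k ks.
by apply: IH; rewrite size_drop (leq_trans (leq_subr _ _)).
Qed.

Lemma loop_out_nil f : loop_out Psi [::] (csub_inc N f) = hprl (Om f).
Proof. by rewrite -hprl_loop_total total0. Qed.

Lemma loop_out_rcons s i f :
  loop_out Psi (rcons s i) (csub_inc N f) = loop_out Psi s (hpr i (hprr (Om f))).
Proof. by rewrite -!hprl_loop_total total_rcons// => j _; exact: loop_in_rcons. Qed.

End LoopRestriction.

(** * Realization *)

Section WordShift.
Variables (R : realType) (n : nat) (D : hilbertType R).

(** D ⊗ F^2 in coordinates, where a backward shift is a reindexing. *)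
Definition ell2 : hilbertType R := hsum (fun _ : seq 'I_n => D).

Implicit Types g h : ell2.

Lemma word_shift_exists i : exists s : bop ell2 ell2, forall g w, s g w = g (i :: w).
Proof.
have [|g A|s [sE _]] := @hsum_op_exists R _ (fun _ : seq 'I_n => D) ell2
    (fun w => hpr (i :: w)) 1; [exact: ler01| |by exists s].
rewrite mul1r; apply: le_trans (hsum_fsum_le g [fset i :: w | w in A]%fset).
by rewrite /fsum big_imfset//= => w w' _ _ [].
Qed.

Definition word_shift i : bop ell2 ell2 := sval (cid (word_shift_exists i)).

Lemma word_shiftE i g w : word_shift i g w = g (i :: w).
Proof. by rewrite /word_shift; case: cid. Qed.

Lemma adj_word_shift_nil i h : adj (word_shift i) h [::] = 0.
Proof.
apply: dot_ext => d; rewrite dot0l -dot_hinr -adjPr.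
rewrite [word_shift i _](_ : _ = 0) ?dot0r//; apply: hsum_ext => w.
by rewrite word_shiftE hin_neq.
Qed.

Lemma adj_word_shift_cons i j h w :
  adj (word_shift i) h (j :: w) = if i == j then h w else 0.
Proof.
apply: dot_ext => d; rewrite -dot_hinr -adjPr.
have -> : word_shift i (hin (j :: w) d) = if i == j then hin w d else 0.
  apply: hsum_ext => w'; rewrite word_shiftE.
  have [<-|ij] := eqVneq i j; last by rewrite hin_neq// eqseq_cons eq_sym (negPf ij).
  have [<-|ww'] := eqVneq w w'; first by rewrite -[LHS]/(hpr _ _) -[RHS]/(hpr _ _) !hpr_hin.
  by rewrite !hin_neq// eqseq_cons eqxx.
by case: eqP => _; rewrite ?dot_hinr// dot0r dot0l.
Qed.

(* [g] is recovered from its coefficient at the empty word and its shifts. *)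
Lemma hnorm_word_shift g :
  hnorm g ^+ 2 = hnorm (g [::]) ^+ 2 + \sum_i hnorm (word_shift i g) ^+ 2.
Proof.
have gE : g = hin [::] (g [::]) + \sum_i adj (word_shift i) (word_shift i g).
  apply: hsum_ext => -[|j w].
    rewrite -[RHS]/(hin [::] (g [::]) [::] + hsum_fun _ [::]) hsum_sumE.
    rewrite -[hin _ _ _]/(hpr _ _) hpr_hin big1 ?addr0// => i _.
    exact: adj_word_shift_nil.
  rewrite -[RHS]/(hin [::] (g [::]) (j :: w) + hsum_fun _ (j :: w)) hsum_sumE.
  rewrite hin_neq// add0r (bigD1 j)//= adj_word_shift_cons eqxx word_shiftE.
  by rewrite big1 ?addr0// => i ij; rewrite adj_word_shift_cons (negPf ij).
rewrite sqr_hnormE {2}gE dotDr dot_sumr dot_hinr raddfD/= -sqr_hnormE raddf_sum.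
congr (_ + _); apply: eq_bigr => i _ /=.
by rewrite -adjP -sqr_hnormE.
Qed.

End WordShift.
Arguments word_shift {R n D} i.

(* A contractive closed-loop system [(Y, U)] on the state space [E], in which the
   inputs [M] are embedded by the isometry [J]. Cutting the feedback through [J]
   leaves the open-loop system with transfer function [Psi]. *)
Section Colligation.
Variables (R : realType) (n : nat) (M D E : hilbertType R).
Variables (J : bop M E) (U : 'I_n -> bop E E) (Y : bop E D).
Hypothesis adjJJ : forall x, adj J (J x) = x.
Hypothesis U_energy : forall k,
  hnorm (Y k) ^+ 2 + \sum_i hnorm (U i k) ^+ 2 <= hnorm k ^+ 2.

Let hnormJ x : hnorm (J x) = hnorm x.
Proof.
by apply/eqP; rewrite -(@eqrXn2 _ 2) ?hnorm_ge0// sqr_hnormE adjPr adjJJ -sqr_hnormE.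
Qed.

Let PU i : bop E E := U i - J \bo (adj J \bo U i).
Let PUE i k : PU i k = U i k - J (adj J (U i k)). Proof. by []. Qed.
Let V : bop E (hplus D (hpow M n)) :=
  hinl \bo Y + hinr \bo (\sum_i hin i \bo (adj J \bo U i)).
Let VE k : V k = hinl (Y k) + hinr (colvec (fun i => adj J (U i k))).
Proof. by rewrite /V bopDE !bcompE bop_sumE. Qed.

Let hnorm_split u : hnorm u ^+ 2 = hnorm (adj J u) ^+ 2 + hnorm (u - J (adj J u)) ^+ 2.
Proof.
rewrite -{1}(subrK (J (adj J u)) u) addrC hnorm_orthD ?hnormJ//.
by rewrite adjP bopB adjJJ subrr dot0r.
Qed.

(** [V] outputs exactly the component of [U i k] in the range of [J] that [PU i] removes, so cutting
    the loop preserves the energy balance. *)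
Let V_energy k : hnorm (V k) ^+ 2 + \sum_i hnorm (PU i k) ^+ 2 <= hnorm k ^+ 2.
Proof.
apply: le_trans (U_energy k); rewrite VE hnorm_hplus hprl_pair hprr_pair -addrA lerD2l.
rewrite hnorm_hsum_fin -big_split /= ler_sum// => i _.
by rewrite colvecE [leRHS]hnorm_split.
Qed.

Let Ea a : bop M E := word_op PU a \bo J.
Definition colligation_fun a := V \bo Ea a.
Let Psi := colligation_fun.

Let col_contractive_Ea : col_contractive Ea.
Proof.
move=> k x; elim: k => [|k IH].
  by rewrite (big_tuple0 (fun a => hnorm (Ea a x) ^+ 2)) hnormJ.
rewrite (big_tuple_cons (fun a => hnorm (Ea a x) ^+ 2)) exchange_big.
apply: le_trans IH; apply: ler_sum => a _; apply: le_trans (V_energy (Ea a x)).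
by rewrite lerDr sqr_ge0.
Qed.

Let V1 k : hnorm (V k) <= hnorm k.
Proof.
rewrite -(@ler_pXn2r _ 2) ?nnegrE ?hnorm_ge0//; apply: le_trans (V_energy k).
by rewrite lerDl sumr_ge0// => i _; rewrite sqr_ge0.
Qed.

(** On N the next states lie in the range of [J], so [PU i] kills them and only the empty word
    contributes. *)
Lemma colligation_restr (N : closed_subspace M) (Om : bop (csub N) (hplus D (hpow M n))) :
  (forall f, Y (J (csub_inc N f)) = hprl (Om f)) ->
  (forall i f, U i (J (csub_inc N f)) = J (hpr i (hprr (Om f)))) ->
  frestr Psi Om.
Proof.
move=> YJ UJ.
split.
  apply: bopP => f; rewrite /Psi !bcompE VE; apply: hplus_ext; rewrite ?hprl_pair
    ?hprr_pair.
    exact: YJ.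
  by apply: hsum_ext => i; rewrite colvecE UJ adjJJ.
case/lastP => // a i _; apply: bopP => f.
rewrite /Psi /Ea !bcompE -cats1 word_op_cat bcompE -[word_op PU [:: i] _]/(PU i _).
by rewrite PUE UJ adjJJ subrr !bop0.
Qed.

Let loop_total_word s x :
  word_op U s (J x) = \sum_(j < (size s).+1) word_op PU (take j s) (J (loop_in Psi
    (drop j s) x)) ->
  loop_total Psi s x = V (word_op U s (J x)).
Proof. by move=> ->; rewrite bop_sum. Qed.

(** The closed-loop state at s is the superposition of the open-loop responses to the inputs at all
    suffixes of s. In the inductive step U_i splits into its part in the range of [J], which is the
    new input, and [PU i]. *)
Let word_split s x : word_op U s (J x) =
  \sum_(j < (size s).+1) word_op PU (take j s) (J (loop_in Psi (drop j s) x)).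
Proof.
elim: s => [|i s IH]; first by rewrite big_ord_recl big_ord0 addr0.
rewrite big_ord_recl -[word_op U (i :: s) _]/(U i (word_op U s (J x))).
have -> : loop_in Psi (drop (@ord0 (size s).+1) (i :: s)) x = adj J (U i (word_op U s
  (J x))).
  rewrite -[drop _ _]/(i :: s) -hprr_loop_total loop_total_word// VE hprr_pair.
  by rewrite -[LHS]/(colvec _ i) colvecE.
have UPU u : U i u = J (adj J (U i u)) + PU i u by rewrite PUE addrC subrK.
apply: (eq_trans (UPU _)).
apply: f_equal2.
  by [].
transitivity (PU i (\sum_(j < (size s).+1) word_op PU (take j s) (J (loop_in Psi (drop
  j s) x)))).
  by congr (PU i _); exact: IH.
by rewrite bop_sum; apply: eq_bigr.
Qed.

Lemma colligation_loop_out s x : loop_out Psi s x = Y (word_op U s (J x)).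
Proof. by rewrite -hprl_loop_total loop_total_word// VE hprl_pair. Qed.

Lemma colligation_free_holomorphic : free_holomorphic Psi.
Proof.
exact: col_contractive_free_holomorphic (col_contractive_comp V1 col_contractive_Ea).
Qed.

Variable Z : hilbertType R.

(** The state k solves k = J xi + q, where q is the sum of the z_i PU_i k and is orthogonal to J xi.
    Hence |k|^2 <= |xi|^2 + sum_i |PU_i k|^2, and the energy balance bounds |V k|^2 + sum_i |PU_i
    k|^2 by |k|^2. *)
Lemma colligation_norm : (fsup_norm Z Psi <= 1)%E.
Proof.
apply: ge_ereal_sup => _ [z zb <-]; rewrite lee_fin.
have [rho rho01 zr] := row_ball_bound zb.
have [Eis _] := feval_exists rho01 zr col_contractive_Ea.
apply/contractionP => xi.
rewrite (feval_eq (feval_is_comp V Eis)) bcompE; set k := feval Ea z xi.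
pose q := \sum_i tens_op (bid E) (z i) (tens_op (PU i) (bid Z) k).
have kE : k = tens_op J (bid Z) xi + q.
  have EaS i a : Ea (i :: a) = PU i \bo Ea a by exact: bopP.
  have := @feval_is_cons _ _ _ _ _ (fun i a => PU i \bo Ea a) Ea z _ EaS
    (fun i => feval_is_comp (PU i) Eis).
  by move=> /(feval_is_uniq Eis) wE; rewrite {1}/k wE bopDE bop_sumE.
have orth : <|tens_op J (bid Z) xi, q|> = 0.
  rewrite adjP adj_tens_op /q bop_sum big1 ?dot0r// => i _.
  rewrite -!bcompE -!tens_op_comp [_ \bo _ \bo _](_ : _ = 0).
    by rewrite tens_op0l.
  by apply: bopP => u; rewrite !bcompE PUE bopB adjJJ subrr.
have nk : hnorm k ^+ 2 <= hnorm xi ^+ 2 + \sum_i hnorm (tens_op (PU i) (bid Z) k) ^+ 2.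
  rewrite {1}kE hnorm_orthD// lerD//.
    rewrite lerXn2r ?nnegrE ?hnorm_ge0//; apply: tens_op_contraction => x.
    by rewrite hnormJ.
  apply: le_trans (tens_row_bound zr _) _; rewrite ler_piMl//.
    by rewrite sumr_ge0// => i _; rewrite sqr_ge0.
  by case/andP: rho01 => r0 /ltW r1; rewrite exprn_ile1.
(* The output [V] and the next states [PU i] form one column, with [None] indexing the output. *)
pose L (o : option 'I_n) : hilbertType R := if o is Some _ then E else hplus D (hpow M n).
pose c (o : option 'I_n) : bop E (L o) := match o with Some i => PU i | None => V end.
have := @tens_op_column _ _ _ (None :: [seq Some i | i <- enum 'I_n]) L Z c 1 _ ler01 k.
rewrite big_cons big_map big_enum mul1r /= => h.
have {}h : hnorm (tens_op V (bid Z) k) ^+ 2 + \sum_i hnorm (tens_op (PU i) (bid Z) k) ^+ 2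
    <= hnorm k ^+ 2.
  by apply: h => u; rewrite big_cons big_map big_enum mul1r; exact: V_energy.
rewrite -(@ler_pXn2r _ 2) ?nnegrE ?hnorm_ge0//; lra.
Qed.

End Colligation.

Section Realization.
Variables (R : realType) (n : nat) (M D : hilbertType R) (N : closed_subspace M).
Variables (Om : bop (csub N) (hplus D (hpow M n))) (gh : bop M (ell2 n D)).

Let om i f : M := hpr i (hprr (Om f)).
Let inc := csub_inc N.

Hypothesis Om1 : forall f, hnorm (Om f) <= hnorm f.
Hypothesis gh1 : contraction gh.
Hypothesis gh_nil : forall f, gh (inc f) [::] = hprl (Om f).
Hypothesis gh_cons : forall f i w, gh (inc f) (i :: w) = gh (om i f) w.

Let dg := defect gh.

Let dgE x : hnorm (dg x) ^+ 2 = hnorm x ^+ 2 - hnorm (gh x) ^+ 2.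
Proof. by rewrite -hnorm_defect// hnorm_to_clrange. Qed.

Let shift_gh f i : word_shift i (gh (inc f)) = gh (om i f).
Proof. by apply: hsum_ext => w; rewrite word_shiftE gh_cons. Qed.

(** By the equations for [gh], |gh f|^2 = |Omega_1 f|^2 + sum_i |gh (om i f)|^2. Subtracting this
    from |Omega f|^2 <= |f|^2 leaves sum_i |dg (om i f)|^2 <= |dg f|^2, so the factorization lemma
    applies. *)
Let W_exists : exists W : bop M (hpow M n),
  (forall f, W (dg (inc f)) = colvec (fun i => dg (om i f))) /\
  forall v, hnorm (W v) <= hnorm v.
Proof.
pose g : bop (csub N) (hpow M n) := \sum_i hin i \bo (dg \bo hpr i \bo hprr \bo Om).
have gE f : g f = colvec (fun i => dg (om i f)) by rewrite bop_sumE.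
have [|W [WE W1]] := @factor_through_clrange _ _ _ _ (dg \bo inc) g.
  move=> f; rewrite -(@ler_pXn2r _ 2) ?nnegrE ?hnorm_ge0// gE hnorm_hsum_fin dgE.
  under eq_bigr do rewrite colvecE dgE.
  have nsum : hnorm (gh (inc f)) ^+ 2 =
      hnorm (hprl (Om f)) ^+ 2 + \sum_i hnorm (gh (om i f)) ^+ 2.
    rewrite hnorm_word_shift gh_nil; congr (_ + _); apply: eq_bigr => i _.
    by rewrite shift_gh.
  have : hnorm (Om f) ^+ 2 <= hnorm f ^+ 2 by rewrite lerXn2r ?nnegrE ?hnorm_ge0.
  have nf : hnorm f = hnorm (inc f) by exact: csub_norm.
  have nom : \sum_i hnorm (om i f) ^+ 2 = hnorm (hprr (Om f)) ^+ 2.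
    by rewrite hnorm_hsum_fin.
  by rewrite hnorm_hplus nf sumrB nsum nom; lra.
by exists W; split=> // f; rewrite -gE -WE.
Qed.

Let W := sval (cid W_exists).
Let WE f : W (dg (inc f)) = colvec (fun i => dg (om i f)).
Proof. by rewrite /W; case: cid => ? []. Qed.
Let W1 v : hnorm (W v) <= hnorm v.
Proof. by rewrite /W; case: cid => ? []. Qed.

Let E : hilbertType R := hplus (ell2 n D) M.
Let J : bop M E := hinl \bo gh + hinr \bo dg.
Let JE x : J x = hinl (gh x) + hinr (dg x). Proof. by []. Qed.
Let U i : bop E E := hinl \bo (word_shift i \bo hprl) + hinr \bo (hpr i \bo W \bo hprr).
Let UE i k : U i k = hinl (word_shift i (hprl k)) + hinr (hpr i (W (hprr k))).
Proof. by []. Qed.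
Let Y : bop E D := hpr [::] \bo hprl.

Let adjJJ x : adj J (J x) = x.
Proof.
apply: dot_ext => y; rewrite -adjPr !JE hplus_dot !hprl_pair !hprr_pair.
have [d0 dd] := bsqrtP (bpos_defect gh1).
rewrite [<|dg x, _|>](bpos_selfadjoint d0).
have -> : dg (dg y) = y - adj gh (gh y).
  exact: (congr1 (fun f : bop M M => f y) dd).
by rewrite dotBr adjP addrC subrK.
Qed.

Let UJ i f : U i (J (inc f)) = J (om i f).
Proof.
rewrite UE JE hprl_pair hprr_pair WE shift_gh -[hpr i _]/(colvec _ i).
by rewrite (colvecE (fun i => dg (om i f))).
Qed.

Let U_energy k : hnorm (Y k) ^+ 2 + \sum_i hnorm (U i k) ^+ 2 <= hnorm k ^+ 2.
Proof.
rewrite [leRHS]hnorm_hplus hnorm_word_shift -addrA lerD2l.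
under eq_bigr do rewrite UE hnorm_hplus hprl_pair hprr_pair.
rewrite big_split lerD2l -hnorm_hsum_fin lerXn2r ?nnegrE ?hnorm_ge0//.
Qed.

(** The last letter of a acts first and strips the first letter of the coefficient, whence the same
    reversal as in the symbol. *)
Let word_U_coef a k w : hprl (word_op U a k) w = hprl k (rev a ++ w).
Proof.
elim: a w => [//|i a IH] w.
rewrite -[word_op U (i :: a) _]/(U i (word_op U a k)) UE hprl_pair word_shiftE IH.
by rewrite rev_cons cat_rcons.
Qed.

Lemma schur_realization (Z : hilbertType R) :
  exists F : seq 'I_n -> bop M (hplus D (hpow M n)),
  [/\ free_holomorphic F, (fsup_norm Z F <= 1)%E, frestr F Om &
      forall a x, loop_out F a x = gh x (rev a)].
Proof.
exists (colligation_fun J U Y); split.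
- exact: colligation_free_holomorphic.
- exact: colligation_norm.
- apply: colligation_restr => //.
  by move=> f; rewrite /Y bcompE JE hprl_pair -gh_nil.
- move=> a x; rewrite colligation_loop_out// -[LHS]/(hprl (word_op U a (J x)) [::]).
  by rewrite word_U_coef JE hprl_pair cats0.
Qed.

End Realization.

(** * Contractive interpolants *)

Lemma binv_eq (R : realType) (H : hilbertType R) (f g : bop H H) :
  is_inverse f g -> binv f = g.
Proof.
move=> fg; have [fgE _] := fg; apply: the_bop_eq => // h [_ hf].
have pE (u v : bop H H) x : u = v -> u x = v x by move=> ->.
apply: bopP => x; rewrite -[LHS]/(h (bid H x)) -(pE _ _ x fgE).
exact: pE (g x) hf.
Qed.

Section GNCL.
Variables (R : realType) (n : nat) (Hn Z H X : hilbertType R).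
Variables (G : 'I_n -> hilbertType R) (e : 'I_n -> Hn).
Variables (A : bop X H) (T : 'I_n -> bop H H) (C Q : forall i, bop (G i) X).
Hypothesis e_onb : is_onb e.
Hypothesis iZ : infinite_dim Z.
Hypothesis data : gncl_data A T C Q.

Let DA := defect_space A.
Let DT := row_defect_space T.
Let F := Fspace A Q.
Let Om : bop (csub F) (hplus DT (hpow DA n)) := Omega A T C Q.

Let Tc : row_contraction T. Proof. by case: data. Qed.
Let Ac : contraction A. Proof. by case: data. Qed.
Let TAC i : T i \bo A \bo C i = A \bo Q i. Proof. by case: data. Qed.

Let QC_le (y : hsum G) : \sum_i hnorm (C i (y i)) ^+ 2 <= hnorm (\sum_i Q i (y i)) ^+ 2.
Proof.
case: data => _ QC _ _; have := bpos_Re y QC.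
rewrite bopBE dotBl raddfB/= subr_ge0 !dot_blockop.
congr (_ <= _).
  rewrite raddf_sum; apply: eq_bigr => i _ /=.
  rewrite (bigD1 i)//= eqxx big1 ?addr0; first by rewrite hnorm_adj_comp.
  by move=> j ji; rewrite eq_sym (negPf ji) dot0l.
rewrite sqr_hnormE dot_sumr; congr (complex.Re _); apply: eq_bigr => i _.
by rewrite dot_suml; apply: eq_bigr => j _; rewrite bcompE -adjPr.
Qed.

Let defectQE (y : hsum G) : defectQ A Q y = to_defect A (\sum_i Q i (y i)).
Proof. by rewrite bop_sumE bop_sum. Qed.

Let Om_col (y : hsum G) : hplus DT (hpow DA n) :=
  hinl (to_row_defect T (colvec (fun i => A (C i (y i))))) +
  hinr (colvec (fun i => to_defect A (C i (y i)))).

(** The terms |A C_i y_i|^2 of the two components cancel, and T_i A C_i = A Q_i turns the remainder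
    into sum_i |C_i y_i|^2 - |A q|^2 with q = sum_i Q_i y_i. By the inequality between C and Q this
    is at most |q|^2 - |A q|^2 = |D_A q|^2. *)
Let hnorm_Om_col y : hnorm (Om_col y) <= hnorm (defectQ A Q y).
Proof.
rewrite -(@ler_pXn2r _ 2) ?nnegrE ?hnorm_ge0// hnorm_hplus hprl_pair hprr_pair.
rewrite hnorm_to_row_defect// defectQE hnorm_defect// !hnorm_hsum_fin.
have -> : \sum_i T i (colvec (fun i => A (C i (y i))) i) = A (\sum_i Q i (y i)).
  rewrite bop_sum; apply: eq_bigr => i _; rewrite colvecE.
  exact: (congr1 (fun f : bop _ _ => f (y i)) (TAC i)).
under eq_bigr do rewrite colvecE.
under [X in _ - _ + X]eq_bigr do rewrite colvecE hnorm_defect//.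
by rewrite sumrB; have := QC_le y; lra.
Qed.

Let Om_exists : exists w : bop (csub F) (hplus DT (hpow DA n)),
  (forall y, w (to_clrange (defectQ A Q) y) = Om_col y) /\
  forall v, hnorm (w v) <= hnorm v.
Proof.
pose g : bop (hsum G) (hplus DT (hpow DA n)) :=
  hinl \bo to_row_defect T \bo (\sum_i hin i \bo (A \bo C i \bo hpr i)) +
  hinr \bo (\sum_i hin i \bo (to_defect A \bo C i \bo hpr i)).
have gE y : g y = Om_col y.
  by rewrite bopDE !bcompE [X in hinl (_ X)]bop_sumE [X in hinr X]bop_sumE.
have [y|w [wE w1]] := @clrange_factor _ _ _ _ (defectQ A Q) g.
  by rewrite gE hnorm_Om_col.
by exists w; split=> // y; rewrite wE gE.
Qed.

Let OmE y : Om (to_clrange (defectQ A Q) y) = Om_col y.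
Proof.
pose P (w : bop (csub F) (hplus DT (hpow DA n))) :=
  forall y, w (to_clrange (defectQ A Q) y) = Om_col y.
have Pw : exists w, P w by have [w [wE _]] := Om_exists; exists w.
exact: (the_bopP Pw y).
Qed.

Let Om1 f : hnorm (Om f) <= hnorm f.
Proof.
have [w [wE w1]] := Om_exists.
have -> : Om = w by apply: clrange_ext => y; rewrite OmE wE.
exact: w1.
Qed.

Lemma schur_transfer (Psi : seq 'I_n -> bop DA (schur_target A T)) :
  (fsup_norm Z Psi <= 1)%E -> transfer_formula Z Psi (loop_out Psi).
Proof.
move=> Psi1 z zb.
have [inv ->] : is_inverse (pencil Psi z) (feval (loop_in Psi) z) /\
    feval (loop_out Psi) z = feval (entryL Psi) z \bo feval (loop_in Psi) z.
  exact: loop_transfer.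
by rewrite (binv_eq inv); split=> //; exists (feval (loop_in Psi) z).
Qed.

Lemma schur_H2ball (Psi : seq 'I_n -> bop DA (schur_target A T)) :
  (fsup_norm Z Psi <= 1)%E -> H2ball (loop_out Psi).
Proof.
by move=> Psi1; apply: short_contractive_H2ball => N x; exact: (loop_out_contractive iZ
  Psi1).
Qed.

Lemma transfer_formula_uniq (Psi : seq 'I_n -> bop DA (schur_target A T)) Theta Theta' :
  transfer_formula Z Psi Theta -> transfer_formula Z Psi Theta' -> Theta = Theta'.
Proof.
move=> h h'; apply: (feval_inj iZ) => z zb.
by have [_ ->] := h z zb; have [_ ->] := h' z zb.
Qed.

Let dilationE i k : dilation e T i k = hinl (T i (hprl k)) +
  hinr (tens (to_row_defect T (hin i (hprl k))) (evec e [::]) +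
        tens_op (bid DT) (creation e i) (hprr k)).
Proof. by []. Qed.

Let om i f : DA := hpr i (hprr (Om f)).

Let F_defectQ y : csub_inc F (to_clrange (defectQ A Q) y) = defectQ A Q y.
Proof. by []. Qed.

Let om_defectQ i y : om i (to_clrange (defectQ A Q) y) = to_defect A (C i (y i)).
Proof. by rewrite /om OmE /Om_col hprr_pair -[LHS]/(colvec _ i) colvecE. Qed.

Let hprl_Om_defectQ y : hprl (Om (to_clrange (defectQ A Q) y)) =
  to_row_defect T (colvec (fun i => A (C i (y i)))).
Proof. by rewrite OmE /Om_col hprl_pair. Qed.

Let defectQ_hin i y : defectQ A Q (hin i y) = to_defect A (Q i y).
Proof.
rewrite defectQE (bigD1 i)//= -[hin_fun y i]/(hpr i (hin i y)) hpr_hin big1 ?addr0// =>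
  j ji.
by rewrite hin_fun_neq ?bop0// eq_sym.
Qed.

Lemma interpolant_of_schur (Psi : seq 'I_n -> bop DA (schur_target A T)) :
  schur_class_Omega Z C Q Psi ->
  contractive_interpolant e A C Q
    (hinl \bo A + hinr \bo (fsymbol e (loop_out Psi) \bo to_defect A)).
Proof.
move=> [_ Psi1 PsiOm].
have Theta1 N x := loop_out_contractive iZ Psi1 N x.
have BE x : (hinl \bo A + hinr \bo (fsymbol e (loop_out Psi) \bo to_defect A)) x =
  hinl (A x) + hinr (fsymbol e (loop_out Psi) (to_defect A x)) :> dilation_space Hn T by [].
split.
- apply/contractionP => x; rewrite -(@ler_pXn2r _ 2) ?nnegrE ?hnorm_ge0//.
  rewrite BE hnorm_hplus hprl_pair hprr_pair.
  rewrite -lerBrDl -(hnorm_defect x Ac) lerXn2r ?nnegrE ?hnorm_ge0//.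
  exact: (hnorm_fsymbol e_onb Theta1).
- by apply: bopP => x; rewrite bcompE BE hprl_pair.
move=> i; apply: bopP => y; rewrite !bcompE dilationE !BE hprl_pair hprr_pair.
have -> : T i (A (C i y)) = A (Q i y) by exact: (congr1 (fun f : bop _ _ => f y) (TAC i)).
(* The D ⊗ F^2 components are compared by coefficients: the empty word gives Omega_1, and a word j w
   gives the component j of Omega_2, nonzero only for j = i. *)
congr (_ + hinr _); apply: (fcoef_ext e_onb) => w.
pose f : csub F := to_clrange (defectQ A Q) (hin i y).
have fE : to_defect A (Q i y) = csub_inc F f by rewrite F_defectQ defectQ_hin.
rewrite bopD fcoef_tens fcoef_fsymbol// fE; case: w => [|j w].
  rewrite fcoef_creation_nil// addr0 dot_evec// eqxx scale1r (loop_out_nil PsiOm).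
  rewrite hprl_Om_defectQ; congr (to_row_defect T _); apply: hsum_ext => j; rewrite colvecE.
  have [<-|ij] := eqVneq i j; last by rewrite !hin_neq// !bop0.
  by rewrite -![hin i _ i]/(hpr i _) !hpr_hin.
rewrite fcoef_creation_cons// dot_evec// scale0r add0r rev_cons (loop_out_rcons PsiOm).
rewrite -/(om j f) om_defectQ.
have [<-|ij] := eqVneq i j; last by rewrite hin_neq// !bop0.
by rewrite fcoef_fsymbol// -[hin i y i]/(hpr i _) hpr_hin.
Qed.

Lemma schur_of_interpolant (B : bop X (dilation_space Hn T)) :
  contractive_interpolant e A C Q B ->
  exists Psi : seq 'I_n -> bop DA (schur_target A T), schur_class_Omega Z C Q Psi /\
    B = hinl \bo A + hinr \bo (fsymbol e (loop_out Psi) \bo to_defect A).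
Proof.
move=> [/contractionP B1 BA BV].
have hprlB x : hprl (B x) = A x by exact: (congr1 (fun f : bop _ _ => f x) BA).
(* Contractivity of [B] bounds its second component at x by |x|^2 - |A x|^2 = |D_A x|^2 in squared
   norm, so that component factors through D_A. *)
have [x|Gam [GamE Gam1]] := @clrange_factor _ _ _ _ (defect A) (hprr \bo B).
  have := hnorm_defect x Ac; rewrite hnorm_to_clrange => dA.
  rewrite -(@ler_pXn2r _ 2) ?nnegrE ?hnorm_ge0// dA lerBrDl -hprlB.
  by rewrite -(hnorm_hplus (B x)) lerXn2r ?nnegrE ?hnorm_ge0.
have {}GamE x : Gam (to_defect A x) = hprr (B x) by rewrite [LHS]GamE.
have [|x S|gh [ghE gh1]] := @hsum_op_exists R _ (fun _ : seq 'I_n => DT) DA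
    (fun w => fcoef e DT w \bo Gam) 1; first exact: ler01.
  rewrite mul1r; apply: le_trans (fcoef_bessel e_onb (Gam x) S) _.
  by rewrite lerXn2r ?nnegrE ?hnorm_ge0.
(* The second components of V_i B C_i y_i = B Q_i y_i, summed over i. *)
have GamQ y : Gam (defectQ A Q y) =
    tens (to_row_defect T (colvec (fun i => A (C i (y i))))) (evec e [::]) +
    \sum_i tens_op (bid DT) (creation e i) (Gam (to_defect A (C i (y i)))).
  rewrite defectQE [LHS]GamE !bop_sum.
  rewrite (big_morph (fun x => tens x (evec e [::])) (fun u v => tensDl u v _) (id1 :=
    0)); last first.
    by rewrite -(scale0r (0 : DT)) tensZl scale0r.
  rewrite -big_split; apply: eq_bigr => i _.
  have <- : dilation e T i (B (C i (y i))) = B (Q i (y i)).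
    exact: (congr1 (fun f : bop _ _ => f (y i)) (BV i)).
  by rewrite dilationE hprr_pair hprlB GamE.
have coefQ v y : gh (defectQ A Q y) v =
    <|evec e [::], evec e v|> *: to_row_defect T (colvec (fun i => A (C i (y i)))) +
    \sum_i fcoef e DT v (tens_op (bid DT) (creation e i) (Gam (to_defect A (C i (y i))))).
  by rewrite ghE bcompE GamQ (bopD (fcoef e DT v)) fcoef_tens (bop_sum (fcoef e DT v)).
have gh_nil f : gh (csub_inc F f) [::] = hprl (Om f).
  have E : hpr [::] \bo (gh \bo csub_inc F) = hprl \bo Om.
    apply: clrange_ext => y; transitivity (gh (defectQ A Q y) [::]); first by [].
    rewrite coefQ [RHS]hprl_Om_defectQ dot_evec// eqxx scale1r big1 ?addr0// => i _.
    exact: fcoef_creation_nil.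
  exact: (congr1 (fun g : bop _ _ => g f) E).
have gh_cons f i w : gh (csub_inc F f) (i :: w) = gh (om i f) w.
  have E : hpr (i :: w) \bo (gh \bo csub_inc F) = hpr w \bo (gh \bo (hpr i \bo hprr \bo
    Om)).
    apply: clrange_ext => y; transitivity (gh (defectQ A Q y) (i :: w)); first by [].
    transitivity (gh (om i (to_clrange (defectQ A Q) y)) w); last by [].
    rewrite om_defectQ coefQ dot_evec// scale0r add0r (bigD1 i)//= big1 ?addr0 => [|j ji].
      by rewrite fcoef_creation_cons// eqxx [RHS]ghE.
    by rewrite fcoef_creation_cons// (negPf ji).
  exact: (congr1 (fun g : bop _ _ => g f) E).
have ghc : contraction gh by apply/contractionP => x; rewrite -[leRHS]mul1r.
have [Psi [Psih Psi1 PsiOm PsiE]] := schur_realization Om1 ghc gh_nil gh_cons Z.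
exists Psi; split=> //; apply: bopP => x.
apply: hplus_ext; first by rewrite hprlB [RHS]hprl_pair.
rewrite -GamE [RHS]hprr_pair bcompE; apply: (fcoef_ext e_onb) => w.
rewrite fcoef_fsymbol//; last by move=> N u; exact: (loop_out_contractive iZ Psi1).
by rewrite PsiE revK ghE.
Qed.

End GNCL.

Theorem theorem4p2 (R : realType) (n : nat) (Hn Z H X : hilbertType R)
    (G : 'I_n -> hilbertType R) (e : 'I_n -> Hn)
    (A : bop X H) (T : 'I_n -> bop H H) (C Q : forall i, bop (G i) X) :
  (0 < n)%N -> is_onb e -> infinite_dim Z -> gncl_data A T C Q ->
  (forall Psi : seq 'I_n -> bop (defect_space A) (schur_target A T),
     schur_class_Omega Z C Q Psi ->
     exists Theta : seq 'I_n -> bop (defect_space A) (row_defect_space T),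
       H2ball Theta /\ transfer_formula Z Psi Theta) /\
  (forall B : bop X (dilation_space Hn T),
     contractive_interpolant e A C Q B <->
     exists Psi : seq 'I_n -> bop (defect_space A) (schur_target A T),
     exists Theta : seq 'I_n -> bop (defect_space A) (row_defect_space T),
       [/\ schur_class_Omega Z C Q Psi,
           H2ball Theta,
           transfer_formula Z Psi Theta &
           B = hinl \bo A + hinr \bo (fsymbol e Theta \bo to_defect A)]).
Proof.
move=> _ e_onb iZ data; split=> [Psi [_ Psi1 _]|B].
  by exists (loop_out Psi); split; [exact: schur_H2ball iZ _ Psi1|exact: schur_transfer].
split=> [/(schur_of_interpolant e_onb iZ data)[Psi [PsiO ->]]|].
  have [_ Psi1 _] := PsiO; exists Psi, (loop_out Psi); split=> //.
    exact: schur_H2ball iZ _ Psi1.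
  exact: schur_transfer.
move=> [Psi [Theta [PsiO _ tf ->]]].
have [_ Psi1 _] := PsiO.
(* The given [Theta] has the same values as the closed loop of [Psi], hence the same coefficients
   and the same symbol. *)
rewrite (transfer_formula_uniq iZ tf (schur_transfer iZ Psi1)).
exact: interpolant_of_schur PsiO.
Qed.
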